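(* Suppose that there are constants $\gamma,\alpha,\delta>0$ independent of $N$ such that the tensor $A$ satisfies: - (bounded row sums) $\max_{i\in[N]}\sum_{j,k}A_{ijk}\le\gamma$; - (mean-field condition) $\big\|\sum_iA_i^2\big\|_{\mathrm{op}}=o((\log N)^{-1})$; - (asymptotic regularity) $\sum_i(\mathcal R_i-\bar{\mathcal R})^2=o(N)$; - (non-degeneracy) $\bar{\mathcal R}\ge\alpha$ and $\mathcal R_i>0$ for all $i\in[N]$; - (spectral gap) $1-\lambda_2\ge\delta$, where $1=\lambda_1\ge\lambda_2\ge\dots\ge\lambda_N\ge-1$ are the (real) eigenvalues of $\mathcal P=D^{-1}\mathcal R$, $D=\mathrm{diag}(\mathcal R_1,\dots,\mathcal R_N)$. Assume that the reference measure $\mu$ is stochastically non-negative. Let $X\sim P_{\beta_0,h_0}$ with fixed $\beta_0>0$ and $h_0\ge0$. If either (i) $h_0>0$ or (ii) $\kappa_-\ge0$, then $$T_N(X)=o_p(1).$$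
   Context: Setting. $\kappa_-<\kappa_+$ are real numbers, $\mu$ is a fixed probability measure on $[\kappa_-,\kappa_+]$ with $\kappa_-,\kappa_+\in\mathrm{supp}(\mu)$, and $\Lambda(\lambda)=\log\int e^{\lambda z}\,d\mu(z)$ for $\lambda\in\mathbb R$. For each $N$, $A=A^{(N)}=(A_{ijk})_{i,j,k\in[N]}$ is a 3-tensor with nonnegative entries, invariant under permutations of its indices, with $A_{ijk}=0$ unless $i,j,k$ are all distinct. $A_i=(A_{ijk})_{j,k\in[N]}$ is the $i$-th matrix slice; $\mathcal R_{ij}=\sum_kA_{ijk}$ (with $\mathcal R=(\mathcal R_{ij})$ the corresponding symmetric matrix), $\mathcal R_i=\sum_{j,k}A_{ijk}$, $\bar{\mathcal R}=\frac1N\sum_i\mathcal R_i$. For $\beta,h\in\mathbb R$, $P_{\beta,h}$ is the probability measure on $[\kappa_-,\kappa_+]^N$ with density $$\frac{dP_{\beta,h}}{d\mu^{\otimes N}}(x)=\frac{e^{f(x)}}{Z_N(\beta,h)},\qquad f(x)=\frac{\beta}{3}\sum_{i,j,k}A_{ijk}x_ix_jx_k+h\sum_i x_i,$$ where $Z_N(\beta,h)$ is the normalizing constant. Put $m_i(x)=\sum_{j,k}A_{ijk}x_jx_k$, $\bar m(x)=\frac1N\sum_i m_i(x)$, $T_N(x)=\frac1N\sum_i(m_i(x)-\bar m(x))^2$. Rate function: for $t\in\mathbb R$, $I(t)=\sup_{\lambda\in\mathbb R}(\lambda t-\Lambda(\lambda))\in[0,\infty]$ (equal to $+\infty$ for $t\notin[\kappa_-,\kappa_+]$).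 The measure $\mu$ is stochastically non-negative if $I(t)\le I(-t)$ for all $t\ge0$. $T_N(X)=o_p(1)$ means $T_N(X)\to0$ in $P_{\beta_0,h_0}$-probability. All asymptotics are as $N\to\infty$. *)

(* Defs.v *)
From HB Require Import structures.
From mathcomp Require Import all_boot all_order all_algebra.
From mathcomp Require Import all_classical all_reals all_analysis.

Set Implicit Arguments.
Unset Strict Implicit.
Unset Printing Implicit Defensive.

Import Order.TTheory GRing.Theory Num.Theory.
Import numFieldNormedType.Exports.

Local Open Scope classical_set_scope.
Local Open Scope ring_scope.

Section product_probability.
Local Open Scope ereal_scope.
Context d1 d2 (T1 : measurableType d1) (T2 : measurableType d2)
  (R : realType).

Definition prod_prob (P : probability T1 R) (Q : probability T2 R)
  : set (T1 * T2) -> \bar R := P \x Q.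

Context (P : probability T1 R) (Q : probability T2 R).

HB.instance Definition _ := Measure.copy (prod_prob P Q) (P \x Q).

Let prod_prob_setT : prod_prob P Q setT = 1.
Proof.
rewrite /prod_prob -setXTT product_measure1E//.
by rewrite -[RHS]mule1; congr (_ * _); exact: probability_setT.
Qed.

HB.instance Definition _ :=
  Measure_isProbability.Build _ _ _ (prod_prob P Q) prod_prob_setT.

End product_probability.

Section power_probability.
Context d (T : measurableType d) (R : realType) (P : probability T R).

Definition tuple_cons n (x : T * n.-tuple T) : n.+1.-tuple T :=
  [tuple of x.1 :: x.2].

Lemma measurable_tuple_cons n : measurable_fun setT (@tuple_cons n).
Proof. by apply: measurable_cons. Qed.

HB.instance Definition _ n :=
  isMeasurableFun.Build _ _ _ _ (@tuple_cons n) (@measurable_tuple_cons n).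

(* The product measure of n copies of P, on T^n represented by n-tuples. *)
Fixpoint power_prob n : probability (n.-tuple T) R :=
  match n with
  | 0 => \d_([tuple] : 0.-tuple T)
  | m.+1 => distribution (prod_prob P (power_prob m)) (@tuple_cons m)
  end.

Lemma power_probE n (A : 'I_n -> set T) : (forall i, measurable (A i)) ->
  power_prob n [set x | forall i, A i (tnth x i)] = (\prod_(i < n) P (A i))%E.
Proof.
elim: n A => [|n IH] A mA /=.
  rewrite big_ord0 diracE mem_set//; by case.
rewrite big_ord_recl -IH; last by move=> i; exact: mA.
rewrite /distribution /pushforward.
rewrite -(@product_measure1E _ _ _ _ _ P (power_prob n))//.
- congr (_ _); apply/seteqP; split => -[x t] /=.
  + move=> h; split; first by have := h ord0.
    by move=> i; have := h (lift ord0 i); rewrite tnthS.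
  + case=> h0 h i; case: (unliftP ord0 i) => [j|] ->//.
    by rewrite tnthS; exact: h.
- rewrite (_ : [set x | _] = \bigcap_(i in [set: 'I_n])
      ((fun t : n.-tuple T => tnth t i) @^-1` A (lift ord0 i))).
    apply: fin_bigcap_measurable; first exact: finite_finset.
    move=> i _; rewrite -[X in measurable X]setTI.
    exact: (measurable_tnth i).
  by apply/seteqP; split => t /= h i; [move=> _|]; exact: h.
Qed.

End power_probability.

Section reference_measure.
Context {R : realType} (mu : probability (measurableTypeR R) R).

Definition supp : set R := [set x | forall U : set R, open U -> U x -> (0 < mu U)%E].

Definition log_mgf (l : R) : R := ln (\int[mu]_z expR (l * z)).

Definition rate (t : R) : \bar R :=
  ereal_sup [set (l * t - log_mgf l)%:E | l in [set: R]].

Definition stochastically_nonnegative : Prop :=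
  forall t, 0 <= t -> (rate t <= rate (- t))%E.

End reference_measure.

Section matrices.
Context {R : realType}.

Definition l2norm n (v : 'cV[R]_n) : R := Num.sqrt (\sum_i v i 0 ^+ 2).

Definition opnorm n (M : 'M[R]_n) : R :=
  sup [set l2norm (M *m v) | v in [set v : 'cV[R]_n | l2norm v <= 1]].

(* s lists the eigenvalues of M, all real, in decreasing order and with
   multiplicity: s`_0 is lambda_1, s`_1 is lambda_2, and so on. *)
Definition is_spectrum n (M : 'M[R]_n) (s : seq R) : Prop :=
  sorted >=%R s /\ char_poly M = \prod_(l <- s) ('X - l%:P).

End matrices.

Section tensors.
Context {R : realType} {N : nat} (A : 'I_N -> 'I_N -> 'I_N -> R).

Definition interaction_tensor : Prop :=
  [/\ forall i j k, 0 <= A i j k,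
      forall i j k, [/\ A i k j = A i j k, A j i k = A i j k,
        A j k i = A i j k, A k i j = A i j k & A k j i = A i j k] &
      forall i j k, ~~ [&& i != j, i != k & j != k] -> A i j k = 0].

Definition slice (i : 'I_N) : 'M[R]_N := \matrix_(j, k) A i j k.

Definition pair_sum : 'M[R]_N := \matrix_(i, j) \sum_k A i j k.

Definition row_sum (i : 'I_N) : R := \sum_j \sum_k A i j k.

Definition mean_row_sum : R := N%:R^-1 * \sum_i row_sum i.

Definition transition : 'M[R]_N :=
  invmx (diag_mx (\row_i row_sum i)) *m pair_sum.

Definition hamiltonian (beta h : R) (x : N.-tuple R) : R :=
  beta / 3 * (\sum_i \sum_j \sum_k A i j k * tnth x i * tnth x j * tnth x k)
  + h * \sum_i tnth x i.

Definition local_field (x : N.-tuple R) (i : 'I_N) : R :=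
  \sum_j \sum_k A i j k * tnth x j * tnth x k.

Definition mean_local_field (x : N.-tuple R) : R :=
  N%:R^-1 * \sum_i local_field x i.

Definition T_stat (x : N.-tuple R) : R :=
  N%:R^-1 * \sum_i (local_field x i - mean_local_field x) ^+ 2.

Context (mu : probability (measurableTypeR R) R).

Definition partition_function (beta h : R) : R :=
  \int[power_prob mu N]_x expR (hamiltonian beta h x).

(* mu is carried by a compact interval, so the configurations outside the cube
   [kappa_-, kappa_+]^N are null for power_prob mu N. *)
Definition gibbs (beta h : R) (E : set (N.-tuple R)) : \bar R :=
  \int[power_prob mu N]_(x in E)
    (expR (hamiltonian beta h x) / partition_function beta h)%:E.

End tensors.

(* Main.v *)
(* Write [u_i(y)] for the mean of the [i]th spin given the others, a tilted mean of
   [mu] with parameter [beta m_i(y) + h]. An exchangeable-pair type second moment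
   computation shows that under the Gibbs measure [y] can be replaced by [u(y)]
   in the fields [m_i] and in the energy, with an error [o(N)]; the mean-field condition
   enters only through [sum_ij R_ij^2 = o(N)], obtained by testing the operator norm
   against the constant vector.
   The weight of such configurations is controlled by the mean-field functional
   [F(u) = beta/3 A(u,u,u) + h sum u_i - sum I(u_i)]. The net of fields used in a
   naive large deviation bound is replaced by sampling: colour the sites at random
   with [K+1] colours, twice; the fields are well approximated by functions of the spins
   of one colour, which occupy a fraction [O(1/K)] of the sites, and once these are
   pinned the remaining spins integrate exactly against a tilted product measure.
   Jensen's inequality gives [log Z >= N (beta/3 R v^3 + h v - I(v))] for every [v >= 0], and
   stochastic non-negativity allows [v = |u_i|]. Comparing with the AM-GM inequality for
   [|u_i| |u_j| |u_k|], [F(u) >= log Z - o(N)] forces [sum R_ij | |u_i| - |u_j| |^3] and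
   [h sum (|u_i| - u_i)] to be [o(N)]. The spectral gap then makes [|u_i|] nearly constant,
   and either [h > 0] or [km >= 0] removes the absolute values. Constant [u] has nearly
   constant fields because the row sums are nearly constant, so the variance of the
   fields is small. *)
Require Import Defs.
From mathcomp Require Import all_boot all_order all_algebra.
From mathcomp Require Import all_classical all_reals all_analysis.
From mathcomp Require Import measurable_realfun complex ring lra.
Set Implicit Arguments.
Unset Strict Implicit.
Unset Printing Implicit Defensive.
Import Order.TTheory GRing.Theory Num.Theory.
Import numFieldNormedType.Exports.
Local Open Scope classical_set_scope.
Local Open Scope ring_scope.

(** * Resampling one coordinate of a product measure *)

(** Three obstacles shape the argument. The means [u(y)] depend on the whole configuration and
    cannot be fixed before integrating. The energy is therefore split into the log-density of a
    tilted product law with parameters [field y], plus a functional of [u(y)] that is bounded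
    pointwise on the bad event. The parameters of that law are still random. Their sampled versions
    see few spins, and no union bound over colourings is paid: once [sq_sum] is small, every
    configuration is well sampled by at least half of the pairs of colourings, so its weight is at
    most twice an average of densities of total mass one. The cost is exponential in [N / K] with
    [K] constant, against a gain exponential in [rho * N]. Finally, the AM-GM defect is cubic while
    the spectral gap is quadratic, and the row sums have no uniform lower bound; cutoffs such as
    [t^2 <= e^2 + t^3 / e] and the replacement of the weights by their mean bridge both gaps. *)

Section resampling.
Context d (T : measurableType d) (R : realType) (P : probability T R).
Local Open Scope ereal_scope.

Definition tset (n : nat) (i : 'I_n) (z : T) (x : n.-tuple T) : n.-tuple T :=
  [tuple if j == i then z else tnth x j | j < n].

Lemma tnth_tset n (i : 'I_n) z x j :
  tnth (tset i z x) j = if j == i then z else tnth x j.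
Proof. by rewrite tnth_mktuple. Qed.

Lemma measurable_tset n (i : 'I_n) :
  measurable_fun setT (fun p : T * n.-tuple T => tset i p.1 p.2).
Proof.
apply/measurable_fun_tnthP => j; rewrite /comp /=.
have [->|ji] := eqVneq j i.
- apply: (eq_measurable_fun fst) => // p _; by rewrite tnth_tset eqxx.
- apply: (eq_measurable_fun (fun p : T * n.-tuple T => tnth p.2 j)).
    by move=> p _; rewrite tnth_tset (negbTE ji).
  exact: (measurableT_comp (measurable_tnth j)).
Qed.

Lemma integral_power_probS n (f : n.+1.-tuple T -> \bar R) :
  measurable_fun [set: n.+1.-tuple T] f -> (forall x, 0 <= f x) ->
  \int[power_prob P n.+1]_x f x =
  \int[P]_z \int[power_prob P n]_x f [tuple of z :: x].
Proof.
move=> mf f0 /=.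
rewrite [LHS](ge0_integral_distribution (@tuple_cons _ T n))//.
rewrite -(fubini_tonelli1 (fun p => f (tuple_cons p)))//.
exact: measurableT_comp.
Qed.

(** Induction on [n]: a coordinate of the tail is resampled with the head frozen. For the head
    itself the integral over the old value is constant, and Tonelli's theorem exchanges the two
    remaining ones. *)
Lemma ge0_integral_resample n (i : 'I_n) (f : n.-tuple T -> \bar R) :
  measurable_fun setT f -> (forall x, 0 <= f x) ->
  \int[power_prob P n]_x f x =
  \int[power_prob P n]_x \int[P]_z f (tset i z x).
Proof.
elim: n i f => [[]//|n IH] i f mf f0.
have mfs : measurable_fun setT (fun p : T * n.+1.-tuple T => f (tset i p.1 p.2)).
  exact: (measurableT_comp mf (measurable_tset i)).
have mcons (z : T) :
    measurable_fun setT (fun x : n.-tuple T => [tuple of z :: x]).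
  exact: measurable_cons.
rewrite [RHS]integral_power_probS; last 2 first.
- exact: (measurable_fun_fubini_tonelli_G
    (fun p : T * n.+1.-tuple T => f (tset i p.1 p.2))).
- by move=> x; apply: integral_ge0.
rewrite integral_power_probS//.
case: (unliftP ord0 i) => [j|] ->.
- have E z y (x : n.-tuple T) : tset (lift ord0 j) z [tuple of y :: x]
                 = [tuple of y :: tset j z x].
    apply: eq_from_tnth => k; rewrite tnth_tset.
    case: (unliftP ord0 k) => [l|] -> //.
    by rewrite !tnthS tnth_tset (inj_eq (lift_inj (h := ord0))).
  apply: eq_integral => y _; under [RHS]eq_integral do
    under eq_integral do rewrite E.
  apply: (IH j (fun x => f [tuple of y :: x])) => //.
  exact: measurableT_comp.
- have E z y (x : n.-tuple T) : tset ord0 z [tuple of y :: x] = [tuple of z :: x] :> n.+1.-tuple T.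
    apply: eq_from_tnth => k; rewrite tnth_tset.
    by case: (unliftP ord0 k) => [l|] -> //; rewrite !tnthS.
  under [RHS]eq_integral do under eq_integral do
    under eq_integral do rewrite E.
  rewrite integral_cst//= [X in _ = _ * X]probability_setT mule1.
  apply: (@fubini_tonelli _ _ _ _ _ P (power_prob P n)
     (fun p : T * n.-tuple T => f [tuple of p.1 :: p.2])) => //.
  by apply: measurableT_comp => //; exact: measurable_cons.
Qed.

End resampling.

(** * Bounded measurable functions *)

Section bounded_measurable.
Context d (T : measurableType d) (R : realType) (P : probability T R).

(** Such observables are integrable under every probability measure and stable under the operations
    used below, so linearity and monotonicity of integrals leave only this side condition. *)
Definition bounded_measurable (g : T -> R) : Prop :=
  measurable_fun setT g /\ exists M : R, forall x, `|g x| <= M.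

Lemma bounded_measurable_integrable g :
  bounded_measurable g -> P.-integrable setT (EFin \o g).
Proof.
move=> [mg [M gM]]; apply: measurable_bounded_integrable => //.
  by rewrite (le_lt_trans (probability_le1 P measurableT))// ltry.
exists M; split => [|x Mx y _ /=]; first exact: num_real.
exact: le_trans (gM y) (ltW Mx).
Qed.

Lemma bounded_measurable_cst c : bounded_measurable (fun=> c).
Proof. by split; [exact: measurable_cst|exists `|c|]. Qed.

Lemma bounded_measurableD f g : bounded_measurable f -> bounded_measurable g ->
  bounded_measurable (fun x => f x + g x).
Proof.
move=> [mf [M fM]] [mg [M' gM]]; split; first exact: measurable_funD.
by exists (M + M') => x; rewrite (le_trans (ler_normD _ _))// lerD.
Qed.

Lemma bounded_measurableM f g : bounded_measurable f -> bounded_measurable g ->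
  bounded_measurable (fun x => f x * g x).
Proof.
move=> [mf [M fM]] [mg [M' gM]]; split; first exact: measurable_funM.
by exists (M * M') => x; rewrite normrM ler_pM.
Qed.

(* Continuity bounds [phi] on the compact interval containing the values of
   [f]. *)
Lemma bounded_measurable_comp (phi : R -> R) f :
  continuous phi -> bounded_measurable f ->
  bounded_measurable (fun x => phi (f x)).
Proof.
move=> cphi [mf [M fM]]; split.
  apply: measurableT_comp => //; exact: continuous_measurable_fun.
have cn : {within `[- M, M], continuous (fun x => `|phi x|)}.
  apply: continuous_subspaceT => x; apply: continuous_comp; first exact: cphi.
  exact: norm_continuous.
have [MM|MM] := lerP (- M) M; last first.
  exists 0 => x; have := fM x; rewrite ler_norml => /andP[a b].
  by have := le_trans a b; rewrite leNgt MM.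
have [c _ cmax] := EVT_max MM cn.
exists `|phi c| => x; apply: cmax.
by rewrite in_itv/= -ler_norml.
Qed.

Lemma bounded_measurable_lt f g :
  bounded_measurable f -> bounded_measurable g ->
  bounded_measurable (fun x => (f x < g x)%R%:R).
Proof.
move=> [mf _] [mg _]; split; last first.
  by exists 1 => x; case: (_ < _); rewrite ?normr1 ?normr0.
rewrite (_ : (fun _ => _) = (fun x => if f x < g x then 1 else 0)); last first.
  by apply/funext => x; case: (_ < _).
by apply: measurable_fun_ifT => //; exact: measurable_fun_ltr.
Qed.

Lemma Rexp_le f g : bounded_measurable f -> bounded_measurable g ->
  (forall x, f x <= g x) -> \int[P]_x f x <= \int[P]_x g x.
Proof.
by move=> bf bg fg; apply: le_Rintegral => //; exact: bounded_measurable_integrable.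
Qed.

Lemma Rexp_cst (c : R) : \int[P]_x c = c.
Proof. rewrite (Rintegral_cst P measurableT) -[RHS]mulr1; congr (_ * _).
rewrite -[RHS]/(fine 1%E); congr fine; exact: probability_setT. Qed.

Lemma RexpD f g : bounded_measurable f -> bounded_measurable g ->
  \int[P]_x (f x + g x) = \int[P]_x f x + \int[P]_x g x.
Proof.
by move=> bf bg; rewrite RintegralD//; exact: bounded_measurable_integrable.
Qed.

Lemma RexpZ (c : R) g : bounded_measurable g ->
  \int[P]_x (c * g x) = c * \int[P]_x g x.
Proof.
by move=> bg; rewrite RintegralZl//; exact: bounded_measurable_integrable.
Qed.

Lemma Rexp_norm_le g (M : R) : bounded_measurable g ->
  (forall x, `|g x| <= M) -> `|\int[P]_x g x| <= M.
Proof.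
move=> bg gM; have bc := bounded_measurable_cst.
rewrite ler_norml -[X in X <= _](Rexp_cst (- M)) -[X in _ && (_ <= X)](Rexp_cst M).
by apply/andP; split; apply: Rexp_le => // x; have := gM x; rewrite ler_norml => /andP[].
Qed.

Lemma EFin_Rexp g : bounded_measurable g ->
  (\int[P]_x g x)%:E = (\int[P]_x (g x)%:E)%E.
Proof.
move=> /bounded_measurable_integrable ig; rewrite /Rintegral fineK//.
exact: integrable_fin_num.
Qed.

End bounded_measurable.

(** * Resampling for bounded real observables *)

Section real_resampling.
Context d (T : measurableType d) (R : realType) (P : probability T R).

(** The nonnegative case is applied to [g + M], and the constant [M] is removed afterwards. *)
Lemma Rexp_resample n (i : 'I_n) (g : n.-tuple T -> R) :
  @bounded_measurable _ _ R g ->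
  \int[power_prob P n]_x g x =
  \int[power_prob P n]_x \int[P]_z g (tset i z x).
Proof.
move=> bg; have [mg [M gM]] := bg.
pose f x := (g x + M)%:E.
have f0 x : (0 <= f x)%E.
  by rewrite lee_fin -lerBlDr sub0r; have := gM x; rewrite ler_norml => /andP[].
have mf : measurable_fun setT f.
  by apply/measurable_EFinP; apply: measurable_funD.
have := ge0_integral_resample P i mf f0.
have bt x : bounded_measurable (fun z => g (tset i z x)).
  split; last by exists M => z; exact: gM.
  apply: (measurableT_comp mg).
  apply: (measurableT_comp (measurable_tset (T := T) i)
     (g := fun z => (z, x))).
  exact: pair2_measurable.
have inner x : (\int[P]_z f (tset i z x) = (\int[P]_z g (tset i z x) + M)%:E)%E.
  rewrite /f -EFin_Rexp.
    by rewrite RexpD// ?Rexp_cst//; exact: bounded_measurable_cst.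
  by apply: bounded_measurableD => //; exact: bounded_measurable_cst.
under [X in _ = X]eq_integral do rewrite inner.
have mG : measurable_fun setT (fun x => \int[P]_z g (tset i z x) : R).
  have := @measurable_fun_fubini_tonelli_G _ _ T (n.-tuple T) R P
    (fun p : T * n.-tuple T => f (tset i p.1 p.2)).
  move=> /(_ (measurableT_comp mf (measurable_tset (T := T) i)) (fun p => f0 _)) H.
  have /measurable_EFinP H' : measurable_fun setT
      (fun x => (\int[P]_z g (tset i z x) + M)%:E).
    apply: eq_measurable_fun H => x _; exact: inner.
  rewrite (_ : (fun _ => _) =
     (fun x => (\int[P]_z g (tset i z x) + M) - M)); last first.
    by apply/funext => x; rewrite addrK.
  by apply: measurable_funB => //.
have bG : @bounded_measurable _ (n.-tuple T) R
    (fun x => \int[P]_z g (tset i z x) : R).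
  split => //; exists M => x.
  by apply: Rexp_norm_le => // z; exact: gM.
have bc c d' (T' : measurableType d') := bounded_measurable_cst T' c.
rewrite /f -!EFin_Rexp//; try exact: bounded_measurableD.
by rewrite !RexpD// !Rexp_cst => -[] /addIr.
Qed.

End real_resampling.

(** * Expectations over the cube *)

Section clip.
Context {R : realType}.
Implicit Types a b z w : R.

Definition clip a b z : R := Num.max a (Num.min b z).

Lemma clip_itv a b z : a <= b -> a <= clip a b z <= b.
Proof.
by move=> ab; rewrite /clip le_max lexx/= ge_max ab ge_min lexx.
Qed.

Lemma clip_id a b z : a <= z <= b -> clip a b z = z.
Proof. by case/andP => az zb; rewrite /clip min_r// max_r. Qed.

Lemma clip_dist a b z w : a <= w <= b -> `|clip a b z - w| <= `|z - w|.
Proof.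
case/andP => aw wb; rewrite /clip.
by case: (leP b z) => ?; case: (leP a _) => ?; rewrite ?lexx//; do 2 case: ger0P => ?; lra.
Qed.

Lemma continuous_clip a b : continuous (clip a b).
Proof.
move=> x; apply: (@continuous_max _ _ (cst a) (fun z => Num.min b z)).
  exact: cvg_cst.
by apply: (@continuous_min _ _ (cst b) id); [exact: cvg_cst|exact: cvg_id].
Qed.

End clip.

Section cube.
Context (R : realType) (km kp : R) (mu : probability (measurableTypeR R) R).
Hypothesis km_le_kp : km <= kp.

Definition in_cube N (y : 'I_N -> R) : Prop := forall i, km <= y i <= kp.

Definition upd N (y : 'I_N -> R) (i : 'I_N) (z : R) : 'I_N -> R :=
  fun j => if j == i then z else y j.

(* Clipping changes nothing almost surely and makes continuous observables bounded. *)
Definition cube_point N (x : N.-tuple (measurableTypeR R)) : 'I_N -> R :=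
  fun i => clip km kp (tnth x i).

Definition Ex N (g : ('I_N -> R) -> R) : R :=
  \int[power_prob mu N]_x g (cube_point x).

Definition E1 (g : R -> R) : R := \int[mu]_z g (clip km kp z).

Definition bm N (g : ('I_N -> R) -> R) : Prop :=
  @bounded_measurable _ (N.-tuple (measurableTypeR R)) R
    (fun x => g (cube_point x)).

Lemma cube_point_in_cube N (x : N.-tuple (measurableTypeR R)) :
  in_cube (cube_point x).
Proof. by move=> i; exact: clip_itv. Qed.

Lemma upd_in_cube N (y : 'I_N -> R) i z :
  in_cube y -> km <= z <= kp -> in_cube (upd y i z).
Proof. by move=> cy cz j; rewrite /upd; case: ifP. Qed.

Lemma cube_point_tset N i z (x : N.-tuple (measurableTypeR R)) :
  cube_point (tset i z x) = upd (cube_point x) i (clip km kp z).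
Proof.
by apply/funext => j; rewrite /cube_point /upd tnth_tset; case: ifP.
Qed.

Section bm_theory.
Context (N : nat).
Implicit Types f g : ('I_N -> R) -> R.

Lemma eq_bm f g : (forall y, in_cube y -> f y = g y) -> bm f -> bm g.
Proof.
move=> fg; rewrite /bm (_ : (fun x => g _) = (fun x => f (cube_point x)))//.
by apply/funext => x; rewrite fg//; exact: cube_point_in_cube.
Qed.

Lemma bm_cst c : bm (fun _ : 'I_N -> R => c).
Proof. exact: bounded_measurable_cst. Qed.

Lemma bmD f g : bm f -> bm g -> bm (fun y => f y + g y).
Proof. exact: bounded_measurableD. Qed.

Lemma bmM f g : bm f -> bm g -> bm (fun y => f y * g y).
Proof. exact: bounded_measurableM. Qed.

Lemma bm_comp (phi : R -> R) f :
  continuous phi -> bm f -> bm (fun y => phi (f y)).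
Proof. exact: bounded_measurable_comp. Qed.

Lemma bm_lt f g : bm f -> bm g -> bm (fun y => (f y < g y)%R%:R).
Proof. exact: bounded_measurable_lt. Qed.

Lemma bmN f : bm f -> bm (fun y => - f y).
Proof. by apply: (bm_comp (phi := -%R)) => x; exact: opp_continuous. Qed.

Lemma bmB f g : bm f -> bm g -> bm (fun y => f y - g y).
Proof. by move=> bf bg; apply: bmD => //; exact: bmN. Qed.

Lemma bmX f n : bm f -> bm (fun y => f y ^+ n).
Proof. by apply: (bm_comp (phi := fun x => x ^+ n)); exact: exprn_continuous. Qed.

Lemma bm_norm f : bm f -> bm (fun y => `|f y|).
Proof. by apply: (bm_comp (phi := Num.norm)) => x; exact: norm_continuous. Qed.

Lemma bm_exp f : bm f -> bm (fun y => expR (f y)).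
Proof. by apply: bm_comp => x; exact: continuous_expR. Qed.

Lemma bm_sum (I : Type) (r : seq I) (p : pred I) (f : I -> ('I_N -> R) -> R) :
  (forall i, bm (f i)) -> bm (fun y => \sum_(i <- r | p i) f i y).
Proof.
move=> bf; elim: r => [|i r IH].
  by apply: eq_bm (bm_cst 0) => y _; rewrite big_nil.
case pi: (p i); last by apply: eq_bm IH => y _; rewrite big_cons pi.
by apply: eq_bm (bmD (bf i) IH) => y _; rewrite big_cons pi.
Qed.

Lemma bm_prod (I : Type) (r : seq I) (p : pred I) (f : I -> ('I_N -> R) -> R) :
  (forall i, bm (f i)) -> bm (fun y => \prod_(i <- r | p i) f i y).
Proof.
move=> bf; elim: r => [|i r IH].
  by apply: eq_bm (bm_cst 1) => y _; rewrite big_nil.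
case pi: (p i); last by apply: eq_bm IH => y _; rewrite big_cons pi.
by apply: eq_bm (bmM (bf i) IH) => y _; rewrite big_cons pi.
Qed.

Lemma bm_coord i : bm (fun y : 'I_N -> R => y i).
Proof.
split; last first.
  exists (Num.max `|km| `|kp|) => x.
  have /andP[] := cube_point_in_cube x i.
  set z := cube_point x i => z1 z2.
  by rewrite le_max; do 3 case: ger0P => ?; lra.
exact: (measurableT_comp (continuous_measurable_fun (@continuous_clip R km kp))
  (@measurable_tnth _ (measurableTypeR R) N i)).
Qed.

Lemma bm_upd i z g : km <= z <= kp -> bm g -> bm (fun y => g (upd y i z)).
Proof.
move=> zk [mg [M gM]]; rewrite /bm.
rewrite (_ : (fun x => _) =
   (fun x => g (cube_point (tset (T := measurableTypeR R) i z x)))); last first.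
  by apply/funext => x; rewrite cube_point_tset clip_id.
split; last by exists M => x; exact: gM.
apply: (measurableT_comp mg).
apply: (measurableT_comp (measurable_tset (T := measurableTypeR R) i)
     (g := fun x => (z, x))).
exact: pair1_measurable.
Qed.

Lemma Ex_le f g : bm f -> bm g -> (forall y, in_cube y -> f y <= g y) ->
  Ex f <= Ex g.
Proof.
move=> bf bg fg; apply: Rexp_le => // x; apply: fg.
exact: cube_point_in_cube.
Qed.

Lemma eq_Ex f g : (forall y, in_cube y -> f y = g y) -> Ex f = Ex g.
Proof.
move=> fg; apply: eq_Rintegral => x _; apply: fg; exact: cube_point_in_cube.
Qed.

Lemma Ex_cst c : Ex (fun _ : 'I_N -> R => c) = c.
Proof. exact: Rexp_cst. Qed.

Lemma ExD f g : bm f -> bm g -> Ex (fun y => f y + g y) = Ex f + Ex g.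
Proof. exact: RexpD. Qed.

Lemma ExZ c f : bm f -> Ex (fun y => c * f y) = c * Ex f.
Proof. exact: RexpZ. Qed.

Lemma ExB f g : bm f -> bm g -> Ex (fun y => f y - g y) = Ex f - Ex g.
Proof.
move=> bf bg; rewrite ExD//; last exact: bmN.
rewrite -[in RHS]mulN1r -ExZ//; congr (_ + _).
by apply: eq_Ex => y _; rewrite mulN1r.
Qed.

Lemma Ex_ge0 f : bm f -> (forall y, in_cube y -> 0 <= f y) -> 0 <= Ex f.
Proof. by move=> bf f0; rewrite -(Ex_cst 0); apply: Ex_le => //; exact: bm_cst. Qed.

Lemma Ex_sum (I : Type) (r : seq I) (f : I -> ('I_N -> R) -> R) :
  (forall i, bm (f i)) -> Ex (fun y => \sum_(i <- r) f i y) = \sum_(i <- r) Ex (f i).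
Proof.
move=> bf; elim: r => [|i r IH].
  by rewrite big_nil -[RHS]Ex_cst; apply: eq_Ex => y _; rewrite big_nil.
rewrite big_cons -IH -ExD//; last exact: bm_sum.
by apply: eq_Ex => y _; rewrite big_cons.
Qed.

Lemma Ex_resample i g : bm g ->
  Ex g = Ex (fun y => E1 (fun z => g (upd y i z))).
Proof.
move=> bg; rewrite [LHS](Rexp_resample (T := measurableTypeR R) mu i bg).
apply: eq_Rintegral => x _; apply: eq_Rintegral => z _.
by rewrite cube_point_tset.
Qed.

End bm_theory.

Section E1_theory.
Implicit Types f g : R -> R.

Lemma continuous_clip_bm g : continuous g ->
  @bounded_measurable _ (measurableTypeR R) R (fun z => g (clip km kp z)).
Proof.
move=> cg; apply: (@bounded_measurable_comp _ (measurableTypeR R) R g) => //.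
split.
  exact: (measurableT_comp (continuous_measurable_fun (@continuous_clip R km kp))
    (@measurable_id _ (measurableTypeR R) setT)).
exists (Num.max `|km| `|kp|) => z.
have /andP[] := clip_itv z km_le_kp.
set t := clip _ _ _ => z1 z2.
by rewrite le_max; do 3 case: ger0P => ?; lra.
Qed.

Lemma E1_le f g : continuous f -> continuous g ->
  (forall z, km <= z <= kp -> f z <= g z) -> E1 f <= E1 g.
Proof.
move=> cf cg fg; apply: Rexp_le; try exact: continuous_clip_bm.
by move=> z; apply: fg; exact: clip_itv.
Qed.

Lemma eq_E1 f g : (forall z, km <= z <= kp -> f z = g z) -> E1 f = E1 g.
Proof. by move=> fg; apply: eq_Rintegral => z _; apply: fg; exact: clip_itv. Qed.

Lemma E1_cst c : E1 (fun=> c) = c.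
Proof. exact: Rexp_cst. Qed.

Lemma E1D f g : continuous f -> continuous g ->
  E1 (fun z => f z + g z) = E1 f + E1 g.
Proof. by move=> cf cg; apply: RexpD; exact: continuous_clip_bm. Qed.

Lemma E1Z c f : continuous f -> E1 (fun z => c * f z) = c * E1 f.
Proof. by move=> cf; apply: RexpZ; exact: continuous_clip_bm. Qed.

Lemma E1_norm_le g M : continuous g ->
  (forall z, km <= z <= kp -> `|g z| <= M) -> `|E1 g| <= M.
Proof.
move=> cg gM; apply: Rexp_norm_le; first exact: continuous_clip_bm.
by move=> z; apply: gM; exact: clip_itv.
Qed.

End E1_theory.
End cube.

(** * Exponential tilts *)

Section exponential_tilts.
Context (R : realType) (km kp : R) (mu : probability (measurableTypeR R) R).
Hypothesis km_le_kp : km <= kp.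
Context (C : R).
Hypotheses (km_geC : - C <= km) (kp_leC : kp <= C).
Implicit Types t s l z e B J a : R.

Notation E1 := (E1 km kp mu).

(** This transform belongs to the clipped law; [log_mgf_cumulant] identifies its logarithm with that
    of [mu] once [mu] is carried by the interval. *)
Definition mgf (t : R) : R := E1 (fun z => expR (t * z)).

Definition tilt_mean (t : R) : R := E1 (fun z => z * expR (t * z)) / mgf t.

Definition cumulant (t : R) : R := ln (mgf t).

Let contM (f g : R -> R) :
  continuous f -> continuous g -> continuous (fun z => f z * g z).
Proof. by move=> cf cg x; apply: cvgM; [exact: cf|exact: cg]. Qed.

Let contD (f g : R -> R) :
  continuous f -> continuous g -> continuous (fun z => f z + g z).
Proof. by move=> cf cg x; apply: cvgD; [exact: cf|exact: cg]. Qed.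

Let contc (c : R) : continuous (fun _ : R => c).
Proof. by move=> x; exact: cvg_cst. Qed.

Let conti : continuous (fun x : R => x).
Proof. by move=> x; exact: cvg_id. Qed.

Let conte (t : R) : continuous (fun z => expR (t * z)).
Proof.
move=> x; apply: (@continuous_comp _ _ _ (fun z => t * z) expR).
  by apply: contM => //; exact: contc.
exact: continuous_expR.
Qed.

Let C_ge0 : 0 <= C.
Proof. by have := le_trans km_geC (le_trans km_le_kp kp_leC); lra. Qed.

Let itv_norm z : km <= z <= kp -> `|z| <= C.
Proof. case/andP => z1 z2; rewrite ler_norml (le_trans km_geC z1) (le_trans z2)//. Qed.

(** For [b <= a] the tangent line at [a] gives [expR a - expR b <= expR a * (a - b)], and [expR a]
    is then enlarged to [expR c]. *)
Lemma expR_lip (a b c : R) : a <= c -> b <= c ->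
  `|expR a - expR b| <= expR c * `|a - b|.
Proof.
wlog ab : a b / b <= a => [H ac bc|ac bc].
  have /orP[ba|ab] := le_total b a; first exact: H.
  by rewrite (distrC (expR a)) (distrC a); exact: H.
have eab : expR b <= expR a by rewrite ler_expR.
rewrite !ger0_norm ?subr_ge0//.
have h1 : expR b >= expR a * (1 + (b - a)).
  have -> : expR b = expR a * expR (b - a).
    by rewrite -expRD; congr expR; ring.
  by rewrite ler_pM2l ?expR_gt0 ?expR_ge1Dx.
have h2 : expR a <= expR c by rewrite ler_expR.
have : (expR c - expR a) * (a - b) >= 0 by rewrite mulr_ge0 ?subr_ge0.
by lra.
Qed.

Lemma exp_bound (t B z : R) : `|t| <= B -> km <= z <= kp ->
  `|t * z| <= B * C.
Proof. by move=> tB zk; rewrite normrM ler_pM// itv_norm. Qed.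

Lemma mgf_ge (t B : R) : `|t| <= B -> expR (- (B * C)) <= mgf t.
Proof.
move=> tB; rewrite -[leLHS](E1_cst km kp mu); apply: E1_le => //.
move=> z zk; rewrite ler_expR lerNl.
by have := exp_bound tB zk; rewrite ler_norml => /andP[]; lra.
Qed.

Lemma mgf_gt0 t : 0 < mgf t.
Proof. exact: lt_le_trans (expR_gt0 _) (mgf_ge (lexx `|t|)). Qed.

Lemma tilt_centered t :
  E1 (fun z => expR (t * z) * (z - tilt_mean t)) = 0.
Proof.
rewrite (@eq_E1 _ _ _ mu km_le_kp _
  (fun z => z * expR (t * z) + (- tilt_mean t) * expR (t * z))); last first.
  by move=> z _; ring.
rewrite E1D//; last 2 first.
- by apply: contM.
- by apply: contM => //; exact: contc.
rewrite E1Z// /tilt_mean -/(mgf t) mulNr divfK ?subrr//.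
by rewrite gt_eqF// mgf_gt0.
Qed.

(** Comparing [tilt_mean t] with a number [a] becomes a question about the sign or size of an
    unnormalized integral, because [mgf t] is positive. *)
Lemma tilt_shift t a :
  E1 (fun z => expR (t * z) * (z - a)) = (tilt_mean t - a) * mgf t.
Proof.
rewrite (@eq_E1 _ _ _ mu km_le_kp _
  (fun z => expR (t * z) * (z - tilt_mean t) + (tilt_mean t - a) * expR (t * z))); last first.
  by move=> z _; ring.
rewrite E1D//; last 2 first.
- by apply: contM => //; apply: contD => //; exact: contc.
- by apply: contM => //; exact: contc.
by rewrite tilt_centered add0r E1Z.
Qed.

Let contea (t a : R) : continuous (fun z => expR (t * z) * (z - a)).
Proof. by apply: contM => //; apply: contD => //; exact: contc. Qed.

Lemma tilt_mean_itv t : km <= tilt_mean t <= kp.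
Proof.
have mp := mgf_gt0 t; apply/andP; split.
  rewrite -subr_ge0 -(pmulr_lge0 _ mp) -tilt_shift.
  rewrite -(E1_cst km kp mu 0); apply: E1_le => //.
  by move=> z /andP[? ?]; rewrite mulr_ge0 ?expR_ge0// subr_ge0.
rewrite -subr_le0 -(pmulr_lle0 _ mp) -tilt_shift.
rewrite -(E1_cst km kp mu 0); apply: E1_le => //.
by move=> z /andP[? ?]; rewrite mulr_ge0_le0 ?expR_ge0// subr_le0.
Qed.

Lemma tilt_mean_norm t : `|tilt_mean t| <= C.
Proof. exact/itv_norm/tilt_mean_itv. Qed.

(** In [tilt_shift] with [a = tilt_mean s], the vanishing centered integral at [s] is subtracted.
    Only a difference of exponentials remains, times a factor at most [2 * C]; dividing by
    [mgf t >= expR (- (B * C))] doubles the exponent. *)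
Lemma tilt_mean_lip B t s : `|t| <= B -> `|s| <= B ->
  `|tilt_mean t - tilt_mean s|
    <= 2 * C ^+ 2 * expR (2 * B * C) * `|t - s|.
Proof.
move=> tB sB.
have H : `|(tilt_mean t - tilt_mean s) * mgf t|
    <= 2 * C ^+ 2 * expR (B * C) * `|t - s|.
  rewrite -tilt_shift.
  rewrite (@eq_E1 _ _ _ mu km_le_kp _
    (fun z => expR (s * z) * (z - tilt_mean s)
       + (expR (t * z) - expR (s * z)) * (z - tilt_mean s))); last first.
    by move=> z _; ring.
  have c2 : continuous (fun z => (expR (t * z) - expR (s * z)) * (z - tilt_mean s)).
    apply: contM; last by apply: contD => //; exact: contc.
    apply: contD => // x; apply: cvgN; exact: conte.
  rewrite E1D// tilt_centered add0r; apply: E1_norm_le => // z zk.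
  rewrite normrM.
  have h1 : `|expR (t * z) - expR (s * z)| <= expR (B * C) * (`|t - s| * C).
    apply: le_trans (expR_lip (c := B * C) _ _) _.
    - by have := exp_bound tB zk; rewrite ler_norml => /andP[].
    - by have := exp_bound sB zk; rewrite ler_norml => /andP[].
    - rewrite ler_pM2l ?expR_gt0// -mulrBl normrM ler_wpM2l//.
      exact: itv_norm.
  have h2 : `|z - tilt_mean s| <= 2 * C.
    rewrite (le_trans (ler_normB _ _))//.
    by have := itv_norm zk; have := tilt_mean_norm s; lra.
  apply: le_trans (ler_pM _ _ h1 h2) _ => //.
  by rewrite le_eqVlt; apply/orP; left; apply/eqP; ring.
have mp := mgf_ge tB.
rewrite normrM (gtr0_norm (mgf_gt0 t)) in H.
have H2 : `|tilt_mean t - tilt_mean s| * expR (- (B * C))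
    <= 2 * C ^+ 2 * expR (B * C) * `|t - s|.
  by apply: le_trans H; rewrite ler_wpM2l.
have := ler_wpM2r (expR_ge0 (B * C)) H2.
rewrite -[X in X <= _]mulrA -expRD addNr expR0 mulr1 => /le_trans; apply.
rewrite (_ : 2 * B * C = B * C + B * C); last by ring.
rewrite expRD le_eqVlt; apply/orP; left; apply/eqP; ring.
Qed.

Lemma locally_lipschitz_continuous (f : R -> R) (K : R -> R) :
  (forall B t s, `|t| <= B -> `|s| <= B -> `|f t - f s| <= K B * `|t - s|) ->
  continuous f.
Proof.
move=> fK x; apply/(@cvgrPdist_le _ R^o) => e e0.
pose B := `|x| + 1; pose k := `|K B| + 1.
have k0 : 0 < k by rewrite /k ltr_wpDl.
near=> y.
have yx : `|x - y| <= Num.min 1 (e / k).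
  near: y; apply: (@cvgr_dist_le _ R^o); first exact: cvg_id.
  by rewrite lt_min ltr01 divr_gt0.
move: yx; rewrite le_min => /andP[yx1 yxe].
apply: le_trans (fK B _ _ _ _) _.
- by rewrite /B lerDl.
- rewrite -lerBlDl (le_trans _ yx1)// distrC.
  exact: lerB_dist.
- rewrite ler_pdivlMr// in yxe.
  apply: le_trans yxe; rewrite [leRHS]mulrC ler_wpM2r//.
  by rewrite /k (le_trans (ler_norm _))// lerDl.
Unshelve. all: by end_near. Qed.

Lemma continuous_tilt_mean : continuous tilt_mean.
Proof. exact: locally_lipschitz_continuous tilt_mean_lip. Qed.

(* Jensen's inequality for [expR] under the tilted law. *)
Lemma mgf_tilt_ge t l : expR ((l - t) * tilt_mean t) * mgf t <= mgf l.
Proof.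
rewrite /mgf -E1Z//.
pose c := expR ((l - t) * tilt_mean t).
have -> : E1 (fun z => c * expR (t * z)) =
   E1 (fun z => c * expR (t * z)
      + (c * (l - t)) * (expR (t * z) * (z - tilt_mean t))).
  rewrite E1D//; last 2 first.
  - by apply: contM => //; exact: contc.
  - by apply: contM => //; exact: contc.
  by rewrite !E1Z// tilt_centered mulr0 addr0.
apply: E1_le => //.
  apply: contD; first by apply: contM => //; exact: contc.
  by apply: contM => //; exact: contc.
move=> z _.
have -> : expR (l * z) = c * expR (t * z) * expR ((l - t) * (z - tilt_mean t)).
  by rewrite /c -!expRD; congr expR; ring.
have := ler_wpM2l (mulr_ge0 (expR_ge0 ((l - t) * tilt_mean t)) (expR_ge0 (t * z)))
  (expR_ge1Dx ((l - t) * (z - tilt_mean t))).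
by rewrite -/c; lra.
Qed.

Lemma expR_cumulant t : expR (cumulant t) = mgf t.
Proof. by rewrite /cumulant lnK// posrE mgf_gt0. Qed.

(** The Legendre supremum at [tilt_mean t] is attained at [t], so [t * tilt_mean t - cumulant t] is
    the value of the rate function there. *)
Lemma cumulant_tilt_ge t l :
  l * tilt_mean t - cumulant l <= t * tilt_mean t - cumulant t.
Proof.
have := mgf_tilt_ge t l; rewrite -2!expR_cumulant -expRD ler_expR.
by move: (cumulant t) (cumulant l) (tilt_mean t) => a b c; lra.
Qed.

Lemma cumulant_lip t s : `|cumulant t - cumulant s| <= C * `|t - s|.
Proof.
have H a b : cumulant a - cumulant b <= C * `|a - b|.
  have := cumulant_tilt_ge a b => h.
  have : (a - b) * tilt_mean a <= C * `|a - b|.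
    rewrite (le_trans (ler_norm _))// normrM mulrC ler_wpM2r//.
    exact: tilt_mean_norm.
  by move: h; move: (cumulant a) (cumulant b) (tilt_mean a) => x y z; lra.
rewrite ler_norml lerNl opprB; apply/andP; split; last exact: H.
by rewrite distrC; exact: H.
Qed.

Lemma cumulant0 : cumulant 0 = 0.
Proof.
rewrite /cumulant /mgf (@eq_E1 _ _ _ mu km_le_kp _ (fun=> 1)) ?E1_cst ?ln1//.
by move=> z _; rewrite mul0r expR0.
Qed.

Lemma cumulant_norm t : `|cumulant t| <= C * `|t|.
Proof. by have := cumulant_lip t 0; rewrite cumulant0 !subr0. Qed.

Lemma cumulant_le l : 0 <= l -> cumulant l <= l * kp.
Proof.
move=> l0; have := cumulant_tilt_ge l 0.
rewrite cumulant0 mul0r subr0.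
have /andP[_ h] := tilt_mean_itv l.
by have := ler_wpM2l l0 h; lra.
Qed.

(** The half-line above [kp - e / 2] is a neighbourhood of the support point [kp], hence has
    positive mass, and the integrand is at least [e / 2] on it. *)
Lemma E1_upper_tail_gt0 e : supp mu kp -> 0 < e ->
  0 < E1 (fun z => Num.max 0 (z - (kp - e))).
Proof.
move=> skp e0.
pose A : set R := [set z | kp - e / 2 < z].
have oA : open A by exact: open_gt.
have mA : @measurable _ (measurableTypeR R) A by exact: open_measurable.
have muA : (0 < mu A)%E by apply: skp => //; rewrite /A/=; lra.
have A1 : (mu A <= 1)%E by exact: probability_le1.
have muAfin : mu A \is a fin_num by rewrite ge0_fin_numE// (le_lt_trans A1)// ltry.
have bmA : @bounded_measurable _ (measurableTypeR R) R (\1_A).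
  split; first exact: measurable_indic.
  by exists 1 => x; rewrite indicE; case: (_ \in _); rewrite ?normr1 ?normr0.
have : 0 < e / 2 * \int[mu]_z \1_A z.
  rewrite mulr_gt0//; first lra.
  by rewrite /Rintegral integral_indic// setIT fine_gt0// muA (le_lt_trans A1)// ltry.
move=> /lt_le_trans; apply; rewrite -RexpZ//.
have cmax : continuous (fun z : R => Num.max 0 (z - (kp - e))).
  move=> x; apply: (@continuous_max _ _ (cst 0) (fun z => z - (kp - e))).
    exact: cvg_cst.
  by apply: contD => //; exact: contc.
apply: Rexp_le.
- apply: (@bounded_measurableM _ (measurableTypeR R) R (fun=> e / 2) (\1_A)) => //.
  exact: (@bounded_measurable_cst _ (measurableTypeR R) R).
- exact: (continuous_clip_bm km_le_kp (g := fun z => Num.max 0 (z - (kp - e)))).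
- move=> z; rewrite indicE; case: (boolP (z \in A)) => [/set_mem zA|_]; last first.
    by rewrite mulr0 le_max lexx.
  rewrite mulr1 le_max; apply/orP; right; move: zA; rewrite /A/= /clip => zA.
  have : Num.min kp z <= Num.max km (Num.min kp z) by rewrite le_max lexx orbT.
  have : kp - e / 2 <= Num.min kp z by rewrite le_min; apply/andP; split; lra.
  by lra.
Qed.

(** With [s = kp - e], the integrand [expR (l * (z - s)) * (z - s)] is at least [- 2 * C] everywhere
    and grows at least linearly in [l] on the upper tail, which has positive mass and wins for large
    [l]. *)
Lemma tilt_mean_near_kp e : supp mu kp -> 0 < e ->
  exists2 l, 0 <= l & kp - e <= tilt_mean l.
Proof.
move=> skp e0; pose p := E1 (fun z => Num.max 0 (z - (kp - e / 2))).
have p0 : 0 < p by apply: E1_upper_tail_gt0 => //; lra.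
(* With this [l] the lower bound [l * (e / 2) * p - 2 * C] for the integral is exactly zero. *)
pose l := 2 * C / (e / 2 * p).
have ep : 0 < e / 2 * p by rewrite mulr_gt0//; lra.
have l0 : 0 <= l by rewrite divr_ge0 ?(ltW ep)// mulr_ge0.
exists l => //.
rewrite -subr_ge0 -(pmulr_lge0 _ (mgf_gt0 l)) -tilt_shift.
rewrite -(pmulr_rge0 _ (expR_gt0 (- (l * (kp - e))))) -E1Z//.
have cmax : continuous (fun z : R => Num.max 0 (z - (kp - e / 2))).
  move=> x; apply: (@continuous_max _ _ (cst 0) (fun z => z - (kp - e / 2))).
    exact: cvg_cst.
  by apply: contD => //; exact: contc.
have -> : 0 = E1 (fun z => l * (e / 2) * Num.max 0 (z - (kp - e / 2)) + - (2 * C)).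
  rewrite E1D//; last by apply: contM.
  rewrite E1Z// E1_cst -/p -mulrA /l divfK ?subrr//.
  by rewrite gt_eqF.
apply: E1_le => //.
- apply: contD; last exact: contc.
  by apply: contM => //; exact: contc.
- by apply: contM => //; exact: contc.
move=> z zk; set s := kp - e.
have -> : expR (- (l * s)) * (expR (l * z) * (z - s)) = expR (l * (z - s)) * (z - s).
  by rewrite [LHS]mulrA -expRD; congr (expR _ * _); ring.
have h1 := itv_norm zk; rewrite ler_norml in h1; case/andP: zk h1 => zm zp /andP[zc1 zc2].
have [zs|zs] := lerP z (kp - e / 2).
  rewrite max_l ?subr_le0// mulr0 add0r.
  have [h|h] := lerP s z.
    apply: (@le_trans _ _ 0); first by rewrite lerNl oppr0; lra.
    by rewrite mulr_ge0 ?expR_ge0// subr_ge0.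
  have e1 : expR (l * (z - s)) <= 1.
    by rewrite -expR0 ler_expR mulr_ge0_le0// subr_le0 ltW.
  have e2 := expR_ge0 (l * (z - s)).
  have : (1 - expR (l * (z - s))) * (s - z) >= 0.
    by rewrite mulr_ge0 ?subr_ge0// ltW.
  by have := kp_leC; rewrite /s in h *; lra.
rewrite max_r; last by rewrite subr_ge0 ltW.
have e1 := expR_ge1Dx (l * (z - s)).
have zs0 : e / 2 <= z - s by rewrite /s; lra.
have zs1 : 0 <= z - s by lra.
have : (expR (l * (z - s)) - 1 - l * (z - s)) * (z - s) >= 0.
  by rewrite mulr_ge0//; lra.
have : l * ((z - s) * (z - s)) >= l * (e / 2 * (z - (kp - e / 2))).
  by apply: ler_wpM2l => //; apply: ler_pM => //; rewrite /s; lra.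
by lra.
Qed.

(* The value [t] need not be a tilted mean when it is an end point of the range of
   [tilt_mean], so it is only approximated from below. *)
Lemma tilt_mean_approx t J e : supp mu kp ->
  (forall l, l * t - cumulant l <= J) ->
  (exists s, tilt_mean s <= t) -> 0 < e ->
  exists l, [/\ t - e <= tilt_mean l, tilt_mean l <= t &
    l * tilt_mean l - cumulant l <= J].
Proof.
move=> skp tJ [s st] e0.
(* Beyond [kp] the values [l * t - cumulant l] are at least [l * (t - kp)] for [l >= 0], which
   eventually exceeds [J]. *)
have tkp : t <= kp.
  rewrite leNgt; apply/negP => kt.
  have dt : 0 < t - kp by rewrite subr_gt0.
  pose l := (`|J| + 1) / (t - kp).
  have l0 : 0 <= l by rewrite divr_ge0 ?ltW// ltr_wpDl.
  have := tJ l; have := cumulant_le l0.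
  have : l * (t - kp) = `|J| + 1 by rewrite /l divfK// gt_eqF.
  by have := ler_norm J; lra.
have [l l0 lk] := tilt_mean_near_kp skp e0.
have [lt|lt] := lerP (tilt_mean l) t.
  exists l; split => //; first by lra.
  apply: le_trans (tJ l); rewrite lerD2r ler_wpM2l//.
suff [c ct] : exists c, tilt_mean c = t.
  by exists c; rewrite ct; split => //; lra.
have cont a b : {within `[a, b], continuous tilt_mean}.
  by apply: continuous_subspaceT; exact: continuous_tilt_mean.
have tt : Num.min (tilt_mean s) (tilt_mean l) <= t
    <= Num.max (tilt_mean s) (tilt_mean l).
  by rewrite ge_min st/= le_max (ltW lt) orbT.
have [sl|/ltW ls] := lerP s l.
  by have [c _ ct] := IVT sl (cont _ _) tt; exists c.
rewrite minC maxC in tt.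
by have [c _ ct] := IVT ls (cont _ _) tt; exists c.
Qed.

End exponential_tilts.

(** * Poincare inequality from the spectral gap *)

Section spectral_gap.

Lemma char_poly_similar (F : fieldType) n (Q M : 'M[F]_n) :
  Q \in unitmx -> char_poly (invmx Q *m M *m Q) = char_poly M.
Proof.
move=> uQ; pose c : F -> {poly F} := polyC.
have cM (X Y : 'M[F]_n) : map_mx c (X *m Y) = map_mx c X *m map_mx c Y.
  by rewrite map_mxM.
have dQ : \det (map_mx c (invmx Q)) * \det (map_mx c Q) = 1.
  by rewrite -det_mulmx -cM mulVmx// map_mx1 det1.
rewrite /char_poly /char_poly_mx -/c.
have -> : 'X%:M - map_mx c (invmx Q *m M *m Q) =
    map_mx c (invmx Q) *m ('X%:M - map_mx c M) *m map_mx c Q.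
  rewrite mulmxBr mulmxBl !cM; congr (_ - _).
  by rewrite scalar_mxC -mulmxA -cM mulVmx// map_mx1 mulmx1.
by rewrite !det_mulmx mulrAC dQ mul1r.
Qed.

Lemma count_gt_sorted (R : realType) (s : seq R) (a : R) :
  sorted >=%R s -> s`_1 <= a ->
  (count (fun x => (a < x)%R) s <= 1)%N.
Proof.
case: s => [//|x [|y s]] //=; first by case: (a < x).
move=> /andP[_ ys] ya.
have -> : (a < y) = false by apply/negbTE; rewrite -leNgt.
rewrite (_ : count _ s = 0%N) ?addn0; first by case: (a < x).
apply/eqP; rewrite -leqn0 leqNgt -has_count; apply/hasPn => z zs.
rewrite -leNgt (le_trans _ ya)//.
have := order_path_min (fun b c d h1 h2 => le_trans h2 h1) ys.
by move=> /allP /(_ z zs).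
Qed.

Local Open Scope complex_scope.
Local Open Scope sesquilinear_scope.

(* The eigenvalues of a real symmetric matrix [S] are real, and those other than
   the top one are at most [a]; the fixed vector [q] spans the top eigenspace. *)
Lemma symmetric_gap (R : realType) n (S : 'M[R]_n) (s : seq R) (a : R)
    (q v : 'rV[R]_n) :
  S^T = S -> is_spectrum S s -> s`_1 <= a -> a < 1 ->
  q != 0 -> q *m S = q -> v *m q^T = 0 ->
  (v *m S *m v^T) 0 0 <= a * (v *m v^T) 0 0.
Proof.
move=> Ssym [ss cS] sa a1 q0 qS vq.
pose f : R -> R[i] := real_complex R.
pose SC := map_mx f S.
have fconj m p (M : 'M[R]_(m, p)) : (map_mx f M)^t* = map_mx f M^T.
  apply/matrixP => i j; rewrite !mxE; apply: conjc_real.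
have SCn : SC \is normalmx.
  by apply/normalmxP; rewrite fconj Ssym.
have /orthomx_spectralP := SCn.
set U := spectralmx SC; set sp := spectral_diag SC => SE.
have Uu : U \is unitarymx by exact: spectral_unitarymx.
have Uunit : U \in unitmx by exact: spectral_unit.
(* Both lists factor the characteristic polynomial of [S], so the diagonal given by the complex
   spectral theorem is the list [s] of real numbers, with multiplicities. *)
have perm : perm_eq [seq sp 0 i | i <- index_enum 'I_n] (map f s).
  apply: prod_XsubC_eq.
  rewrite 2!big_map -[RHS](map_prod_XsubC f) -cS map_char_poly -/SC SE char_poly_similar//.
  rewrite char_poly_trig; last first.
    apply/is_trig_mxP => i j ij; rewrite mxE (_ : (i == j) = false) ?mulr0n//.
    by apply/negbTE; apply: contraTneq ij => ->; rewrite ltnn.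
  by apply: eq_bigr => i _; rewrite mxE eqxx.
have spR i : exists2 x, x \in s & sp 0 i = f x.
  have : sp 0 i \in [seq sp 0 i | i <- index_enum 'I_n].
    apply: map_f; exact: mem_index_enum.
  by rewrite (perm_mem perm) => /mapP[x xs ->]; exists x.
have uniq_top i j : f a < sp 0 i -> f a < sp 0 j -> i = j.
  have : (#|[pred i | (f a < sp 0 i)%R]| <= 1)%N.
    rewrite -sum1_card.
    rewrite -(big_map (sp 0) (fun z => f a < z) (fun=> 1%N)) sum1_count.
    rewrite (permP perm) count_map (eq_count (a2 := fun x => (a < x)%R)).
      exact: count_gt_sorted.
    by move=> x /=; rewrite ltcR.
  by move=> /card_le1_eqP H ai aj; apply: H.
(* Coordinates of [q] and [v] in the orthonormal eigenbasis. As [q] is fixed by [S] and [a < 1], [y]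
   is carried by the single index whose eigenvalue exceeds [a]; orthogonality then removes this
   coordinate from [w]. *)
pose y := map_mx f q *m invmx U.
pose w := map_mx f v *m invmx U.
have yE : y *m U = map_mx f q by rewrite mulmxKV.
have wE : w *m U = map_mx f v by rewrite mulmxKV.
have ysp j : y 0 j * sp 0 j = y 0 j.
  have : y *m diag_mx sp = y.
    rewrite -[RHS]/(map_mx f q *m invmx U) -{1}qS map_mxM -/SC SE -yE.
    by rewrite !mulmxA mulmxK// mulmxK.
  by move=> /matrixP /(_ 0 j); rewrite mul_mx_diag mxE.
have [i0 yi0] : exists i0, y 0 i0 != 0.
  apply/existsP; apply: contraNT q0 => /existsPn y0.
  have y00 : y = 0.
    by apply/rowP => j; rewrite [RHS]mxE; apply/eqP; have := y0 j; rewrite negbK.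
  apply/eqP/matrixP => i j; apply: (@complexI R).
  by move: yE => /matrixP /(_ i j); rewrite y00 mul0mx !mxE.
have spi0 : f a < sp 0 i0.
  by rewrite (mulfI yi0 (etrans (ysp i0) (esym (mulr1 _)))) (ltcR a 1).
have sple j : j != i0 -> exists2 x, x <= a & sp 0 j = f x.
  move=> ji0; have [x _ xE] := spR j; exists x => //.
  rewrite leNgt; apply: contra ji0 => ax; apply/eqP; apply: uniq_top => //.
  by rewrite xE ltcR.
have y0 j : j != i0 -> y 0 j = 0.
  move=> /sple[x xa xE]; apply/eqP; apply: contraTT xa => yj.
  have := mulfI yj (etrans (ysp j) (esym (mulr1 _))).
  by rewrite xE => /(@complexI R _ 1) ->; rewrite -ltNge.
have U1 : U *m U^t* = 1%:M by apply/unitarymxP.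
have UwU (p p' : 'rV[R[i]]_n) : (p *m U) *m (p' *m U)^t* = p *m p'^t*.
  by rewrite trmx_mul map_mxM mulmxA -(mulmxA p) U1 mulmx1.
have tE (p : 'rV[R[i]]_n) j : (p^t*) j 0 = Num.conj (p 0 j) by rewrite 2!mxE.
have wi0 : w 0 i0 = 0.
  have : (w *m y^t*) 0 0 = 0.
    by rewrite -UwU yE wE fconj -map_mxM vq map_mx0 mxE.
  rewrite mxE (bigD1 i0)//= big1 => [|j ji0]; last first.
    by rewrite tE (y0 _ ji0) conjC0 mulr0.
  rewrite addr0 tE => /eqP; rewrite mulf_eq0 conjC_eq0 (negbTE yi0) orbF.
  by move/eqP.
rewrite -lecR.
have -> : ((v *m S *m v^T) 0 0)%:C = \sum_j sp 0 j * (w 0 j * Num.conj (w 0 j)).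
  transitivity ((map_mx f (v *m S *m v^T)) 0 0); first by rewrite [RHS]mxE.
  rewrite !map_mxM -/SC -fconj -wE SE !mulmxA mulmxK// UwU.
  rewrite mul_mx_diag mxE; apply: eq_bigr => j _.
  by rewrite tE mxE mulrA (mulrC (w 0 j)).
have -> : (a * (v *m v^T) 0 0)%:C = \sum_j f a * (w 0 j * Num.conj (w 0 j)).
  rewrite rmorphM/= -mulr_sumr; congr (_ * _).
  transitivity ((map_mx f (v *m v^T)) 0 0); first by rewrite [RHS]mxE.
  rewrite !map_mxM -fconj -wE UwU mxE; apply: eq_bigr => j _.
  by rewrite tE.
apply: ler_sum => j _.
have [->|ji0] := eqVneq j i0; first by rewrite wi0 mul0r !mulr0.
have [x xa ->] := sple _ ji0.
by rewrite ler_wpM2r ?mul_conjC_ge0// lecR.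
Qed.

(** With [D] the diagonal matrix of [d], the transition matrix is similar to the symmetric
    [S = D^(-1/2) M D^(-1/2)]. The vector with entries [sqrt (d i)] is fixed by [S], and the
    centering hypothesis makes [sqrt (d i) * (x i - xbar)] orthogonal to it. The right-hand side is
    twice the quadratic form of [1 - S] at the latter. *)
Lemma poincare (R : realType) n (M : 'M[R]_n) (d : 'I_n -> R) (s : seq R)
    (delta xbar : R) (x : 'I_n -> R) :
  M^T = M -> (forall i, \sum_j M i j = d i) -> (forall i, 0 < d i) -> (0 < n)%N ->
  is_spectrum (invmx (diag_mx (\row_i d i)) *m M) s ->
  0 < delta -> delta <= 1 - s`_1 ->
  \sum_i d i * (x i - xbar) = 0 ->
  2 * delta * (\sum_i d i * (x i - xbar) ^+ 2)
    <= \sum_i \sum_j M i j * (x i - x j) ^+ 2.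
Proof.
move=> Msym Md d0 n0 [ss cP] delta0 gap xd.
pose r i := Num.sqrt (d i).
have r0 i : 0 < r i by rewrite sqrtr_gt0.
have rn i : r i != 0 by rewrite gt_eqF.
have rr i : r i * r i = d i by rewrite -expr2 sqr_sqrtr// ltW.
pose E : 'M[R]_n := diag_mx (\row_i r i).
pose S : 'M[R]_n := \matrix_(i, j) (M i j / (r i * r j)).
have Eu : E \in unitmx.
  rewrite unitmxE det_diag unitfE; apply/prodf_neq0 => i _; by rewrite mxE.
have EE : E *m E = diag_mx (\row_i d i).
  apply/matrixP => i j; rewrite mul_diag_mx !mxE.
  by rewrite mulrnAr rr.
have Mij i j : M j i = M i j by move/matrixP : Msym => /(_ i j); rewrite mxE.
have ESE : E *m S *m E = M.
  apply/matrixP => i j; rewrite mul_mx_diag mxE mul_diag_mx !mxE.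
  by field; rewrite !rn.
have PE : invmx (diag_mx (\row_i d i)) *m M = invmx E *m S *m E.
  have EEu : E *m E \in unitmx by rewrite unitmx_mul Eu.
  rewrite -EE -{1}ESE -[RHS](mulKmx EEu).
  by congr (_ *m _); rewrite !mulmxA mulmxK.
have specS : is_spectrum S s by split => //; rewrite -cP PE char_poly_similar.
pose y i := x i - xbar.
pose q : 'rV[R]_n := \row_i r i.
pose v : 'rV[R]_n := \row_i (r i * y i).
have ST : S^T = S.
  by apply/matrixP => i j; rewrite !mxE Mij (mulrC (r j)).
have qn : q != 0.
  apply/eqP => /matrixP /(_ 0 (Ordinal n0)); rewrite !mxE => /eqP.
  by rewrite (negbTE (rn _)).
have qS : q *m S = q.
  apply/rowP => j; rewrite !mxE.
  under eq_bigr => i _ do rewrite !mxE.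
  transitivity (\sum_i M j i / r j).
    by apply: eq_bigr => i _; rewrite Mij; field; rewrite !rn.
  by rewrite -mulr_suml Md -rr mulfK.
have vq : v *m q^T = 0.
  apply/matrixP => i j; rewrite !ord1 !mxE -[RHS]xd; apply: eq_bigr => k _.
  by rewrite !mxE -rr /y; ring.
have H := symmetric_gap ST specS (a := 1 - delta) _ _ qn qS vq.
have {}H : (v *m S *m v^T) 0 0 <= (1 - delta) * (v *m v^T) 0 0 by apply: H; lra.
have vv : (v *m v^T) 0 0 = \sum_i d i * y i ^+ 2.
  rewrite mxE; apply: eq_bigr => i _; rewrite !mxE -rr; ring.
have vSv : (v *m S *m v^T) 0 0 = \sum_i \sum_j M i j * (y i * y j).
  rewrite mxE exchange_big; apply: eq_bigr => j _; rewrite !mxE mulr_suml.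
  apply: eq_bigr => i _; rewrite !mxE Mij; field; by rewrite !rn.
have tot : \sum_i \sum_j M i j * (x i - x j) ^+ 2 =
    2 * (\sum_i d i * y i ^+ 2) - 2 * (\sum_i \sum_j M i j * (y i * y j)).
  transitivity (\sum_i \sum_j (M i j * y i ^+ 2 + M i j * y j ^+ 2
      - 2 * (M i j * (y i * y j)))).
    apply: eq_bigr => i _; apply: eq_bigr => j _; rewrite /y; ring.
  under eq_bigr do rewrite sumrB big_split/= -mulr_sumr.
  rewrite sumrB big_split/= -mulr_sumr; congr (_ - _).
  rewrite mulr_natl mulr2n; congr (_ + _).
    by apply: eq_bigr => i _; rewrite -mulr_suml Md.
  rewrite exchange_big; apply: eq_bigr => i _; rewrite -mulr_suml -Md.
  by congr (_ * _); apply: eq_bigr => j _.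
rewrite tot; rewrite vv vSv in H.
by move: H; rewrite -/y; move: (\sum_i d i * _) (\sum_i \sum_j _) => a b; lra.
Qed.

End spectral_gap.

(** * The interaction tensor *)

Lemma mulrB_split (K : comNzRingType) (a b c d : K) :
  a * c - b * d = (a - b) * c + b * (c - d).
Proof. by ring. Qed.

Lemma subrB_swap (K : zmodType) (a b c d : K) :
  (a - b) - (c - d) = (a - c) - (b - d).
Proof. by rewrite !opprB addrACA [RHS]addrACA (addrC (- b)). Qed.

Section tensor_algebra.
Context {R : realType} {N : nat} (A : 'I_N -> 'I_N -> 'I_N -> R).
Hypothesis A_int : interaction_tensor A.
Implicit Types (x y u v : 'I_N -> R) (i j k l : 'I_N).

(** Stated for functions on the sites instead of tuples, so that the same formulas apply to spins
    and to conditional means. *)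
Definition lf y i : R := \sum_j \sum_k A i j k * y j * y k.

Definition pr i j : R := \sum_k A i j k.

Definition tri y : R := \sum_i \sum_j \sum_k A i j k * y i * y j * y k.

Definition energy (beta h : R) y : R := beta / 3 * tri y + h * \sum_i y i.

Lemma tensor_ge0 i j k : 0 <= A i j k.
Proof. by case: A_int. Qed.

Lemma tensor_sym23 i j k : A i k j = A i j k.
Proof. by case: A_int => _ /(_ i j k)[]. Qed.

Lemma tensor_sym12 i j k : A j i k = A i j k.
Proof. by case: A_int => _ /(_ i j k)[]. Qed.

Lemma tensor_diag i j k : ~~ [&& i != j, i != k & j != k] -> A i j k = 0.
Proof. by case: A_int => _ _; apply. Qed.

Lemma pr_ge0 i j : 0 <= pr i j.
Proof. by apply: sumr_ge0 => k _; exact: tensor_ge0. Qed.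

Lemma pr_sym i j : pr i j = pr j i.
Proof. by apply: eq_bigr => k _; exact: tensor_sym12. Qed.

Lemma pr_diag i : pr i i = 0.
Proof. by apply: big1 => k _; apply: tensor_diag; rewrite eqxx. Qed.

Lemma row_sumE i : row_sum A i = \sum_j pr i j.
Proof. by []. Qed.

Lemma row_sum_ge0 i : 0 <= row_sum A i.
Proof. by apply: sumr_ge0 => j _; exact: pr_ge0. Qed.

Lemma sum_pr_l j : \sum_i pr i j = row_sum A j.
Proof. by apply: eq_bigr => i _; exact: pr_sym. Qed.

Lemma tri_lf y : tri y = \sum_i y i * lf y i.
Proof.
apply: eq_bigr => i _; rewrite mulr_sumr; apply: eq_bigr => j _.
by rewrite mulr_sumr; apply: eq_bigr => k _; ring.
Qed.

Lemma lf_norm C y i : (forall j, `|y j| <= C) -> `|lf y i| <= C ^+ 2 * row_sum A i.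
Proof.
move=> yC; rewrite (le_trans (ler_norm_sum _ _ _))// mulr_sumr.
apply: ler_sum => j _; rewrite (le_trans (ler_norm_sum _ _ _))// mulr_sumr.
apply: ler_sum => k _; rewrite !normrM ger0_norm ?tensor_ge0//.
rewrite -mulrA [leRHS]mulrC ler_wpM2l ?tensor_ge0// expr2.
by rewrite ler_pM.
Qed.

(** By symmetry in the last two indices the cross terms [u j * v k] and [v j * u k] cancel, so the
    difference of the two quadratic forms factors. *)
Lemma lf_sub u v i :
  lf u i - lf v i = \sum_j (u j - v j) * \sum_k A i j k * (u k + v k).
Proof.
transitivity (\sum_j \sum_k (A i j k * (u j * u k - v j * v k))).
  rewrite -sumrB; apply: eq_bigr => j _; rewrite -sumrB.
  by apply: eq_bigr => k _; ring.
transitivity (\sum_j \sum_k A i j k * (u j * u k - v j * v k)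
   + (\sum_j \sum_k A i j k * u j * v k - \sum_j \sum_k A i j k * v j * u k)).
  rewrite [X in _ + (X - _)]exchange_big/=.
  under [X in _ + (X - _)]eq_bigr do under eq_bigr do
    rewrite tensor_sym23 -mulrA (mulrC (u _)) mulrA.
  by rewrite subrr addr0.
rewrite -sumrB -big_split/=; apply: eq_bigr => j _.
rewrite -sumrB -big_split/= mulr_sumr; apply: eq_bigr => k _; ring.
Qed.

Lemma lf_lip C u v i : (forall j, `|u j| <= C) -> (forall j, `|v j| <= C) ->
  `|lf u i - lf v i| <= 2 * C * \sum_j pr i j * `|u j - v j|.
Proof.
move=> uC vC; rewrite lf_sub (le_trans (ler_norm_sum _ _ _))// mulr_sumr.
apply: ler_sum => j _; rewrite normrM.
have H : `|\sum_k A i j k * (u k + v k)| <= 2 * C * pr i j.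
  rewrite (le_trans (ler_norm_sum _ _ _))// mulr_sumr; apply: ler_sum => k _.
  rewrite normrM ger0_norm ?tensor_ge0// [leRHS]mulrC ler_wpM2l ?tensor_ge0//.
  by rewrite (le_trans (ler_normD _ _))//; have := uC k; have := vC k; lra.
by have := ler_wpM2r (normr_ge0 (u j - v j)) H; rewrite mulrC mulrA.
Qed.

Lemma lf_upd y i z : lf (upd y i z) i = lf y i.
Proof.
apply: eq_bigr => j _; apply: eq_bigr => k _; rewrite /upd.
have [->|ji] := eqVneq j i; first by rewrite tensor_diag ?eqxx// !mul0r.
by have [->|ki] := eqVneq k i; first by rewrite tensor_diag ?eqxx ?andbF// !mul0r.
Qed.

Lemma sum_delta i (F : 'I_N -> R) : \sum_j (j == i)%:R * F j = F i.
Proof.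
rewrite (bigD1 i)//= eqxx mul1r big1 ?addr0// => j /negbTE ->.
by rewrite mul0r.
Qed.

(** Entries with a repeated index vanish, so [tri] is affine in each coordinate; by symmetry the
    three positions of [i] contribute equally. *)
Lemma tri_upd y i z : tri (upd y i z) = tri (upd y i 0) + 3 * z * lf y i.
Proof.
pose y0 := upd y i 0; pose d j : R := (j == i)%:R.
have dE j k l : A j k l * upd y i z j * upd y i z k * upd y i z l =
    A j k l * y0 j * y0 k * y0 l + z * (d j * (A j k l * y0 k * y0 l))
    + z * (d k * (A k j l * y0 j * y0 l)) + z * (d l * (A l j k * y0 j * y0 k)).
  have -> : A k j l = A j k l by exact: tensor_sym12.
  have -> : A l j k = A j k l by rewrite tensor_sym12 tensor_sym23.
  have E m : upd y i z m = y0 m + z * d m.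
    by rewrite /y0 /upd /d; case: (m == i); rewrite /= ?mulr1 ?mulr0 ?add0r ?addr0.
  have [ji|ji] := eqVneq j i; have [ki|ki] := eqVneq k i;
    have [li|li] := eqVneq l i; rewrite ?ji ?ki ?li;
    try (by rewrite tensor_diag ?eqxx ?andbF//; ring);
    rewrite !E /d ?eqxx ?(negbTE ji) ?(negbTE ki) ?(negbTE li) /=
      /y0 /upd ?eqxx ?(negbTE ji) ?(negbTE ki) ?(negbTE li); ring.
rewrite /tri.
under eq_bigr do under eq_bigr do under eq_bigr do rewrite dE.
under eq_bigr do under eq_bigr do rewrite !big_split/=.
under eq_bigr do rewrite !big_split/=.
rewrite !big_split/= -/y0 -!addrA; congr (_ + _).
have lfE : \sum_j \sum_k A i j k * y0 j * y0 k = lf y i.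
  by rewrite -[LHS]/(lf y0 i) /y0 lf_upd.
have -> : \sum_j \sum_k \sum_l z * (d j * (A j k l * y0 k * y0 l)) = z * lf y i.
  rewrite -lfE -(sum_delta i (fun j => \sum_k \sum_l A j k l * y0 k * y0 l)).
  rewrite mulr_sumr; apply: eq_bigr => j _; rewrite !mulr_sumr.
  by apply: eq_bigr => k _; rewrite !mulr_sumr.
have -> : \sum_j \sum_k \sum_l z * (d k * (A k j l * y0 j * y0 l)) = z * lf y i.
  rewrite exchange_big/=.
  rewrite -lfE -(sum_delta i (fun j => \sum_k \sum_l A j k l * y0 k * y0 l)).
  rewrite mulr_sumr; apply: eq_bigr => j _; rewrite !mulr_sumr.
  by apply: eq_bigr => k _; rewrite !mulr_sumr.
have -> : \sum_j \sum_k \sum_l z * (d l * (A l j k * y0 j * y0 k)) = z * lf y i.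
  under eq_bigr do rewrite exchange_big/=.
  rewrite exchange_big/=.
  rewrite -lfE -(sum_delta i (fun j => \sum_k \sum_l A j k l * y0 k * y0 l)).
  rewrite mulr_sumr; apply: eq_bigr => j _; rewrite !mulr_sumr.
  by apply: eq_bigr => k _; rewrite !mulr_sumr.
by ring.
Qed.

Lemma energy_upd beta h y i z :
  energy beta h (upd y i z) = z * (beta * lf y i + h) + energy beta h (upd y i 0).
Proof.
rewrite /energy tri_upd.
have -> : \sum_j upd y i z j = \sum_j upd y i 0 j + z.
  rewrite (bigD1 i)//= [in RHS](bigD1 i)//= /upd eqxx add0r addrC.
  by congr (_ + _); apply: eq_bigr => j /negbTE ->.
by field.
Qed.

Lemma lf_influence C y v i l : (forall j, `|y j| <= C) -> (forall j, `|v j| <= C) ->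
  (forall j, j != l -> y j = v j) ->
  `|lf y i - lf v i| <= 4 * C ^+ 2 * pr i l.
Proof.
move=> yC vC yv; apply: le_trans (lf_lip i yC vC) _.
rewrite (bigD1 l)//= big1 ?addr0; last first.
  by move=> j jl; rewrite yv// subrr normr0 mulr0.
have yvC : `|y l - v l| <= 2 * C.
  by rewrite (le_trans (ler_normB _ _))//; have := yC l; have := vC l; lra.
have C0 : 0 <= C := le_trans (normr_ge0 _) (yC l).
have := ler_wpM2l (mulr_ge0 C0 (pr_ge0 i l)) yvC.
by move: `|y l - v l| (pr i l) => a b; lra.
Qed.

End tensor_algebra.

(** * Second moments under the Gibbs measure *)

Section gibbs_concentration.
Context (R : realType) (km kp : R) (mu : probability (measurableTypeR R) R).
Hypothesis km_le_kp : km <= kp.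
Context (C : R).
Hypotheses (km_geC : - C <= km) (kp_leC : kp <= C).
Context (N : nat) (A : 'I_N -> 'I_N -> 'I_N -> R).
Hypothesis A_int : interaction_tensor A.
Context (beta h gamma : R).
Hypothesis beta_ge0 : 0 <= beta.
Hypothesis rows_le : forall i, row_sum A i <= gamma.

Notation Ex := (Ex km kp mu).
Notation E1 := (E1 km kp mu).
Notation bm := (bm km kp).
Notation in_cube := (in_cube km kp).
Notation tilt_mean := (tilt_mean km kp mu).
Notation cumulant := (cumulant km kp mu).
Notation lf := (lf A).
Notation pr := (pr A).
Implicit Types (y v : 'I_N -> R) (i j l : 'I_N).

Definition weight (y : 'I_N -> R) : R := expR (energy A beta h y).

Definition Zc : R := Ex weight.

Definition field (y : 'I_N -> R) (i : 'I_N) : R := beta * lf y i + h.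

Definition cond_mean (y : 'I_N -> R) (i : 'I_N) : R := tilt_mean (field y i).

Definition field_bound : R := beta * (C ^+ 2 * gamma) + `|h|.

(** The Lipschitz constant of [tilt_mean] on the range of the fields, times the change of a field
    per unit of [pr i l] when spin [l] moves. *)
Definition mean_lip : R :=
  2 * C ^+ 2 * expR (2 * field_bound * C) * (beta * (4 * C ^+ 2)).

Lemma C_ge0 : 0 <= C.
Proof. by have := le_trans km_geC (le_trans km_le_kp kp_leC); lra. Qed.

Lemma cube_norm y i : in_cube y -> `|y i| <= C.
Proof.
move=> /(_ i)/andP[y1 y2].
by rewrite ler_norml (le_trans km_geC y1) (le_trans y2).
Qed.

Lemma km_itv : km <= km <= kp.
Proof. by rewrite lexx km_le_kp. Qed.

Lemma cond_mean_cube y : in_cube (cond_mean y).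
Proof. by move=> i; exact: (tilt_mean_itv _ km_le_kp km_geC kp_leC). Qed.

Lemma lf_norm_gamma y i : (forall j, `|y j| <= C) -> `|lf y i| <= C ^+ 2 * gamma.
Proof.
move=> yC; apply: le_trans (lf_norm A_int i yC) _.
by rewrite ler_wpM2l// sqr_ge0.
Qed.

Lemma field_norm y i : in_cube y -> `|field y i| <= field_bound.
Proof.
move=> cy; rewrite /field /field_bound (le_trans (ler_normD _ _))// lerD2r.
rewrite normrM ger0_norm// ler_wpM2l// lf_norm_gamma// => j; exact: cube_norm.
Qed.

Lemma bm_tri : bm (tri A).
Proof.
do 3 (apply: (bm_sum km_le_kp) => ?).
by do 3 (apply: bmM; last exact: bm_coord); exact: bm_cst.
Qed.

Lemma bm_lf i : bm (fun y => lf y i).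
Proof.
do 2 (apply: (bm_sum km_le_kp) => ?).
by do 2 (apply: bmM; last exact: bm_coord); exact: bm_cst.
Qed.

Lemma bm_weight : bm weight.
Proof.
apply: bm_exp; apply: bmD; apply: bmM; try exact: bm_cst; first exact: bm_tri.
by apply: (bm_sum km_le_kp) => ?; exact: bm_coord.
Qed.

Lemma bm_field i : bm (fun y => field y i).
Proof.
apply: bmD; last exact: bm_cst.
by apply: bmM; [exact: bm_cst|exact: bm_lf].
Qed.

Lemma bm_cond_mean i : bm (fun y => cond_mean y i).
Proof.
apply: (bm_comp (phi := tilt_mean)); last exact: bm_field.
exact: (continuous_tilt_mean km_le_kp km_geC kp_leC).
Qed.

Lemma Zc_gt0 : 0 < Zc.
Proof.
have [_ [M wM]] : bm (fun y => energy A beta h y).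
  apply: bmD; apply: bmM; try exact: bm_cst; first exact: bm_tri.
  by apply: (bm_sum km_le_kp) => ?; exact: bm_coord.
apply: lt_le_trans (expR_gt0 (- M)) _.
rewrite -(Ex_cst km kp mu N (expR (- M))).
apply: Rexp_le; [exact: bounded_measurable_cst|exact: bm_weight|].
by move=> x; rewrite ler_expR; have := wM x; rewrite ler_norml => /andP[].
Qed.

Lemma field_upd y i z : field (upd y i z) i = field y i.
Proof. by rewrite /field lf_upd. Qed.

(* [cond_mean y i] is the mean of the [i]th spin given all the others. *)
Lemma Ex_centered i (g : ('I_N -> R) -> R) : bm g ->
  (forall y z, g (upd y i z) = g y) ->
  Ex (fun y => weight y * ((y i - cond_mean y i) * g y)) = 0.
Proof.
move=> bg gi.
rewrite (Ex_resample mu i); last first.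
  apply: bmM; first exact: bm_weight.
  apply: bmM => //; apply: bmB; [exact: bm_coord|exact: bm_cond_mean].
rewrite -[RHS](Ex_cst km kp mu N 0); apply: eq_Ex => // y _.
pose c := expR (energy A beta h (upd y i 0)) * g y.
rewrite (@eq_E1 _ _ _ mu km_le_kp _
  (fun z => c * (expR (field y i * z) * (z - tilt_mean (field y i))))); last first.
  move=> z _; rewrite /weight energy_upd// expRD gi /cond_mean field_upd.
  by rewrite /upd eqxx /c [z * _]mulrC -/(field y i); ring.
rewrite E1Z//; last first.
  move=> x; apply: cvgM.
    apply: (@continuous_comp _ _ _ (fun z => field y i * z) expR).
      by apply: cvgM; [exact: cvg_cst|exact: cvg_id].
    exact: continuous_expR.
  by apply: cvgB; [exact: cvg_id|exact: cvg_cst].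
by rewrite (tilt_centered _ km_le_kp km_geC kp_leC) mulr0.
Qed.

Lemma upd_upd (y : 'I_N -> R) i z z' : upd (upd y i z) i z' = upd y i z'.
Proof. by apply/funext => j; rewrite /upd; case: eqP. Qed.

Lemma upd_neq (y : 'I_N -> R) i z j : j != i -> y j = upd y i z j.
Proof. by rewrite /upd => /negbTE ->. Qed.

Lemma mean_lip_ge0 : 0 <= mean_lip.
Proof.
rewrite /mean_lip; apply: mulr_ge0; last by rewrite mulr_ge0// mulr_ge0// sqr_ge0.
by rewrite mulr_ge0 ?expR_ge0// mulr_ge0// sqr_ge0.
Qed.

Lemma cond_mean_influence y v i l : in_cube y -> in_cube v ->
  (forall j, j != l -> y j = v j) ->
  `|cond_mean y i - cond_mean v i| <= mean_lip * pr i l.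
Proof.
move=> cy cv yv.
apply: le_trans (tilt_mean_lip mu km_le_kp km_geC kp_leC
   (field_norm i cy) (field_norm i cv)) _.
rewrite /mean_lip -[leRHS]mulrA ler_wpM2l//.
  by rewrite mulr_ge0 ?expR_ge0// mulr_ge0// sqr_ge0.
have -> : field y i - field v i = beta * (lf y i - lf v i) by rewrite /field; ring.
rewrite normrM ger0_norm// -mulrA ler_wpM2l//.
by apply: (lf_influence A_int i) => // j; exact: cube_norm.
Qed.

(** * Second moments of centered sums *)

Section second_moment.
Context (psi : 'I_N -> ('I_N -> R) -> R) (b : 'I_N -> 'I_N -> R) (P : R).
Hypotheses (bm_psi : forall j, bm (psi j))
  (psi_le : forall j y, in_cube y -> `|psi j y| <= P)
  (psi_influence : forall j l y, in_cube y ->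
     `|psi j y - psi j (upd y l km)| <= b j l).

(** The coefficient [psi j] may depend on every spin, the [j]th included; [b j l] bounds its change
    when spin [l] is set to [km]. *)
Definition centered_sum (y : 'I_N -> R) : R :=
  \sum_j (y j - cond_mean y j) * psi j y.

Lemma dev_norm y j : in_cube y -> `|y j - cond_mean y j| <= 2 * C.
Proof.
move=> cy; rewrite (le_trans (ler_normB _ _))//.
have := cube_norm j cy; have := cube_norm j (cond_mean_cube y); lra.
Qed.

Lemma bm_dev j : bm (fun y => y j - cond_mean y j).
Proof. by apply: bmB; [exact: bm_coord|exact: bm_cond_mean]. Qed.

Lemma bm_centered_sum : bm centered_sum.
Proof. by apply: (bm_sum km_le_kp) => j; apply: bmM => //; exact: bm_dev. Qed.

Lemma centered_sum_norm y : in_cube y -> `|centered_sum y| <= 2 * C * P * N%:R.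
Proof.
move=> cy; rewrite (le_trans (ler_norm_sum _ _ _))//.
rewrite mulr_natr -[N in X in _ <= X]card_ord -sumr_const; apply: ler_sum => j _.
by rewrite normrM ler_pM// ?dev_norm// psi_le.
Qed.

(** Three effects add up: the moved spin itself, present only at [j = l]; the conditional means,
    through [mean_lip]; and the coefficients, through [b]. *)
Lemma centered_sum_influence y l : in_cube y ->
  `|centered_sum y - centered_sum (upd y l km)|
    <= 2 * C * P + \sum_j (mean_lip * pr j l * P + 2 * C * b j l).
Proof.
move=> cy; have cv := upd_in_cube l cy km_itv.
set v := upd y l km in cv *.
rewrite -sumrB (le_trans (ler_norm_sum _ _ _))//.
have -> : 2 * C * P = \sum_j (j == l)%:R * (2 * C * P).
  by rewrite (sum_delta l (fun=> 2 * C * P)).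
rewrite -big_split/=; apply: ler_sum => j _.
have -> : (y j - cond_mean y j) * psi j y - (v j - cond_mean v j) * psi j v =
   (y j - v j) * psi j y - (cond_mean y j - cond_mean v j) * psi j y
   + (v j - cond_mean v j) * (psi j y - psi j v) by ring.
rewrite (le_trans (ler_normD _ _))// addrA lerD//; last first.
  by rewrite normrM ler_pM// ?dev_norm// psi_influence.
rewrite (le_trans (ler_normB _ _))// lerD//; last first.
  rewrite normrM ler_pM// ?psi_le//.
  by apply: cond_mean_influence => // k; exact: upd_neq.
have [->|jl] := eqVneq j l; last first.
  by rewrite {1}/v -upd_neq// subrr mul0r normr0 mul0r.
rewrite mul1r normrM ler_pM// ?psi_le// (le_trans (ler_normB _ _))//.
have := cube_norm l cy; have := cube_norm l cv; lra.
Qed.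

(* Replacing the [j]th spin by a constant decouples it from the rest of the sum,
   up to the influence of that spin. *)
Lemma centered_sum_second_moment :
  Ex (fun y => weight y * centered_sum y ^+ 2) <=
  Zc * \sum_j 2 * C * (b j j * (2 * C * P * N%:R)
     + P * (2 * C * P + \sum_l (mean_lip * pr l j * P + 2 * C * b l j))).
Proof.
have kmk := km_itv.
pose F j y := weight y * ((y j - cond_mean y j) * (psi j y * centered_sum y)).
have bF j : bm (F j).
  apply: bmM; first exact: bm_weight.
  by apply: bmM; [exact: bm_dev|apply: bmM => //; exact: bm_centered_sum].
rewrite (@eq_Ex _ _ _ mu km_le_kp _ _ (fun y => \sum_j F j y)); last first.
  by move=> y _; rewrite /F -mulr_sumr expr2 {1}/centered_sum mulr_suml;
    congr (_ * _); apply: eq_bigr => j _; rewrite mulrA.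
rewrite Ex_sum// mulr_sumr; apply: ler_sum => j _.
pose g y := psi j y * centered_sum y.
have bg : bm g by apply: bmM => //; exact: bm_centered_sum.
have bgu : bm (fun y => g (upd y j km)) by exact: bm_upd.
have H := Ex_centered bgu (i := j) (fun y z => congr1 g (upd_upd y j z km)).
pose c := 2 * C * (b j j * (2 * C * P * N%:R)
     + P * (2 * C * P + \sum_l (mean_lip * pr l j * P + 2 * C * b l j))).
rewrite -/c -[leLHS]subr0 -H -ExB//; last first.
  apply: bmM; first exact: bm_weight.
  by apply: bmM; first exact: bm_dev.
rewrite [leRHS]mulrC -ExZ//; last exact: bm_weight.
apply: Ex_le => //.
- apply: bmB => //; apply: bmM; first exact: bm_weight.
  by apply: bmM; first exact: bm_dev.
- by apply: bmM; [exact: bm_cst|exact: bm_weight].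
move=> y cy; rewrite /F -mulrBr -mulrBr [leRHS]mulrC.
rewrite ler_wpM2l ?expR_ge0// (le_trans (ler_norm _))// normrM /c.
have cv := upd_in_cube j cy kmk.
apply: ler_pM => //; first exact: dev_norm.
have -> : psi j y * centered_sum y - g (upd y j km) =
  (psi j y - psi j (upd y j km)) * centered_sum y
  + psi j (upd y j km) * (centered_sum y - centered_sum (upd y j km)).
  by rewrite /g; ring.
rewrite (le_trans (ler_normD _ _))// lerD// normrM ler_pM//.
- exact: psi_influence.
- exact: centered_sum_norm.
- exact: psi_le.
- exact: centered_sum_influence.
Qed.

End second_moment.

End gibbs_concentration.

(** * Mean-field equations *)

Section mean_field_equations.
Context (R : realType) (km kp : R) (mu : probability (measurableTypeR R) R).
Hypothesis km_le_kp : km <= kp.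
Context (C : R).
Hypotheses (km_geC : - C <= km) (kp_leC : kp <= C).
Context (N : nat) (A : 'I_N -> 'I_N -> 'I_N -> R).
Hypothesis A_int : interaction_tensor A.
Context (beta h gamma : R).
Hypotheses (beta_ge0 : 0 <= beta) (gamma_ge0 : 0 <= gamma).
Hypothesis rows_le : forall i, row_sum A i <= gamma.

Notation Ex := (Ex km kp mu).
Notation bm := (bm km kp).
Notation in_cube := (in_cube km kp).
Notation lf := (lf A).
Notation pr := (pr A).
Notation weight := (weight A beta h).
Notation Zc := (Zc km kp mu A beta h).
Notation cond_mean := (cond_mean km kp mu A beta h).
Notation ml := (mean_lip C beta h gamma).
Implicit Types (y v : 'I_N -> R) (i j l : 'I_N).

Let C0 : 0 <= C := C_ge0 km_le_kp km_geC kp_leC.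
Let ml0 : 0 <= ml := mean_lip_ge0 C h gamma beta_ge0.

Definition moment_const (P sb db : R) : R :=
  2 * C * (2 * C * P * db + P * (2 * C * P + ml * P * gamma + 2 * C * sb)).

(** The self-influences [b j j] multiply the crude bound [2 * C * P * N] on the whole sum, so only
    their total [db] matters. It may be as large as [o(N)], which still leaves a second moment
    [o(N^2)]. *)
Lemma second_moment_bound (psi : 'I_N -> ('I_N -> R) -> R)
    (b : 'I_N -> 'I_N -> R) (P sb db : R) :
  (forall j, bm (psi j)) ->
  (forall j y, in_cube y -> `|psi j y| <= P) ->
  (forall j l y, in_cube y -> `|psi j y - psi j (upd y l km)| <= b j l) ->
  0 <= P -> (forall j, \sum_l b l j <= sb) -> \sum_j b j j <= db ->
  Ex (fun y => weight y * (\sum_j (y j - cond_mean y j) * psi j y) ^+ 2)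
    <= Zc * (moment_const P sb db * N%:R).
Proof.
move=> bp pP pb P0 bsb bdb.
apply: le_trans (centered_sum_second_moment mu km_le_kp km_geC kp_leC A_int
  h beta_ge0 rows_le bp pP pb) _.
rewrite ler_wpM2l//; first by apply/ltW/Zc_gt0.
have CP : 0 <= 2 * C * P * N%:R by rewrite mulr_ge0// mulr_ge0// mulr_ge0.
rewrite -mulr_sumr big_split/= -mulr_suml /moment_const -[leRHS]mulrA.
rewrite ler_wpM2l ?mulr_ge0//. rewrite [leRHS]mulrDl lerD//.
  by have := ler_wpM2l CP bdb; move: (\sum_j b j j) => S; lra.
rewrite -mulr_sumr -[leRHS]mulrA ler_wpM2l// mulr_natr.
rewrite -[N in X in _ <= X]card_ord -sumr_const; apply: ler_sum => j _.
rewrite -addrA lerD2l big_split/= lerD//; last by rewrite -mulr_sumr ler_wpM2l// mulr_ge0.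
rewrite -mulr_suml -mulr_sumr (sum_pr_l A_int).
have := ler_wpM2l (mulr_ge0 ml0 P0) (rows_le j).
by move: (row_sum A j) (ml) => x m; lra.
Qed.

Definition dev_sum y : R := \sum_j (y j - cond_mean y j) * lf y j.

Definition field_dev y : R := \sum_i (lf y i - lf (cond_mean y) i) ^+ 2.

Definition dev_const : R :=
  moment_const (C ^+ 2 * gamma) (4 * C ^+ 2 * gamma) 0.

(** The coefficient [lf y j] does not see the [j]th spin: there is no self-influence, and the second
    moment is of order [N]. *)
Lemma dev_sum_second_moment :
  Ex (fun y => weight y * dev_sum y ^+ 2) <= Zc * (dev_const * N%:R).
Proof.
apply: (second_moment_bound (b := fun j l => 4 * C ^+ 2 * pr j l)).
- by move=> j; exact: bm_lf.
- by move=> j y cy; apply: (lf_norm_gamma A_int rows_le) => // k; exact: (cube_norm km_geC kp_leC).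
- move=> j l y cy; apply: (lf_influence A_int).
  + by move=> k; exact: (cube_norm km_geC kp_leC).
  + move=> k; apply: (cube_norm km_geC kp_leC); apply: upd_in_cube => //.
    by rewrite lexx.
  + by move=> k; exact: upd_neq.
- by rewrite mulr_ge0// sqr_ge0.
- move=> j; rewrite -mulr_sumr (sum_pr_l A_int) ler_wpM2l//.
  by rewrite mulr_ge0// sqr_ge0.
- by rewrite big1// => j _; rewrite pr_diag// mulr0.
Qed.

(** Entries of the second and, below, third power of the matrix [pr]: influences passing through one
    or two intermediate sites. *)
Let r2 i l : R := \sum_k pr i k * pr k l.
Let r3 i l : R := \sum_k pr i k * r2 k l.

(** The squared Frobenius norm of [pr], which is also the trace of its square and thereby controls
    self-influences. *)
Definition sq_sum : R := \sum_i \sum_j pr i j ^+ 2.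

Let pr0 i j : 0 <= pr i j := pr_ge0 A_int i j.

Let sum_r2 j : \sum_l r2 l j <= gamma ^+ 2.
Proof.
rewrite exchange_big/=.
apply: (@le_trans _ _ (\sum_k gamma * pr k j)).
  apply: ler_sum => k _; rewrite -mulr_suml (sum_pr_l A_int) ler_wpM2r//.
by rewrite -mulr_sumr (sum_pr_l A_int) expr2 ler_wpM2l.
Qed.

Let sum_r3 j : \sum_l r3 l j <= gamma ^+ 3.
Proof.
rewrite exchange_big/=.
apply: (@le_trans _ _ (\sum_k gamma * r2 k j)).
  apply: ler_sum => k _; rewrite -mulr_suml (sum_pr_l A_int) ler_wpM2r//.
  by apply: sumr_ge0 => *; rewrite mulr_ge0.
by rewrite -mulr_sumr exprS ler_wpM2l.
Qed.

Let diag_r2 : \sum_j r2 j j = sq_sum.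
Proof.
apply: eq_bigr => i _; apply: eq_bigr => k _.
by rewrite (pr_sym A_int k i) expr2.
Qed.

(** Trace of the cubed matrix: the product [pr j i * pr k j] is at most half the sum of the two
    squares, and the remaining factor [pr i k] sums to at most [gamma] over the free index. *)
Let diag_r3 : \sum_j r3 j j <= gamma * sq_sum.
Proof.
have H : \sum_j r3 j j <= \sum_j \sum_i \sum_k
    (2^-1 * (pr i k * pr j i ^+ 2) + 2^-1 * (pr i k * pr j k ^+ 2)).
  apply: ler_sum => j _; apply: ler_sum => i _; rewrite mulr_sumr.
  apply: ler_sum => k _; rewrite (pr_sym A_int k j).
  have := mulr_ge0 (pr0 i k) (sqr_ge0 (pr j i - pr j k)).
  by move: (pr i k) (pr j i) (pr j k) => a b c; lra.
apply: le_trans H _.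
under eq_bigr do under eq_bigr do rewrite big_split/= -!mulr_sumr -mulr_suml.
under eq_bigr do rewrite big_split/= -!mulr_sumr.
rewrite big_split/= -!mulr_sumr.
have h1 : \sum_j \sum_i (\sum_k pr i k) * pr j i ^+ 2 <= gamma * sq_sum.
  rewrite mulr_sumr; apply: ler_sum => j _; rewrite mulr_sumr.
  by apply: ler_sum => i _; rewrite ler_wpM2r ?sqr_ge0// -row_sumE.
have h2 : \sum_j \sum_i \sum_k pr i k * pr j k ^+ 2 <= gamma * sq_sum.
  rewrite mulr_sumr; apply: ler_sum => j _; rewrite exchange_big mulr_sumr/=.
  by apply: ler_sum => k _; rewrite -mulr_suml (sum_pr_l A_int) ler_wpM2r ?sqr_ge0.
move: h1 h2; move: (\sum_j _) (\sum_j _) (gamma * _) => a b c; lra.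
Qed.

(** One factor of each square in [field_dev] is expanded by [lf_sub]; this turns [field_dev] into a
    centered sum with these coefficients. *)
Let psi j y : R :=
  \sum_i (lf y i - lf (cond_mean y) i) * \sum_k A i j k * (y k + cond_mean y k).

Let field_dev_psi y : field_dev y = \sum_j (y j - cond_mean y j) * psi j y.
Proof.
rewrite /field_dev /psi.
under [RHS]eq_bigr do rewrite mulr_sumr.
rewrite exchange_big; apply: eq_bigr => i _.
rewrite expr2 {2}(lf_sub A_int) mulr_sumr; apply: eq_bigr => j _; ring.
Qed.

Let bm_lf_mean i : bm (fun y => lf (cond_mean y) i).
Proof.
do 2 (apply: (bm_sum km_le_kp) => ?).
do 2 (apply: bmM; last exact: (bm_cond_mean mu km_le_kp km_geC kp_leC)).
exact: bm_cst.
Qed.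

Lemma bm_field_dev : bm field_dev.
Proof.
by apply: (bm_sum km_le_kp) => i; apply: bmX; apply: bmB; [exact: bm_lf|].
Qed.

Lemma bm_dev_sum : bm dev_sum.
Proof.
apply: (bm_sum km_le_kp) => i; apply: bmM; last exact: bm_lf.
by apply: bmB; [exact: bm_coord|exact: (bm_cond_mean mu km_le_kp km_geC kp_leC)].
Qed.

Let lfC y i : in_cube y -> `|lf y i| <= C ^+ 2 * gamma.
Proof.
by move=> cy; apply: (lf_norm_gamma A_int rows_le) => // k; exact: (cube_norm km_geC kp_leC).
Qed.

Let cm_cube y : in_cube (cond_mean y).
Proof. exact: (cond_mean_cube mu km_le_kp km_geC kp_leC). Qed.

Let cC y i : in_cube y -> `|lf y i - lf (cond_mean y) i| <= 2 * (C ^+ 2 * gamma).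
Proof.
move=> cy; rewrite (le_trans (ler_normB _ _))//.
by have := lfC i cy; have := lfC i (cm_cube y); lra.
Qed.

Let sC y i j : in_cube y ->
  `|\sum_k A i j k * (y k + cond_mean y k)| <= 2 * C * pr i j.
Proof.
move=> cy; rewrite (le_trans (ler_norm_sum _ _ _))// mulr_sumr.
apply: ler_sum => k _.
rewrite normrM ger0_norm ?(tensor_ge0 A_int)// [leRHS]mulrC.
rewrite ler_wpM2l ?(tensor_ge0 A_int)// (le_trans (ler_normD _ _))//.
have := cube_norm km_geC kp_leC k cy.
have := cube_norm km_geC kp_leC k (cm_cube y); lra.
Qed.

(** Both halves of the product rule for [psi]: changing the field deviations yields
    [8 * C^3 * r2 + 4 * C^2 * ml * r3], changing the inner sums over [k] yields
    [2 * C^2 * gamma * (2 * C * pr + ml * r2)]. *)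
Let b j l : R := 4 * C ^+ 3 * gamma * pr j l
  + (8 * C ^+ 3 + 2 * C ^+ 2 * gamma * ml) * r2 j l + 4 * C ^+ 2 * ml * r3 j l.

Let psi_influence j l y : in_cube y -> `|psi j y - psi j (upd y l km)| <= b j l.
Proof.
move=> cy; set v := upd y l km.
have cv : in_cube v by apply: upd_in_cube => //; rewrite lexx.
have yv k : k != l -> y k = v k by exact: upd_neq.
have uv k : `|cond_mean y k - cond_mean v k| <= ml * pr k l.
  exact: (cond_mean_influence mu km_le_kp km_geC kp_leC A_int).
have c_inf i : `|(lf y i - lf (cond_mean y) i) - (lf v i - lf (cond_mean v) i)|
    <= 4 * C ^+ 2 * pr i l + 2 * C * ml * r2 i l.
  rewrite subrB_swap (le_trans (ler_normB _ _))// lerD//.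
    by apply: (lf_influence A_int) => // k; exact: (cube_norm km_geC kp_leC).
  apply: le_trans (lf_lip A_int (C := C) i _ _) _.
  - by move=> k; apply: (cube_norm km_geC kp_leC); exact: cm_cube.
  - by move=> k; apply: (cube_norm km_geC kp_leC); exact: cm_cube.
  - rewrite -[leRHS]mulrA ler_wpM2l ?mulr_ge0// mulr_sumr; apply: ler_sum => k _.
    by rewrite mulrCA ler_wpM2l.
have s_inf k : `|(y k + cond_mean y k) - (v k + cond_mean v k)|
    <= (k == l)%:R * (2 * C) + ml * pr k l.
  rewrite opprD addrACA (le_trans (ler_normD _ _))// lerD//.
  have [->|kl] := eqVneq k l; last by rewrite yv// subrr normr0 mul0r.
  rewrite mul1r (le_trans (ler_normB _ _))//.
  have := cube_norm km_geC kp_leC l cy.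
  have := cube_norm km_geC kp_leC l cv; lra.
have -> : psi j y - psi j v =
  \sum_i (((lf y i - lf (cond_mean y) i) - (lf v i - lf (cond_mean v) i))
      * \sum_k A i j k * (y k + cond_mean y k)
    + (lf v i - lf (cond_mean v) i)
      * \sum_k A i j k * ((y k + cond_mean y k) - (v k + cond_mean v k))).
  rewrite -sumrB; apply: eq_bigr => i _.
  under [X in _ = _ + _ * X]eq_bigr do rewrite mulrBr.
  by rewrite sumrB mulrB_split.
rewrite (le_trans (ler_norm_sum _ _ _))//.
apply: (@le_trans _ _ (\sum_i ((4 * C ^+ 2 * pr i l + 2 * C * ml * r2 i l) * (2 * C * pr i j)
   + 2 * (C ^+ 2 * gamma) * \sum_k A i j k * ((k == l)%:R * (2 * C) + ml * pr k l)))).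
  apply: ler_sum => i _; rewrite (le_trans (ler_normD _ _))// !normrM lerD//.
    by apply: ler_pM => //; exact: sC.
  apply: ler_pM => //; first exact: cC.
  rewrite (le_trans (ler_norm_sum _ _ _))//; apply: ler_sum => k _.
  by rewrite normrM ger0_norm ?(tensor_ge0 A_int)// ler_wpM2l ?(tensor_ge0 A_int).
rewrite big_split/= -mulr_sumr.
have -> : \sum_i \sum_k A i j k * ((k == l)%:R * (2 * C) + ml * pr k l)
    = 2 * C * pr j l + ml * r2 j l.
  rewrite exchange_big/=.
  transitivity (\sum_k ((k == l)%:R * (2 * C * pr j k) + ml * (pr j k * pr k l))).
    apply: eq_bigr => k _; rewrite -mulr_suml.
    have -> : \sum_i A i j k = pr j k.
      by apply: eq_bigr => i _; rewrite (tensor_sym12 A_int) (tensor_sym23 A_int).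
    by ring.
  by rewrite big_split/= sum_delta -mulr_sumr.
have -> : \sum_i (4 * C ^+ 2 * pr i l + 2 * C * ml * r2 i l) * (2 * C * pr i j)
    = 8 * C ^+ 3 * r2 j l + 4 * C ^+ 2 * ml * r3 j l.
  rewrite /r3 {2}/r2 !mulr_sumr -big_split/=; apply: eq_bigr => i _.
  by rewrite (pr_sym A_int i j); ring.
rewrite /b le_eqVlt; apply/orP; left; apply/eqP; ring.
Qed.

Definition field_dev_sb : R := 4 * C ^+ 3 * gamma * gamma
  + (8 * C ^+ 3 + 2 * C ^+ 2 * gamma * ml) * gamma ^+ 2 + 4 * C ^+ 2 * ml * gamma ^+ 3.

Definition field_dev_db : R :=
  (8 * C ^+ 3 + 2 * C ^+ 2 * gamma * ml) + 4 * C ^+ 2 * ml * gamma.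

Definition field_dev_const (s : R) : R :=
  moment_const (4 * C ^+ 3 * gamma ^+ 2) field_dev_sb (field_dev_db * s).

Let C20 : 0 <= C ^+ 2. Proof. exact: sqr_ge0. Qed.
Let C30 : 0 <= C ^+ 3. Proof. exact: exprn_ge0. Qed.

(** The diagonal of [pr] is zero and those of [r2] and [r3] sum to at most [sq_sum] and
    [gamma * sq_sum], so the total self-influence is bounded by a multiple of [sq_sum]. *)
Lemma field_dev_second_moment :
  Ex (fun y => weight y * field_dev y ^+ 2) <= Zc * (field_dev_const sq_sum * N%:R).
Proof.
rewrite (@eq_Ex _ _ _ mu km_le_kp _ _
  (fun y => weight y * (\sum_j (y j - cond_mean y j) * psi j y) ^+ 2)); last first.
  by move=> y _; rewrite field_dev_psi.
have c20 : 0 <= 8 * C ^+ 3 + 2 * C ^+ 2 * gamma * ml.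
  by rewrite addr_ge0// ?mulr_ge0.
apply: (second_moment_bound (b := b)).
- move=> j; apply: (bm_sum km_le_kp) => i; apply: bmM.
    by apply: bmB; [exact: bm_lf|exact: bm_lf_mean].
  apply: (bm_sum km_le_kp) => k; apply: bmM; first exact: bm_cst.
  by apply: bmD; [exact: bm_coord|exact: (bm_cond_mean mu km_le_kp km_geC kp_leC)].
- move=> j y cy; rewrite (le_trans (ler_norm_sum _ _ _))//.
  apply: (@le_trans _ _ (\sum_i 2 * (C ^+ 2 * gamma) * (2 * C * pr i j))).
    by apply: ler_sum => i _; rewrite normrM ler_pM// ?cC// sC.
  rewrite -!mulr_sumr (sum_pr_l A_int).
  have := ler_wpM2l (mulr_ge0 (mulr_ge0 C30 gamma_ge0) (ler0n R 4)) (rows_le j).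
  by move: (row_sum A j) => a; lra.
- exact: psi_influence.
- by rewrite mulr_ge0// ?mulr_ge0// sqr_ge0.
- move=> j; rewrite /b !big_split/= -!mulr_sumr /field_dev_sb (sum_pr_l A_int).
  by rewrite lerD ?lerD// ler_wpM2l// ?mulr_ge0.
- rewrite /b !big_split/= -!mulr_sumr diag_r2 /field_dev_db.
  rewrite big1 ?mulr0 ?add0r; last by move=> j _; exact: pr_diag.
  by rewrite [leRHS]mulrDl lerD2l -[leRHS]mulrA ler_wpM2l// ?mulr_ge0.
Qed.

Lemma weighted_markov (S : ('I_N -> R) -> R) (t K : R) : bm S -> 0 < t -> (0 < N)%N ->
  Ex (fun y => weight y * S y ^+ 2) <= Zc * (K * N%:R) ->
  Ex (fun y => weight y * (t * N%:R < `|S y|)%R%:R) <= Zc * (K / (t ^+ 2 * N%:R)).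
Proof.
move=> bS t0 N0 H.
have N0' : 0 < N%:R :> R by rewrite ltr0n.
have tN0 : 0 < t * N%:R by rewrite mulr_gt0.
have -> : Zc * (K / (t ^+ 2 * N%:R)) = (t * N%:R) ^- 2 * (Zc * (K * N%:R)).
  by field; rewrite gt_eqF//= gt_eqF.
apply: le_trans (ler_wpM2l _ H); last by rewrite invr_ge0 sqr_ge0.
have bw : bm weight by exact: bm_weight.
rewrite -ExZ; last by apply: bmM => //; exact: bmX.
apply: Ex_le => //.
- by apply: bmM => //; apply: bm_lt; [exact: bm_cst|exact: bm_norm].
- by apply: bmM; [exact: bm_cst|apply: bmM => //; exact: bmX].
move=> y _; rewrite mulrCA ler_wpM2l ?expR_ge0//.
have s0 : 0 <= (t * N%:R) ^- 2 * S y ^+ 2.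
  by rewrite mulr_ge0 ?sqr_ge0// invr_ge0 sqr_ge0.
have [tS|//] := boolP (_ < _).
rewrite ler_pdivlMl ?exprn_gt0// mulr1 -[leRHS]real_normK ?num_real//.
by rewrite ler_sqr ?nnegrE ?ltW// (lt_trans tN0).
Qed.

End mean_field_equations.

(** * Variational lower bound for the partition function *)

Section variational_bound.
Context (R : realType) (km kp : R) (mu : probability (measurableTypeR R) R).
Hypothesis km_le_kp : km <= kp.
Context (C : R).
Hypotheses (km_geC : - C <= km) (kp_leC : kp <= C).
Context (N : nat) (A : 'I_N -> 'I_N -> 'I_N -> R).
Hypothesis A_int : interaction_tensor A.
Context (beta h : R).
Hypotheses (beta_ge0 : 0 <= beta) (h_ge0 : 0 <= h).

Notation Ex := (Ex km kp mu).
Notation E1 := (E1 km kp mu).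
Notation bm := (bm km kp).
Notation in_cube := (in_cube km kp).
Notation tilt_mean := (tilt_mean km kp mu).
Notation cumulant := (cumulant km kp mu).
Notation mgf := (mgf km kp mu).
Notation weight := (weight A beta h).
Notation Zc := (Zc km kp mu A beta h).
Implicit Types (y v : 'I_N -> R) (i j k l : 'I_N) (t s e J lam : R).

Let C0 : 0 <= C := C_ge0 km_le_kp km_geC kp_leC.

Lemma continuous_cumulant : continuous cumulant.
Proof.
apply: (locally_lipschitz_continuous (K := fun=> C)) => B t s _ _.
exact: (cumulant_lip mu km_le_kp km_geC kp_leC).
Qed.

Definition tilt_density (t z : R) : R := expR (t * z - cumulant t).

Lemma tilt_density_exp t z : tilt_density t z = expR (t * z - cumulant t).
Proof. by []. Qed.

Lemma tilt_densityE t z : tilt_density t z = expR (t * z) / mgf t.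
Proof.
by rewrite /tilt_density expRD expRN (expR_cumulant mu km_le_kp km_geC kp_leC).
Qed.

Lemma continuous_tilt_density t : continuous (tilt_density t).
Proof.
move=> x; apply: (@continuous_comp _ _ _ (fun z => t * z - cumulant t) expR).
  apply: cvgB; last exact: cvg_cst.
  by apply: cvgM; [exact: cvg_cst|exact: cvg_id].
exact: continuous_expR.
Qed.

Lemma E1_tilt_density t : E1 (tilt_density t) = 1.
Proof.
have ce : continuous (fun z => expR (t * z)).
  move=> x; apply: (@continuous_comp _ _ _ (fun z => t * z) expR).
    by apply: cvgM; [exact: cvg_cst|exact: cvg_id].
  exact: continuous_expR.
rewrite (@eq_E1 _ _ _ mu km_le_kp _ (fun z => (mgf t)^-1 * expR (t * z))); last first.
  by move=> z _; rewrite tilt_densityE mulrC.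
rewrite E1Z// mulVf// gt_eqF//.
exact: (mgf_gt0 mu km_le_kp km_geC kp_leC).
Qed.

Lemma bm_tilt_density (th : ('I_N -> R) -> R) i :
  bm th -> bm (fun y => tilt_density (th y) (y i)).
Proof.
move=> bt; apply: bm_exp; apply: bmB.
  by apply: bmM => //; exact: bm_coord.
apply: (bm_comp (phi := cumulant)) => //; exact: continuous_cumulant.
Qed.

#[local] Opaque tilt_density.

(* The coordinates in [r] are integrated out one at a time. *)
Lemma Ex_tilt_prod (r : seq 'I_N) (th : 'I_N -> ('I_N -> R) -> R) :
  uniq r -> (forall i, bm (th i)) ->
  (forall i j y z, i \in r -> j \in r -> th i (upd y j z) = th i y) ->
  Ex (fun y => \prod_(i <- r) tilt_density (th i y) (y i)) = 1.
Proof.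
move=> + bth; elim: r => [_ _|j r IH /= /andP[jr ur] thr].
  rewrite -[RHS](Ex_cst km kp mu N 1); apply: eq_Ex => // y _.
  by rewrite big_nil.
rewrite (Ex_resample mu j); last first.
  by apply: (bm_prod km_le_kp) => i; exact: bm_tilt_density.
rewrite -[RHS]IH//; last first.
  by move=> i l y z ir lr; apply: thr; rewrite inE ?ir ?lr orbT.
apply: eq_Ex => // y _.
rewrite (@eq_E1 _ _ _ mu km_le_kp _
  (fun z => (\prod_(i <- r) tilt_density (th i y) (y i)) * tilt_density (th j y) z)).
  by rewrite E1Z// ?E1_tilt_density ?mulr1//; exact: continuous_tilt_density.
move=> z _; have rE : \prod_(i <- r) tilt_density (th i (upd y j z)) (upd y j z i) =
    \prod_(i <- r) tilt_density (th i y) (y i).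
  apply: eq_big_seq => i ir.
  rewrite thr ?inE ?eqxx ?ir ?orbT// -upd_neq//.
  by apply: contraNneq jr => <-.
have thj : th j (upd y j z) = th j y by apply: thr; rewrite inE eqxx.
have uj : upd y j z j = z by rewrite /upd eqxx.
rewrite big_cons.
rewrite [LHS]mulrC.
exact: (f_equal2 *%R rE (f_equal2 tilt_density thj uj)).
Qed.

Definition tilt_prod t y : R := \prod_i tilt_density t (y i).

Lemma bm_tilt_prod t : bm (tilt_prod t).
Proof.
apply: (bm_prod km_le_kp) => i.
by apply: (bm_tilt_density (th := fun=> t)); exact: bm_cst.
Qed.

Lemma tilt_prod_ge0 t y : 0 <= tilt_prod t y.
Proof. by apply: prodr_ge0 => i _; rewrite tilt_density_exp expR_ge0. Qed.

Lemma Ex_tilt_prod1 t : Ex (tilt_prod t) = 1.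
Proof.
apply: (Ex_tilt_prod (th := fun _ _ => t)) => //; first exact: index_enum_uniq.
by move=> i; exact: bm_cst.
Qed.

Lemma Ex_tilt_coord t i (g : ('I_N -> R) -> R) : bm g ->
  (forall y z, g (upd y i z) = g y) ->
  Ex (fun y => tilt_prod t y * (y i * g y)) = tilt_mean t * Ex (fun y => tilt_prod t y * g y).
Proof.
move=> bg gi; have bt := bm_tilt_prod t.
rewrite -ExZ//; last exact: bmM.
apply/eqP; rewrite -subr_eq0 -ExB//; last 2 first.
- by apply: bmM => //; apply: bmM => //; exact: bm_coord.
- by apply: bmM; [exact: bm_cst|exact: bmM].
apply/eqP; rewrite (Ex_resample mu i); last first.
  apply: bmB; last by apply: bmM; [exact: bm_cst|exact: bmM].
  by apply: bmM => //; apply: bmM => //; exact: bm_coord.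
rewrite -[RHS](Ex_cst km kp mu N 0); apply: eq_Ex => // y _.
pose c := (\prod_(l | l != i) tilt_density t (y l)) * g y / mgf t.
rewrite (@eq_E1 _ _ _ mu km_le_kp _
  (fun z => c * (expR (t * z) * (z - tilt_mean t)))); last first.
  move=> z _; have -> : tilt_prod t (upd y i z)
      = tilt_density t z * \prod_(l | l != i) tilt_density t (y l).
    rewrite /tilt_prod (bigD1 i)//= {1}/upd eqxx; congr (_ * _).
    by apply: eq_bigr => l li; rewrite -upd_neq.
  by rewrite gi /upd eqxx tilt_densityE /c; ring.
rewrite E1Z//; last first.
  move=> x; apply: cvgM.
    apply: (@continuous_comp _ _ _ (fun z => t * z) expR).
      by apply: cvgM; [exact: cvg_cst|exact: cvg_id].
    exact: continuous_expR.
  by apply: cvgB; [exact: cvg_id|exact: cvg_cst].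
by rewrite (tilt_centered mu km_le_kp km_geC kp_leC) mulr0.
Qed.

Lemma Ex_tilt_mean t i : Ex (fun y => tilt_prod t y * y i) = tilt_mean t.
Proof.
transitivity (Ex (fun y => tilt_prod t y * (y i * 1))).
  by apply: eq_Ex => // y _; rewrite mulr1.
rewrite Ex_tilt_coord//; last exact: bm_cst.
rewrite -[RHS]mulr1 -[in RHS](Ex_tilt_prod1 t); congr (_ * _).
by apply: eq_Ex => // y _; rewrite mulr1.
Qed.

Lemma Ex_tilt_triple t i j k : i != j -> i != k -> j != k ->
  Ex (fun y => tilt_prod t y * (y i * (y j * y k))) = tilt_mean t ^+ 3.
Proof.
move=> ij ik jk; have bc l : bm (fun y => y l) by exact: bm_coord.
rewrite Ex_tilt_coord; last 2 first.
- exact: bmM.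
- by move=> y z; rewrite -!upd_neq 1?eq_sym.
rewrite Ex_tilt_coord//; last by move=> y z; rewrite -upd_neq 1?eq_sym.
by rewrite Ex_tilt_mean; ring.
Qed.

(** Triples with a repeated index have zero entries, so every surviving product of three spins
    factors under the product law and there is no diagonal correction. *)
Lemma Ex_tilt_energy t :
  Ex (fun y => tilt_prod t y * energy A beta h y) =
  beta / 3 * (tilt_mean t ^+ 3 * \sum_i row_sum A i) + h * (N%:R * tilt_mean t).
Proof.
have bt := bm_tilt_prod t.
have bc l : bm (fun y => y l) by exact: bm_coord.
have btri i j k : bm (fun y => tilt_prod t y * (y i * (y j * y k))).
  by apply: bmM => //; apply: bmM => //; exact: bmM.
rewrite (@eq_Ex _ _ _ mu km_le_kp _ _ (fun y =>
  beta / 3 * (\sum_i \sum_j \sum_k A i j k * (tilt_prod t y * (y i * (y j * y k))))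
  + h * (\sum_i tilt_prod t y * y i))); last first.
  move=> y _; rewrite /energy mulrDr; congr (_ + _); last first.
    by rewrite -mulr_sumr mulrCA.
  rewrite mulrCA; congr (_ * _); rewrite mulr_sumr; apply: eq_bigr => i _.
  rewrite mulr_sumr; apply: eq_bigr => j _; rewrite mulr_sumr.
  by apply: eq_bigr => k _; ring.
have bAk i j k : bm (fun y => A i j k * (tilt_prod t y * (y i * (y j * y k)))).
  by apply: bmM => //; exact: bm_cst.
have bAj i j : bm (fun y => \sum_k A i j k * (tilt_prod t y * (y i * (y j * y k)))).
  exact: (bm_sum km_le_kp).
have bAi i : bm (fun y => \sum_j \sum_k A i j k * (tilt_prod t y * (y i * (y j * y k)))).
  exact: (bm_sum km_le_kp).
have bA : bm (fun y => \sum_i \sum_j \sum_k A i j k * (tilt_prod t y * (y i * (y j * y k)))).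
  exact: (bm_sum km_le_kp).
have bs : bm (fun y => \sum_i tilt_prod t y * y i).
  by apply: (bm_sum km_le_kp) => i; exact: bmM.
rewrite ExD//; last 2 first.
- by apply: bmM => //; exact: bm_cst.
- by apply: bmM => //; exact: bm_cst.
rewrite !ExZ//; congr (_ * _ + _ * _).
  rewrite Ex_sum// mulr_sumr; apply: eq_bigr => i _.
  rewrite Ex_sum// mulr_sumr; apply: eq_bigr => j _.
  rewrite Ex_sum// mulr_sumr; apply: eq_bigr => k _.
  rewrite ExZ// mulrC.
  have [/and3P[ij ik jk]|nd] := boolP [&& i != j, i != k & j != k].
    by rewrite Ex_tilt_triple.
  by rewrite (tensor_diag A_int nd) !mulr0.
rewrite Ex_sum//; last by move=> i; exact: bmM.
rewrite mulr_natl -[N in RHS]card_ord -sumr_const; apply: eq_bigr => i _.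
exact: Ex_tilt_mean.
Qed.

(* Jensen's inequality for the trial product measure [tilt_prod t]. *)
Lemma ln_Zc_ge t :
  beta / 3 * (tilt_mean t ^+ 3 * \sum_i row_sum A i) + h * (N%:R * tilt_mean t)
    - N%:R * (t * tilt_mean t - cumulant t) <= ln Zc.
Proof.
set a := (X in X <= _).
have bt := bm_tilt_prod t.
have bc l : bm (fun y => y l) by exact: bm_coord.
have Z0 : 0 < Zc by exact: (Zc_gt0 mu km_le_kp).
rewrite -[a]expRK ler_ln ?posrE ?expR_gt0//.
pose X y := energy A beta h y - t * (\sum_i y i) + N%:R * cumulant t.
have be : bm (fun y => energy A beta h y).
  apply: bmD; apply: bmM; try exact: bm_cst; first exact: bm_tri.
  exact: (bm_sum km_le_kp).
have bs : bm (fun y => \sum_i tilt_prod t y * y i).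
  by apply: (bm_sum km_le_kp) => i; exact: bmM.
have wX y : weight y = tilt_prod t y * expR (X y).
  have -> : tilt_prod t y = expR (t * (\sum_i y i) - N%:R * cumulant t).
    rewrite /tilt_prod (eq_bigr _ (fun i _ => tilt_density_exp t (y i))) -expR_sum.
    congr expR.
    rewrite sumrB mulr_sumr; congr (_ - _).
    by rewrite sumr_const card_ord mulr_natl.
  by rewrite -expRD /weight; congr expR; rewrite /X; ring.
(* [L] is [tilt_prod t y * (1 + (X y - a))], the tangent of the exponential at the tilted mean [a]
   of [X], expanded so that its integral splits into known terms. *)
pose L y := (1 - a + N%:R * cumulant t) * tilt_prod t y
   + (tilt_prod t y * energy A beta h y) - t * (\sum_i tilt_prod t y * y i).
have bL : bm L.
  apply: bmB; last by apply: bmM => //; exact: bm_cst.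
  apply: bmD; last exact: bmM.
  by apply: bmM => //; exact: bm_cst.
have ExL : Ex L = 1.
  rewrite ExB//; last 2 first.
  - apply: bmD; last exact: bmM.
    by apply: bmM => //; exact: bm_cst.
  - by apply: bmM => //; exact: bm_cst.
  rewrite ExD//; last 2 first.
  - by apply: bmM => //; exact: bm_cst.
  - exact: bmM.
  have sE : \sum_i Ex (fun y => tilt_prod t y * y i) = N%:R * tilt_mean t.
    rewrite mulr_natl -[N in RHS]card_ord -sumr_const; apply: eq_bigr => i _.
    exact: Ex_tilt_mean.
  rewrite !ExZ// Ex_tilt_prod1 Ex_tilt_energy Ex_sum//; last by move=> i; exact: bmM.
  rewrite sE /a; move: (tilt_mean t) (cumulant t) (\sum_i _) => x z s; ring.
rewrite -[leLHS]mulr1 -ExL -ExZ//.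
apply: Ex_le => //.
- by apply: bmM => //; exact: bm_cst.
- exact: bm_weight.
move=> y _; rewrite wX.
have -> : L y = tilt_prod t y * (1 + (X y - a)).
  by rewrite /L /X -mulr_sumr; ring.
rewrite mulrCA ler_wpM2l ?tilt_prod_ge0//.
have -> : expR (X y) = expR a * expR (X y - a).
  by rewrite -expRD addrC subrK.
by rewrite ler_pM2l ?expR_gt0// expR_ge1Dx.
Qed.

Lemma site_bound_tilt t : (0 < N)%N ->
  beta / 3 * (mean_row_sum A * tilt_mean t ^+ 3) + h * tilt_mean t
    - (t * tilt_mean t - cumulant t) <= N%:R^-1 * ln Zc.
Proof.
move=> N0; have N0' : N%:R != 0 :> R by rewrite pnatr_eq0 -lt0n.
have Hi : 0 <= N%:R^-1 :> R by rewrite invr_ge0.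
apply: le_trans (ler_wpM2l Hi (ln_Zc_ge t)).
rewrite le_eqVlt /mean_row_sum; apply/orP; left; apply/eqP.
by move: (tilt_mean t) (cumulant t) (\sum_i _) => x z s; field.
Qed.

(** Serves values [t] that need not be tilted means: a tilted mean [v] slightly below [t] has rate
    at most [J], and the polynomial part loses at most a multiple of [t - v]. *)
Lemma site_bound t J : (0 < N)%N -> supp mu kp -> 0 < t -> t <= C ->
  (forall l : R, l * t - cumulant l <= J) -> (exists s, tilt_mean s <= t) ->
  beta / 3 * (mean_row_sum A * t ^+ 3) + h * t - J <= N%:R^-1 * ln Zc.
Proof.
move=> N0 skp t0 tC tJ st.
have m0 : 0 <= mean_row_sum A.
  by rewrite mulr_ge0 ?invr_ge0//; apply: sumr_ge0 => i _; exact: row_sum_ge0.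
(* A Lipschitz constant on [[0, C]] for [beta / 3 * (mean_row_sum A * x ^+ 3) + h * x]. *)
pose K := beta * (mean_row_sum A * C ^+ 2) + h.
have K0 : 0 <= K by rewrite addr_ge0// mulr_ge0// mulr_ge0// exprn_ge0.
apply/ler_addgt0Pr => e e0.
pose d := Num.min t (e / (K + 1)).
have d0 : 0 < d by rewrite lt_min t0 divr_gt0// ltr_wpDl.
have [l [vl vt vJ]] := tilt_mean_approx km_le_kp km_geC kp_leC skp tJ st d0.
have H := site_bound_tilt l N0.
have dt : d <= t by rewrite ge_min lexx.
have dK : K * d <= e.
  have : d * (K + 1) <= e by rewrite -ler_pdivlMr ?ltr_wpDl// ge_min lexx orbT.
  by lra.
move: vl vt vJ H; set v := tilt_mean l; move: (l * v - cumulant l) => I vl vt vJ H.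
have v0 : 0 <= v by lra.
have cube : t ^+ 3 - v ^+ 3 <= 3 * C ^+ 2 * d.
  have -> : t ^+ 3 - v ^+ 3 = (t - v) * (t ^+ 2 + t * v + v ^+ 2) by ring.
  have vC : v <= C by lra.
  have b1 : t ^+ 2 <= C ^+ 2 by rewrite ler_sqr ?nnegrE// ltW.
  have b2 : t * v <= C ^+ 2 by rewrite expr2 ler_pM// ltW.
  have b3 : v ^+ 2 <= C ^+ 2 by rewrite ler_sqr ?nnegrE.
  rewrite mulrC; apply: ler_pM; try lra.
  by rewrite !addr_ge0 ?sqr_ge0// mulr_ge0// ltW.
have b1 : beta / 3 * (mean_row_sum A * (t ^+ 3 - v ^+ 3))
    <= beta / 3 * (mean_row_sum A * (3 * C ^+ 2 * d)).
  by rewrite ler_wpM2l ?divr_ge0// ler_wpM2l.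
have b2 : h * (t - v) <= h * d by rewrite ler_wpM2l//; lra.
move: H b1 b2 dK; rewrite /K; move: (N%:R^-1 * _) (mean_row_sum A) (t ^+ 3) (v ^+ 3) (C ^+ 2).
by move=> z m t3 v3 c; lra.
Qed.

(** A negative mean is reflected. The hypothesis bounds the rate at the reflected point by the rate
    at the original one, and the original mean is the tilted mean below the target that [site_bound]
    asks for. *)
Lemma site_bound_abs t : (0 < N)%N -> supp mu kp ->
  (forall s l : R, s <= 0 -> tilt_mean t = s ->
     l * - s - cumulant l <= t * s - cumulant t) ->
  beta / 3 * (mean_row_sum A * `|tilt_mean t| ^+ 3) + h * `|tilt_mean t|
    - (t * tilt_mean t - cumulant t) <= N%:R^-1 * ln Zc.
Proof.
move=> N0 skp H; have [u0|u0] := leP 0 (tilt_mean t).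
  by rewrite ger0_norm//; exact: site_bound_tilt.
rewrite (ltr0_norm u0); apply: site_bound N0 skp _ _ _ _.
- by rewrite oppr_gt0.
- have := tilt_mean_norm mu km_le_kp km_geC kp_leC t.
  by rewrite (ltr0_norm u0).
- by move=> l; apply: H; [exact: ltW|].
- by exists t; rewrite -subr_ge0; lra.
Qed.

End variational_bound.

(** * Stability of near-optimizers *)

Section near_optimizers.
Context (R : realType) (N : nat) (A : 'I_N -> 'I_N -> 'I_N -> R).
Hypothesis A_int : interaction_tensor A.
Context (C gamma beta h : R).
Hypotheses (C_ge0 : 0 <= C) (gamma_ge0 : 0 <= gamma) (beta_gt0 : 0 < beta)
  (h_ge0 : 0 <= h).
Hypothesis rows_le : forall i, row_sum A i <= gamma.
Hypothesis N_gt0 : (0 < N)%N.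

Notation lf := (lf A).
Notation pr := (pr A).
Notation tri := (tri A).
Notation rs := (row_sum A).
Notation rbar := (mean_row_sum A).

Definition irregularity : R := \sum_i `|rs i - rbar|.

Section optimizer.
Context (u I : 'I_N -> R) (L : R).
Hypothesis u_le : forall i, `|u i| <= C.
Hypothesis site : forall i,
  beta / 3 * (rbar * `|u i| ^+ 3) + h * `|u i| - I i <= N%:R^-1 * L.

Let a (i : 'I_N) : R := `|u i|.

Definition gibbs_functional : R := beta / 3 * tri u + h * \sum_i u i - \sum_i I i.

Definition cubic_variation : R := \sum_i \sum_j pr i j * `|a i - a j| ^+ 3.

Definition negative_mass : R := \sum_i (a i - u i).

(** The AM-GM gap equals [(x + y + z) / 6] times the sum of the three squared differences. Only
    [(x + y) * (x - y)^2 / 6] is kept, and [x + y >= |x - y|]. *)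
Lemma amgm_defect (x y z : R) : 0 <= x -> 0 <= y -> 0 <= z ->
  x * y * z + 6^-1 * `|x - y| ^+ 3 <= (x ^+ 3 + y ^+ 3 + z ^+ 3) / 3.
Proof.
move=> x0 y0 z0.
have h1 : `|x - y| ^+ 3 <= (x + y) * (x - y) ^+ 2.
  rewrite exprS real_normK ?num_real// ler_wpM2r ?sqr_ge0//.
  by rewrite (le_trans (ler_normB _ _))// !ger0_norm.
have h2 : 0 <= z * (x - y) ^+ 2 by rewrite mulr_ge0// sqr_ge0.
have h3 : 0 <= (x + y + z) * ((y - z) ^+ 2 + (z - x) ^+ 2).
  by rewrite mulr_ge0 ?addr_ge0// sqr_ge0.
move: h1; move: (`|x - y| ^+ 3) => w; lra.
Qed.

Lemma tri_le : tri u + 6^-1 * cubic_variation <= \sum_i rs i * a i ^+ 3.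
Proof.
have a0 i : 0 <= a i by exact: normr_ge0.
have -> : \sum_i rs i * a i ^+ 3 =
    \sum_i \sum_j \sum_k A i j k * ((a i ^+ 3 + a j ^+ 3 + a k ^+ 3) / 3).
  have E1 : \sum_i rs i * a i ^+ 3 = \sum_i \sum_j \sum_k A i j k * a i ^+ 3.
    by apply: eq_bigr => i _; rewrite mulr_suml; apply: eq_bigr => j _; rewrite mulr_suml.
  have E2 : \sum_i rs i * a i ^+ 3 = \sum_i \sum_j \sum_k A i j k * a j ^+ 3.
    rewrite E1 exchange_big; apply: eq_bigr => j _; apply: eq_bigr => i _.
    by apply: eq_bigr => k _; rewrite (tensor_sym12 A_int).
  have E3 : \sum_i rs i * a i ^+ 3 = \sum_i \sum_j \sum_k A i j k * a k ^+ 3.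
    rewrite E2; apply: eq_bigr => i _; rewrite exchange_big.
    by apply: eq_bigr => k _; apply: eq_bigr => j _; rewrite (tensor_sym23 A_int).
  transitivity (3^-1 * (\sum_i \sum_j \sum_k A i j k * a i ^+ 3
     + \sum_i \sum_j \sum_k A i j k * a j ^+ 3
     + \sum_i \sum_j \sum_k A i j k * a k ^+ 3)).
    rewrite -E3 -E2 -E1; move: (\sum_i _) => s; lra.
  rewrite -!big_split mulr_sumr; apply: eq_bigr => i _.
  rewrite -!big_split mulr_sumr; apply: eq_bigr => j _.
  rewrite -!big_split mulr_sumr; apply: eq_bigr => k _ /=; by field.
rewrite /cubic_variation mulr_sumr -big_split; apply: ler_sum => i _ /=.
rewrite mulr_sumr -big_split; apply: ler_sum => j _ /=.
rewrite mulrCA mulr_suml -big_split; apply: ler_sum => k _ /=.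
rewrite -mulrA -mulrA -mulrDr ler_wpM2l ?(tensor_ge0 A_int)//.
apply: le_trans (amgm_defect (a0 i) (a0 j) (a0 k)).
by rewrite lerD2r mulrA (le_trans (ler_norm _))// !normrM.
Qed.

(** Summing [site] bounds the functional written with [rbar] in place of [rs i], a replacement that
    costs [irregularity]. Whatever AM-GM and the passage to absolute values lose must then fit into
    [L - gibbs_functional]. The factor [18] is [3 * 6]. *)
Lemma gibbs_functional_defect :
  beta / 18 * cubic_variation + h * negative_mass
    <= L - gibbs_functional + beta / 3 * (C ^+ 3 * irregularity).
Proof.
have b0 : 0 <= beta / 3 by rewrite divr_ge0// ltW.
have H1 := ler_wpM2l b0 tri_le.
have H2 : \sum_i (beta / 3 * (rbar * a i ^+ 3) + h * a i - I i) <= L.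
  have -> : L = \sum_(i < N) N%:R^-1 * L.
    rewrite sumr_const card_ord -[RHS]mulr_natl mulrA mulfV ?mul1r//.
    by rewrite pnatr_eq0 -lt0n.
  by apply: ler_sum => i _; exact: site.
have H3 : \sum_i rs i * a i ^+ 3 <= \sum_i rbar * a i ^+ 3 + C ^+ 3 * irregularity.
  rewrite /irregularity mulr_sumr -big_split; apply: ler_sum => i _ /=.
  have c3 : a i ^+ 3 <= C ^+ 3 by apply: lerXn2r; rewrite ?nnegrE ?normr_ge0// u_le.
  have := ler_wpM2r (exprn_ge0 3 (normr_ge0 (u i))) (ler_norm (rs i - rbar)).
  have := ler_wpM2r (normr_ge0 (rs i - rbar)) c3.
  by rewrite -/(a i); move: (`|rs i - rbar|) (a i ^+ 3) (C ^+ 3) (rs i) rbar => n t c x y; lra.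
have H4 := ler_wpM2l b0 H3.
move: H1 H2 H4; rewrite /gibbs_functional /negative_mass.
rewrite !(sumrB, big_split) /= -!mulr_sumr.
move: (tri u) cubic_variation irregularity (\sum_i u i) (\sum_i I i) (\sum_i a i) => t V X s1 s2 s3.
move: (\sum_i rs i * _) (\sum_i a i ^+ 3) (C ^+ 3) rbar => r1 r2 c3 rb; lra.
Qed.

(** * From small defects to nearly constant fields *)

Context (alpha delta : R).
Hypotheses (alpha_gt0 : 0 < alpha) (delta_gt0 : 0 < delta).
Hypothesis mean_ge : alpha <= rbar.
Hypothesis gap : forall (x : 'I_N -> R) (xbar : R),
  \sum_i rs i * (x i - xbar) = 0 ->
  2 * delta * (\sum_i rs i * (x i - xbar) ^+ 2)
    <= \sum_i \sum_j pr i j * (x i - x j) ^+ 2.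

Lemma sum_row_sum : \sum_i rs i = N%:R * rbar.
Proof.
by rewrite /mean_row_sum mulrA mulfV ?mul1r// pnatr_eq0 -lt0n.
Qed.

Let S1 : R := \sum_i rs i.

Let S1_gt0 : 0 < S1.
Proof.
by rewrite /S1 sum_row_sum mulr_gt0 ?ltr0n//; exact: lt_le_trans mean_ge.
Qed.

(** Weighted by [rs], the stationary weights of the walk, because the Poincare inequality requires
    this centering. *)
Let abar : R := (\sum_i rs i * a i) / S1.

Let abar_itv : 0 <= abar <= C.
Proof.
apply/andP; split.
  rewrite divr_ge0 ?(ltW S1_gt0)//; apply: sumr_ge0 => i _.
  by rewrite mulr_ge0 ?(row_sum_ge0 A_int)// normr_ge0.
rewrite ler_pdivrMr// mulrC /S1 mulr_suml; apply: ler_sum => i _.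
by rewrite ler_wpM2l ?(row_sum_ge0 A_int)//; exact: u_le.
Qed.

(** Termwise [|t| <= e + t^2 / e], a substitute for Cauchy-Schwarz with a free parameter. *)
Lemma sum_cutoff (I' : finType) (x : I' -> R) (e : R) : 0 < e ->
  \sum_i `|x i| <= e * #|I'|%:R + e^-1 * \sum_i x i ^+ 2.
Proof.
move=> e0; rewrite mulr_natr -sumr_const mulr_sumr -big_split; apply: ler_sum => i _ /=.
rewrite -real_normK ?num_real//; move: `|x i| (normr_ge0 (x i)) => t t0.
rewrite -(ler_pM2l e0) mulrDr mulrA mulfV ?gt_eqF// mul1r.
have : 0 <= (t - e) ^+ 2 by exact: sqr_ge0.
have : 0 <= e ^+ 2 by exact: sqr_ge0.
have : 0 <= e * t by rewrite mulr_ge0// ltW.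
by lra.
Qed.

(** Termwise [t^2 <= e^2 + t^3 / e], according to whether [t <= e]. It passes from the cubic defect
    to the squares of the Poincare inequality. *)
Lemma quadratic_variation_le (e : R) : 0 < e ->
  \sum_i \sum_j pr i j * (a i - a j) ^+ 2
    <= e ^+ 2 * (gamma * N%:R) + e^-1 * cubic_variation.
Proof.
move=> e0; apply: (@le_trans _ _
  (\sum_i \sum_j (e ^+ 2 * pr i j + e^-1 * (pr i j * `|a i - a j| ^+ 3)))).
  apply: ler_sum => i _; apply: ler_sum => j _.
  rewrite -real_normK ?num_real//; move: `|a i - a j| (normr_ge0 (a i - a j)) => t t0.
  have -> : e ^+ 2 * pr i j + e^-1 * (pr i j * t ^+ 3) =
    pr i j * (e ^+ 2 + e^-1 * t ^+ 3) by ring.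
  rewrite ler_wpM2l ?(pr_ge0 A_int)//.
  have [te|et] := leP t e.
    by rewrite -[leLHS]addr0 lerD ?mulr_ge0 ?exprn_ge0 ?invr_ge0 ?(ltW e0)// ler_sqr ?nnegrE// ltW.
  rewrite -[leLHS]add0r lerD ?sqr_ge0//.
  by rewrite ler_pdivlMl// exprS mulrC [leRHS]mulrC ler_wpM2l ?sqr_ge0// ltW.
under eq_bigr do rewrite big_split/= -!mulr_sumr.
rewrite big_split/= -!mulr_sumr lerD2r ler_wpM2l ?sqr_ge0//.
apply: (@le_trans _ _ (\sum_(i < N) gamma)).
  by apply: ler_sum => i _; exact: rows_le.
by rewrite sumr_const card_ord mulr_natr.
Qed.

(** The Poincare inequality controls squares weighted by [rs i], which may be small at some sites.
    Exchanging [rs i] for [rbar >= alpha] costs [C ^+ 2 * irregularity], since deviations are at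
    most [C]. *)
Lemma abs_deviation_le (e e' : R) : 0 < e -> 0 < e' ->
  \sum_i `|a i - abar| <= e' * N%:R + e'^-1 * (alpha^-1 *
    ((2 * delta)^-1 * (e ^+ 2 * (gamma * N%:R) + e^-1 * cubic_variation)
     + C ^+ 2 * irregularity)).
Proof.
move=> e0 e'0; have := sum_cutoff (fun i => a i - abar) e'0.
rewrite card_ord => /le_trans; apply; rewrite lerD2l ler_wpM2l ?invr_ge0 ?(ltW e'0)//.
rewrite ler_pdivlMl//.
have g : \sum_i rs i * (a i - abar) = 0.
  under eq_bigr do rewrite mulrBr.
  by rewrite sumrB -mulr_suml -/S1 /abar mulrC divfK ?subrr// gt_eqF.
have H1 : \sum_i rs i * (a i - abar) ^+ 2 <= (2 * delta)^-1 *
    (e ^+ 2 * (gamma * N%:R) + e^-1 * cubic_variation).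
  rewrite ler_pdivlMl ?mulr_gt0//.
  exact: le_trans (gap g) (quadratic_variation_le e0).
apply: le_trans (lerD H1 (lexx _)).
rewrite !mulr_sumr -big_split; apply: ler_sum => i _ /=.
have d2 : (a i - abar) ^+ 2 <= C ^+ 2.
  rewrite -real_normK ?num_real// ler_sqr ?nnegrE// ler_norml.
  have := u_le i; rewrite -/(a i); have := normr_ge0 (u i); rewrite -/(a i).
  by case/andP: abar_itv; move: abar (a i) => x y *; apply/andP; split; lra.
have d0 := sqr_ge0 (a i - abar).
have h1 : alpha * (a i - abar) ^+ 2 <= rbar * (a i - abar) ^+ 2 by rewrite ler_wpM2r.
have h2 := ler_wpM2r (normr_ge0 (rs i - rbar)) d2.
have h3 := ler_wpM2r d0 (ler_norm (rbar - rs i)).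
rewrite distrC in h3; move: h1 h2 h3.
move: ((a i - abar) ^+ 2) (`|rs i - rbar|) (rs i) rbar (C ^+ 2) => d n x y c; lra.
Qed.

Lemma lf_cst (c : R) i : lf (fun=> c) i = c ^+ 2 * rs i.
Proof.
rewrite mulr_sumr; apply: eq_bigr => j _; rewrite mulr_sumr.
by apply: eq_bigr => k _; ring.
Qed.

Lemma sum_sq_sub_mean (x : 'I_N -> R) (t : R) :
  \sum_i (x i - N%:R^-1 * \sum_j x j) ^+ 2 <= \sum_i (x i - t) ^+ 2.
Proof.
set m := N%:R^-1 * _.
have -> : \sum_i (x i - t) ^+ 2 =
    \sum_i (x i - m) ^+ 2 + \sum_i (2 * (m - t) * (x i - m)) + \sum_(i < N) (m - t) ^+ 2.
  by rewrite -!big_split; apply: eq_bigr => i _ /=; ring.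
have xm : \sum_i (x i - m) = 0.
  rewrite sumrB sumr_const card_ord -[m *+ N]mulr_natl.
  by rewrite /m mulrA mulfV ?mul1r ?subrr// pnatr_eq0 -lt0n.
rewrite -mulr_sumr xm mulr0 addr0 lerDl; apply: sumr_ge0 => i _; exact: sqr_ge0.
Qed.

(** The fields are compared with the constant [abar ^+ 2 * rbar] in three stages: from [y] to [u],
    from [u] to the constant [abar], and from [rs i] to [rbar]. Squaring a sum of three terms gives
    the factor [3]. In the middle stage one factor of the square is bounded uniformly and the other
    by [lf_lip], whence [12 = 3 * 2 * 2]. *)
Lemma local_field_variance_le (y : 'I_N -> R) (e e' : R) : 0 < e -> 0 < e' ->
  \sum_i (lf y i - N%:R^-1 * \sum_j lf y j) ^+ 2 <=
  3 * (\sum_i (lf y i - lf u i) ^+ 2)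
  + 12 * C ^+ 3 * gamma ^+ 2 * (negative_mass + (e' * N%:R + e'^-1 * (alpha^-1 *
    ((2 * delta)^-1 * (e ^+ 2 * (gamma * N%:R) + e^-1 * cubic_variation)
     + C ^+ 2 * irregularity))))
  + 3 * C ^+ 4 * \sum_i (rs i - rbar) ^+ 2.
Proof.
move=> e0 e'0; apply: le_trans (sum_sq_sub_mean (lf y) (abar ^+ 2 * rbar)) _.
have /andP[ab0 abC] := abar_itv.
apply: (@le_trans _ _ (\sum_i (3 * (lf y i - lf u i) ^+ 2
   + 3 * (lf u i - lf (fun=> abar) i) ^+ 2 + 3 * C ^+ 4 * (rs i - rbar) ^+ 2))).
  apply: ler_sum => i _; rewrite lf_cst.
  have ab4 : abar ^+ 4 <= C ^+ 4 by apply: lerXn2r; rewrite ?nnegrE.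
  have := ler_wpM2r (sqr_ge0 (rs i - rbar)) ab4.
  set p := lf y i; set q := lf u i; set r := rs i; set b := rbar; set c := abar.
  have -> : p - c ^+ 2 * b = (p - q) + (q - c ^+ 2 * r) + c ^+ 2 * (r - b) by ring.
  have -> : c ^+ 4 * (r - b) ^+ 2 = (c ^+ 2 * (r - b)) ^+ 2 by ring.
  have -> : 3 * C ^+ 4 * (r - b) ^+ 2 = 3 * (C ^+ 4 * (r - b) ^+ 2) by ring.
  move: (p - q) (q - c ^+ 2 * r) (c ^+ 2 * (r - b)) (C ^+ 4 * (r - b) ^+ 2) => s t v w H.
  have := sqr_ge0 (s - t); have := sqr_ge0 (s - v); have := sqr_ge0 (t - v); lra.
rewrite !big_split/= -!mulr_sumr lerD2r lerD2l.
set W := negative_mass + _.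
have devW : \sum_j `|u j - abar| <= W.
  apply: le_trans (lerD (lexx negative_mass) (abs_deviation_le e0 e'0)).
  rewrite -big_split; apply: ler_sum => j _ /=.
  rewrite (_ : u j - abar = (u j - a j) + (a j - abar)); last by ring.
  rewrite (le_trans (ler_normD _ _))// lerD2r distrC ger0_norm//.
  by rewrite subr_ge0 ler_norm.
have cC (j : 'I_N) : `|(fun=> abar : R) j| <= C by rewrite ger0_norm.
have T : \sum_i (lf u i - lf (fun=> abar) i) ^+ 2 <=
    2 * (C ^+ 2 * gamma) * (2 * C * (gamma * \sum_j `|u j - abar|)).
  apply: (@le_trans _ _ (\sum_i 2 * (C ^+ 2 * gamma) * (2 * C * \sum_j pr i j * `|u j - abar|))).
    apply: ler_sum => i _; rewrite -real_normK ?num_real// expr2.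
    apply: ler_pM => //; last exact: (lf_lip A_int i u_le cC).
    rewrite (le_trans (ler_normB _ _))//.
    have := lf_norm_gamma A_int rows_le i u_le.
    by have := lf_norm_gamma A_int rows_le i cC; clear cC; lra.
  rewrite -!mulr_sumr exchange_big/=.
  rewrite ler_wpM2l ?mulr_ge0 ?sqr_ge0// ler_wpM2l ?mulr_ge0//.
  rewrite mulr_sumr; apply: ler_sum => j _; rewrite -mulr_suml ler_wpM2r//.
  by rewrite (sum_pr_l A_int).
have K0 : 0 <= C ^+ 3 * gamma ^+ 2 by rewrite mulr_ge0 ?sqr_ge0 ?exprn_ge0.
move: T (ler_wpM2l K0 devW); clear devW cC.
move: (\sum_i (lf u i - lf (fun=> abar) i) ^+ 2) W (\sum_j `|u j - abar|).
by move=> x w z; lra.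
Qed.

End optimizer.

End near_optimizers.

(** * Random colorings *)

Section random_colorings.
Context (R : realType) (N K : nat).

Notation coloring := {ffun 'I_N -> 'I_K.+1}.
Notation q := (K.+1%:R : R).

Definition avg (F : coloring -> R) : R := \sum_a q^-1 ^+ N * F a.

(** Under [avg] each site belongs to the class of [ord0] with probability [1 / K.+1], independently
    of the other sites. *)
Definition sampled (a : coloring) (j : 'I_N) : R := (a j == ord0)%:R.

Let q_gt0 : 0 < q. Proof. by rewrite ltr0n. Qed.
Let q_neq0 : q != 0. Proof. by rewrite gt_eqF. Qed.

Lemma avg_prod (G : 'I_N -> 'I_K.+1 -> R) :
  avg (fun a => \prod_i G i (a i)) = \prod_i (q^-1 * \sum_c G i c).
Proof.
under [RHS]eq_bigr do rewrite mulr_sumr.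
rewrite bigA_distr_bigA; apply: eq_bigr => a _.
by rewrite big_split/= prodr_const card_ord.
Qed.

Lemma avg_const_factor : q^-1 * \sum_(c : 'I_K.+1) 1 = 1.
Proof. by rewrite sumr_const card_ord mulVf. Qed.

Lemma avg_le (F G : coloring -> R) : (forall a, F a <= G a) -> avg F <= avg G.
Proof.
move=> FG; apply: ler_sum => a _.
by rewrite ler_wpM2l// exprn_ge0// invr_ge0.
Qed.

Lemma avgD (F G : coloring -> R) : avg (fun a => F a + G a) = avg F + avg G.
Proof. by rewrite -big_split; apply: eq_bigr => a _ /=; rewrite mulrDr. Qed.

Lemma avgZ c (F : coloring -> R) : avg (fun a => c * F a) = c * avg F.
Proof. by rewrite mulr_sumr; apply: eq_bigr => a _; rewrite mulrCA. Qed.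

Lemma avg_sum (I : Type) (r : seq I) (F : I -> coloring -> R) :
  avg (fun a => \sum_(i <- r) F i a) = \sum_(i <- r) avg (F i).
Proof. by rewrite exchange_big; apply: eq_bigr => a _; rewrite mulr_sumr. Qed.

Lemma avg_cst c : avg (fun=> c) = c.
Proof.
transitivity (c * avg (fun=> 1)).
  by rewrite -avgZ; apply: eq_bigr => a _; rewrite mulr1.
rewrite [X in c * X](_ : _ = 1) ?mulr1//.
transitivity (avg (fun a => \prod_(i < N) (fun _ _ => 1) i (a i))).
  by apply: eq_bigr => a _; rewrite big1.
by rewrite (avg_prod (fun _ _ => 1)) big1// => i _; exact: avg_const_factor.
Qed.

Lemma avg1 (phi : 'I_K.+1 -> R) j : avg (fun a => phi (a j)) = q^-1 * \sum_c phi c.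
Proof.
pose G i c := if i == j then phi c else 1.
transitivity (avg (fun a => \prod_i G i (a i))).
  apply: eq_bigr => a _; rewrite (bigD1 j)//= big1 ?mulr1 /G ?eqxx// => i.
  by move/negbTE ->.
rewrite avg_prod (bigD1 j)//= [X in _ * X]big1 ?mulr1 /G ?eqxx// => i /negbTE ->.
exact: avg_const_factor.
Qed.

Lemma avg2 (phi psi : 'I_K.+1 -> R) j l : j != l ->
  avg (fun a => phi (a j) * psi (a l)) =
  (q^-1 * \sum_c phi c) * (q^-1 * \sum_c psi c).
Proof.
move=> jl; have lj : l != j by rewrite eq_sym.
pose G i c := if i == j then phi c else if i == l then psi c else 1.
transitivity (avg (fun a => \prod_i G i (a i))).
  apply: eq_bigr => a _; rewrite (bigD1 j)//= (bigD1 l)//= big1 /G.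
    by rewrite eqxx (negbTE lj) eqxx mulr1.
  by move=> i /andP[/negbTE -> /negbTE ->].
rewrite avg_prod (bigD1 j)//= (bigD1 l)//= [X in _ * (_ * X)]big1 /G.
  by rewrite ?eqxx ?(negbTE lj) ?eqxx mulr1.
by move=> i /andP[/negbTE -> /negbTE ->]; exact: avg_const_factor.
Qed.

Let sum_delta0 : \sum_(c : 'I_K.+1) (c == ord0)%:R = 1 :> R.
Proof.
by rewrite (bigD1 ord0)//= big1 ?addr0// => c /negbTE ->.
Qed.

Let dev (c : 'I_K.+1) : R := q * (c == ord0)%:R - 1.

Let dev_mean : q^-1 * \sum_c dev c = 0.
Proof.
by rewrite sumrB -mulr_sumr sum_delta0 mulr1 mulrBr avg_const_factor mulVf ?subrr.
Qed.

Let dev_sq : q^-1 * \sum_c dev c ^+ 2 <= q.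
Proof.
have -> : \sum_c dev c ^+ 2 = \sum_(c : 'I_K.+1) ((q ^+ 2 - 2 * q) * (c == ord0)%:R + 1).
  apply: eq_bigr => c _; rewrite /dev.
  by case: (c == ord0); rewrite /= ?mulr1 ?mulr0; ring.
rewrite big_split/= -mulr_sumr sum_delta0 mulrDr avg_const_factor mulr1.
have -> : q^-1 * (q ^+ 2 - 2 * q) = q - 2 by field.
lra.
Qed.

(* Pairwise independence kills the off-diagonal terms of the square. *)
Lemma sampling_variance (t : 'I_N -> R) :
  avg (fun a => (\sum_j (q * sampled a j) * t j - \sum_j t j) ^+ 2)
    <= q * \sum_j t j ^+ 2.
Proof.
have -> : avg (fun a => (\sum_j (q * sampled a j) * t j - \sum_j t j) ^+ 2) =
    \sum_j \sum_l (t j * t l) * avg (fun a => dev (a j) * dev (a l)).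
  transitivity (avg (fun a => \sum_j \sum_l (t j * t l) * (dev (a j) * dev (a l)))).
    apply: eq_bigr => a _; congr (_ * _); rewrite -sumrB expr2 mulr_suml.
    apply: eq_bigr => j _; rewrite mulr_sumr; apply: eq_bigr => l _.
    by rewrite /dev /sampled; ring.
  rewrite avg_sum; apply: eq_bigr => j _; rewrite avg_sum.
  by apply: eq_bigr => l _; rewrite avgZ.
rewrite mulr_sumr; apply: ler_sum => j _.
rewrite (bigD1 j)//= big1 ?addr0 => [|l lj]; last first.
  by rewrite avg2 1?eq_sym// dev_mean mul0r mulr0.
rewrite -expr2 mulrC ler_wpM2r ?sqr_ge0//.
rewrite (_ : avg _ = q^-1 * \sum_c dev c ^+ 2)//.
by rewrite -(avg1 (fun c => dev c ^+ 2) j).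
Qed.

Lemma avg_sampled : avg (fun a => \sum_j sampled a j) = q^-1 * N%:R.
Proof.
rewrite avg_sum (eq_bigr (fun=> q^-1)) ?sumr_const ?card_ord ?mulr_natr// => j _.
by rewrite (avg1 (fun c => (c == ord0)%:R)) sum_delta0 mulr1.
Qed.

(** * Estimating the local fields from sampled spins *)

Section sampled_field.
Context (A : 'I_N -> 'I_N -> 'I_N -> R).
Hypothesis A_int : interaction_tensor A.
Notation lf := (lf A).
Notation pr := (pr A).
Implicit Types (a b : coloring) (y : 'I_N -> R).

(** An unbiased estimator of [lf]: the factors [q] compensate the sampling probability. One
    independent colouring per summation index keeps it linear in each of them, so
    [sampling_variance] applies twice, with [half_lf] in between. *)
Definition sampled_lf a b y i : R :=
  \sum_j \sum_k A i j k * (q * sampled a j * y j) * (q * sampled b k * y k).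

Let half_lf a y i : R := \sum_j \sum_k A i j k * (q * sampled a j * y j) * y k.

Lemma sampled_norm a j : `|q * sampled a j| <= q.
Proof.
rewrite /sampled; case: (_ == _); first by rewrite mulr1 gtr0_norm.
by rewrite mulr0 normr0 ltW.
Qed.

Let half_lf_avg (C : R) y : (forall i, `|y i| <= C) ->
  avg (fun a => \sum_i (half_lf a y i - lf y i) ^+ 2) <= q * (C ^+ 4 * sq_sum A).
Proof.
move=> yC; rewrite avg_sum !mulr_sumr; apply: ler_sum => i _.
pose t j := \sum_k A i j k * y j * y k.
have tE a : half_lf a y i - lf y i = \sum_j (q * sampled a j) * t j - \sum_j t j.
  congr (_ - _); apply: eq_bigr => j _; rewrite /t mulr_sumr.
  by apply: eq_bigr => k _; ring.
rewrite (_ : avg _ = avg (fun a => (\sum_j (q * sampled a j) * t j - \sum_j t j) ^+ 2)); last first.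
  by apply: eq_bigr => a _; rewrite tE.
apply: le_trans (sampling_variance t) _; rewrite ler_wpM2l ?(ltW q_gt0)//.
rewrite mulr_sumr; apply: ler_sum => j _.
have C0 : 0 <= C := le_trans (normr_ge0 _) (yC j).
have tj : `|t j| <= C ^+ 2 * pr i j.
  rewrite (le_trans (ler_norm_sum _ _ _))// mulr_sumr; apply: ler_sum => k _.
  rewrite !normrM ger0_norm ?(tensor_ge0 A_int)// -mulrA [leRHS]mulrC.
  by rewrite ler_wpM2l ?(tensor_ge0 A_int)// expr2 ler_pM.
rewrite -real_normK ?num_real// (_ : _ * _ = (C ^+ 2 * pr i j) ^+ 2); last by ring.
by rewrite ler_sqr// nnegrE mulr_ge0 ?sqr_ge0// pr_ge0.
Qed.

Let sampled_lf_avg (C : R) a y : (forall i, `|y i| <= C) ->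
  avg (fun b => \sum_i (sampled_lf a b y i - half_lf a y i) ^+ 2)
    <= q ^+ 3 * (C ^+ 4 * sq_sum A).
Proof.
move=> yC; rewrite avg_sum !mulr_sumr; apply: ler_sum => i _.
pose t k := \sum_j A i j k * (q * sampled a j * y j) * y k.
have tE b : sampled_lf a b y i - half_lf a y i =
    \sum_k (q * sampled b k) * t k - \sum_k t k.
  rewrite /sampled_lf /half_lf exchange_big [X in _ - X]exchange_big.
  congr (_ - _); apply: eq_bigr => k _; rewrite /t mulr_sumr.
  by apply: eq_bigr => j _; ring.
rewrite (_ : avg _ = avg (fun b => (\sum_k (q * sampled b k) * t k - \sum_k t k) ^+ 2)); last first.
  by apply: eq_bigr => b _; rewrite tE.
apply: le_trans (sampling_variance t) _.
rewrite exprS -mulrA ler_wpM2l ?(ltW q_gt0)// !mulr_sumr.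
apply: ler_sum => k _.
have C0 : 0 <= C := le_trans (normr_ge0 _) (yC k).
have tk : `|t k| <= q * (C ^+ 2 * pr i k).
  have -> : pr i k = \sum_j A i j k by apply: eq_bigr => j _; rewrite (tensor_sym23 A_int).
  rewrite (le_trans (ler_norm_sum _ _ _))// !mulr_sumr; apply: ler_sum => j _.
  rewrite normrM normrM (ger0_norm (tensor_ge0 A_int i j k)).
  rewrite [leRHS](_ : _ = A i j k * ((q * C) * C)); last by ring.
  rewrite -mulrA ler_wpM2l ?(tensor_ge0 A_int)//; apply: ler_pM => //.
  by rewrite normrM; apply: ler_pM => //; exact: sampled_norm.
rewrite -real_normK ?num_real// (_ : _ * _ = (q * (C ^+ 2 * pr i k)) ^+ 2); last by ring.
by rewrite ler_sqr// nnegrE mulr_ge0 ?(ltW q_gt0)// mulr_ge0 ?sqr_ge0// pr_ge0.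
Qed.

Definition sample_size a b : R := \sum_j sampled a j + \sum_j sampled b j.

Definition sampling_error a b y : R := \sum_i (sampled_lf a b y i - lf y i) ^+ 2.

Definition good_sample (t : R) a b y : bool :=
  (sample_size a b <= 8 * (q^-1 * N%:R)) && (sampling_error a b y <= t * N%:R).

(** Markov's inequality twice: the mean sample size is [2 * N / q] against the threshold
    [8 * N / q], and the mean error is at most [4 * S] against [t * N >= 16 * S]. Each failure has
    probability at most [1 / 4]. *)
Lemma avg_good_sample (C t : R) y : (0 < N)%N -> 0 < t ->
  (forall i, `|y i| <= C) ->
  16 * (q ^+ 3 * (C ^+ 4 * sq_sum A)) <= t * N%:R ->
  1 <= 2 * avg (fun a => avg (fun b => (good_sample t a b y)%:R)).
Proof.
move=> N0 t0 yC small.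
have N0' : 0 < N%:R :> R by rewrite ltr0n.
have tN : 0 < t * N%:R by rewrite mulr_gt0.
have qN : 0 < q^-1 * N%:R by rewrite mulr_gt0 ?invr_gt0.
set S := q ^+ 3 * (C ^+ 4 * sq_sum A) in small *.
have s0 : 0 <= C ^+ 4 * sq_sum A.
  rewrite mulr_ge0 ?exprn_even_ge0//.
  by apply: sumr_ge0 => i _; apply: sumr_ge0 => j _; exact: sqr_ge0.
have q1 : q * (C ^+ 4 * sq_sum A) <= S.
  rewrite /S ler_wpM2r// exprS -[leLHS]mulr1 ler_wpM2l ?(ltW q_gt0)//.
  by rewrite exprn_ege1// ler1n.
have err : avg (fun a => avg (fun b => sampling_error a b y)) <= 4 * S.
  apply: (@le_trans _ _ (avg (fun a => 2 * S + 2 * \sum_i (half_lf a y i - lf y i) ^+ 2))).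
    apply: avg_le => a.
    apply: (@le_trans _ _ (avg (fun b => 2 * (\sum_i (sampled_lf a b y i - half_lf a y i) ^+ 2)
       + 2 * \sum_i (half_lf a y i - lf y i) ^+ 2))).
      apply: avg_le => b; rewrite !mulr_sumr -big_split; apply: ler_sum => i _ /=.
      move: (sampled_lf a b y i) (half_lf a y i) (lf y i) => u v w.
      have := sqr_ge0 ((u - v) - (v - w)); lra.
    by rewrite avgD avgZ avg_cst lerD2r ler_pM2l//; exact: sampled_lf_avg.
  rewrite avgD !avgZ avg_cst (_ : 4 * S = 2 * S + 2 * S); last by ring.
  by rewrite lerD2l ler_pM2l//; exact: le_trans (half_lf_avg yC) q1.
have size : avg (fun a => avg (fun b => sample_size a b)) = 2 * (q^-1 * N%:R).
  transitivity (avg (fun a => \sum_j sampled a j + q^-1 * N%:R)).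
    by apply: eq_bigr => a _; rewrite avgD avg_cst avg_sampled.
  by rewrite avgD avg_cst avg_sampled; ring.
have bad a b : 1 <= (good_sample t a b y)%:R
    + ((8 * (q^-1 * N%:R))^-1 * sample_size a b + (t * N%:R)^-1 * sampling_error a b y).
  have z0 : 0 <= sample_size a b.
    by rewrite addr_ge0//; apply: sumr_ge0 => j _; rewrite ler0n.
  have e0 : 0 <= sampling_error a b y by apply: sumr_ge0 => i _; exact: sqr_ge0.
  have z1 : 0 <= (8 * (q^-1 * N%:R))^-1 * sample_size a b.
    by rewrite mulr_ge0// invr_ge0 mulr_ge0// ltW.
  have e1 : 0 <= (t * N%:R)^-1 * sampling_error a b y.
    by rewrite mulr_ge0// invr_ge0 ltW.
  rewrite /good_sample; have [zl|zl] := leP (sample_size a b) _; last first.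
    rewrite add0r -[leLHS]addr0 lerD// ler_pdivlMl ?mulr_gt0// mulr1; exact: ltW.
  have [el|el] := leP (sampling_error a b y) _; first by rewrite lerDl addr_ge0.
  by rewrite add0r -[leLHS]add0r lerD// ler_pdivlMl// mulr1; exact: ltW.
have : 1 <= avg (fun a => avg (fun b => (good_sample t a b y)%:R
    + ((8 * (q^-1 * N%:R))^-1 * sample_size a b + (t * N%:R)^-1 * sampling_error a b y))).
  rewrite -[leLHS]avg_cst; apply: avg_le => a.
  by rewrite -[leLHS]avg_cst; apply: avg_le => b; exact: bad.
have -> : avg (fun a => avg (fun b => (good_sample t a b y)%:R
    + ((8 * (q^-1 * N%:R))^-1 * sample_size a b + (t * N%:R)^-1 * sampling_error a b y)))
  = avg (fun a => avg (fun b => (good_sample t a b y)%:R))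
    + ((8 * (q^-1 * N%:R))^-1 * avg (fun a => avg (fun b => sample_size a b))
     + (t * N%:R)^-1 * avg (fun a => avg (fun b => sampling_error a b y))).
  rewrite -!avgZ -!avgD; apply: eq_bigr => a _; congr (_ * _).
  by rewrite -!avgZ -!avgD; apply: eq_bigr => b _.
rewrite size.
have -> : (8 * (q^-1 * N%:R))^-1 * (2 * (q^-1 * N%:R)) = 4^-1.
  by field; rewrite !gt_eqF.
have : (t * N%:R)^-1 * avg (fun a => avg (fun b => sampling_error a b y)) <= 4^-1.
  by rewrite ler_pdivrMl//; move: err small; move: (avg _) => e; lra.
by move: (avg _) ((t * N%:R)^-1 * _) => g e; lra.
Qed.

End sampled_field.
End random_colorings.

(** * Upper bound for the weight of a bad event *)

Section cells.
Context (R : realType) (km kp : R) (mu : probability (measurableTypeR R) R).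
Hypothesis km_le_kp : km <= kp.
Context (C : R).
Hypotheses (km_geC : - C <= km) (kp_leC : kp <= C).
Context (N : nat) (A : 'I_N -> 'I_N -> 'I_N -> R).
Hypothesis A_int : interaction_tensor A.
Context (beta h gamma : R).
Hypotheses (beta_ge0 : 0 <= beta) (gamma_ge0 : 0 <= gamma).
Hypothesis rows_le : forall i, row_sum A i <= gamma.
Hypothesis N_gt0 : (0 < N)%N.

Notation Ex := (Ex km kp mu).
Notation bm := (bm km kp).
Notation in_cube := (in_cube km kp).
Notation cumulant := (cumulant km kp mu).
Notation lf := (lf A).
Notation weight := (weight A beta h).
Notation Zc := (Zc km kp mu A beta h).
Notation field := (field A beta h).
Notation cond_mean := (cond_mean km kp mu A beta h).
Notation dev_sum := (dev_sum km kp mu A beta h).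
Notation field_dev := (field_dev km kp mu A beta h).
Notation tilt_density := (tilt_density km kp mu).
Notation bound := (field_bound C beta h gamma).
Implicit Types (y : 'I_N -> R) (i j l : 'I_N) (e t : R).

Let C0 : 0 <= C := C_ge0 km_le_kp km_geC kp_leC.
Let N0 : 0 < N%:R :> R. Proof. by rewrite ltr0n. Qed.

(** The rate function at [cond_mean y i]: the parameter [field y i] attains the Legendre supremum
    there. *)
Definition conj_rate y i : R := field y i * cond_mean y i - cumulant (field y i).

Definition local_functional y : R :=
  gibbs_functional A beta h (cond_mean y) (conj_rate y).

(** For parameters [th] independent of [y], the log-density of the product of tilted laws. *)
Definition linearized (th : 'I_N -> R) y : R :=
  \sum_i (th i * y i - cumulant (th i)).

Let sum_abs_le (x : 'I_N -> R) e : 0 < e -> \sum_i x i ^+ 2 <= e ^+ 2 * N%:R ->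
  \sum_i `|x i| <= 2 * e * N%:R.
Proof.
move=> e0 xe; have := sum_cutoff x e0; rewrite card_ord => /le_trans; apply.
have : e^-1 * \sum_i x i ^+ 2 <= e * N%:R.
  by rewrite ler_pdivrMl// mulrA -expr2.
by move: (_^-1 * _) => z; lra.
Qed.

(** Write [u = cond_mean y]. The cumulants and the terms in [h] cancel. Apart from the error term,
    right minus left is exactly [2 * beta / 3 * dev_sum y] minus [beta / 3] times the sum of
    [u i * (lf y i - lf u i)]. *)
Lemma energy_linearized y e : in_cube y -> 0 < e ->
  `|dev_sum y| <= e ^+ 2 * N%:R -> field_dev y <= e ^+ 2 * N%:R ->
  energy A beta h y <= linearized (field y) y + local_functional y
    + (2 * beta / 3 * e ^+ 2 + 2 * beta / 3 * C * e) * N%:R.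
Proof.
move=> cy e0 dy fy.
have uC i : `|cond_mean y i| <= C.
  apply: (cube_norm km_geC kp_leC).
  exact: (cond_mean_cube mu km_le_kp km_geC kp_leC).
have H1 : \sum_i `|lf y i - lf (cond_mean y) i| <= 2 * e * N%:R by exact: sum_abs_le.
have H2 : `|\sum_i cond_mean y i * (lf y i - lf (cond_mean y) i)| <= C * (2 * e * N%:R).
  apply: le_trans (ler_wpM2l C0 H1).
  rewrite (le_trans (ler_norm_sum _ _ _))// mulr_sumr; apply: ler_sum => i _.
  by rewrite normrM ler_wpM2r.
have b3 : 0 <= beta / 3 by rewrite divr_ge0.
rewrite -subr_ge0.
have -> : linearized (field y) y + local_functional y
    + (2 * beta / 3 * e ^+ 2 + 2 * beta / 3 * C * e) * N%:R - energy A beta h y =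
  beta / 3 * (C * (2 * e * N%:R) - \sum_i cond_mean y i * (lf y i - lf (cond_mean y) i))
  + 2 * (beta / 3) * (e ^+ 2 * N%:R + dev_sum y).
  rewrite /linearized /local_functional /gibbs_functional /energy /conj_rate.
  rewrite !tri_lf /dev_sum.
  have -> : \sum_i (field y i * y i - cumulant (field y i)) =
      beta * (\sum_i y i * lf y i) + h * (\sum_i y i) - \sum_i cumulant (field y i).
    rewrite sumrB; congr (_ - _); rewrite !mulr_sumr -big_split.
    by apply: eq_bigr => i _ /=; rewrite /field; ring.
  have -> : \sum_i (field y i * cond_mean y i - cumulant (field y i)) =
      beta * (\sum_i cond_mean y i * lf y i) + h * (\sum_i cond_mean y i)
      - \sum_i cumulant (field y i).
    rewrite sumrB; congr (_ - _); rewrite !mulr_sumr -big_split.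
    by apply: eq_bigr => i _ /=; rewrite /field; move: (cond_mean y i) => u; ring.
  have -> : \sum_i cond_mean y i * (lf y i - lf (cond_mean y) i) =
      \sum_i cond_mean y i * lf y i - \sum_i cond_mean y i * lf (cond_mean y) i.
    by rewrite -sumrB; apply: eq_bigr => i _; rewrite mulrBr.
  have -> : \sum_i (y i - cond_mean y i) * lf y i =
      \sum_i y i * lf y i - \sum_i cond_mean y i * lf y i.
    by rewrite -sumrB; apply: eq_bigr => i _; rewrite mulrBl.
  move: (\sum_i y i * lf y i) (\sum_i cond_mean y i * lf y i)
    (\sum_i cond_mean y i * lf (cond_mean y) i) (\sum_i y i)
    (\sum_i cond_mean y i) (\sum_i cumulant _) => s1 s2 s3 s4 s5 s6.
  by field.
rewrite addr_ge0//; first by rewrite mulr_ge0// subr_ge0 (le_trans (ler_norm _)).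
rewrite mulr_ge0//; first by rewrite mulr_ge0.
by rewrite -(opprK (dev_sum y)) subr_ge0 (le_trans (ler_norm _))// normrN.
Qed.

Lemma linearized_lip (th th' : 'I_N -> R) y : in_cube y ->
  linearized th y <= linearized th' y + 2 * C * \sum_i `|th i - th' i|.
Proof.
move=> cy; rewrite /linearized mulr_sumr -big_split; apply: ler_sum => i _ /=.
have h1 : (th i - th' i) * y i <= C * `|th i - th' i|.
  rewrite (le_trans (ler_norm _))// normrM mulrC ler_wpM2r//.
  exact: (cube_norm km_geC kp_leC).
have := le_trans (ler_norm _)
  (cumulant_lip mu km_le_kp km_geC kp_leC (th' i) (th i)).
rewrite (distrC (th' i)); move: h1.
by move: (cumulant (th i)) (cumulant (th' i)) `|th i - th' i| => x x' n; lra.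
Qed.

(** * Tilted laws with the sampled spins pinned *)

Section pinned.
Context (K : nat).
Notation coloring := {ffun 'I_N -> 'I_K.+1}.
Notation q := (K.+1%:R : R).
Implicit Types (a b : coloring).

(** The estimator may be far larger than the field itself. Clipping it to the a priori range of [lf]
    keeps the tilts bounded and, as [lf] lies in that range, does not increase the error. *)
Definition pinned_field a b y i : R :=
  beta * clip (- (C ^+ 2 * gamma)) (C ^+ 2 * gamma) (sampled_lf A a b y i) + h.

Definition free_site a b i : bool := (a i != ord0) && (b i != ord0).

Definition pinned_density a b y : R :=
  \prod_(i <- [seq i <- index_enum 'I_N | free_site a b i])
     tilt_density (pinned_field a b y i) (y i).

Let B0 : 0 <= C ^+ 2 * gamma. Proof. by rewrite mulr_ge0 ?sqr_ge0. Qed.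

Lemma bm_pinned_field a b i : bm (fun y => pinned_field a b y i).
Proof.
apply: bmD; last exact: bm_cst.
apply: bmM; first exact: bm_cst.
apply: (bm_comp (phi := clip (- (C ^+ 2 * gamma)) (C ^+ 2 * gamma))).
  exact: continuous_clip.
do 2 (apply: (bm_sum km_le_kp) => ?).
apply: bmM; last by apply: bmM; [exact: bm_cst|exact: bm_coord].
apply: bmM; first exact: bm_cst.
by apply: bmM; [exact: bm_cst|exact: bm_coord].
Qed.

Lemma bm_pinned_density a b : bm (pinned_density a b).
Proof.
apply: (bm_prod km_le_kp) => i.
apply: (bm_tilt_density mu km_le_kp km_geC kp_leC (th := fun y => pinned_field a b y i)).
exact: bm_pinned_field.
Qed.

Lemma pinned_field_upd a b y j z i : free_site a b j ->
  pinned_field a b (upd y j z) i = pinned_field a b y i.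
Proof.
case/andP => /negbTE aj /negbTE bj.
congr (_ * clip _ _ _ + _); apply: eq_bigr => k _; apply: eq_bigr => l _.
have E (c : coloring) m : (c j == ord0) = false ->
    q * sampled R c m * upd y j z m = q * sampled R c m * y m.
  move=> cj; have [->|mj] := eqVneq m j; last by rewrite -upd_neq.
  by rewrite /sampled cj mulr0 !mul0r.
by rewrite !E.
Qed.

Lemma Ex_pinned_density a b : Ex (pinned_density a b) = 1.
Proof.
apply: (Ex_tilt_prod mu km_le_kp km_geC kp_leC
  (th := fun i y => pinned_field a b y i)).
- by rewrite filter_uniq// index_enum_uniq.
- by move=> i; exact: bm_pinned_field.
- by move=> i j y z _; rewrite mem_filter => /andP[fj _]; exact: pinned_field_upd.
Qed.

Lemma pinned_field_norm a b y i : `|pinned_field a b y i| <= bound.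
Proof.
rewrite /pinned_field /field_bound (le_trans (ler_normD _ _))// lerD2r.
rewrite normrM ger0_norm// ler_wpM2l// ler_norml.
by apply: clip_itv; rewrite -subr_ge0 opprK addr_ge0.
Qed.

Lemma field_sub_pinned a b y e : in_cube y -> 0 < e ->
  sampling_error A a b y <= e ^+ 2 * N%:R ->
  \sum_i `|field y i - pinned_field a b y i| <= beta * (2 * e * N%:R).
Proof.
move=> cy e0 se; apply: le_trans (ler_wpM2l beta_ge0 (sum_abs_le e0 se)).
rewrite mulr_sumr; apply: ler_sum => i _.
rewrite (_ : field y i - _ = beta * (lf y i -
   clip (- (C ^+ 2 * gamma)) (C ^+ 2 * gamma) (sampled_lf A a b y i))); last first.
  by rewrite /field /pinned_field; ring.
rewrite normrM ger0_norm// ler_wpM2l// distrC.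
apply: clip_dist; rewrite -ler_norml; apply: (lf_norm_gamma A_int rows_le) => k.
exact: (cube_norm km_geC kp_leC).
Qed.

(** Each sampled site costs at most [2 * C * bound], half from the linear term and half from the
    cumulant, and there are at most [sample_size] of them. *)
Lemma linearized_pinned a b y : in_cube y ->
  expR (linearized (pinned_field a b y) y) <=
  expR (2 * C * bound * sample_size R a b) * pinned_density a b y.
Proof.
move=> cy; have b0 : 0 <= bound.
  by rewrite /field_bound addr_ge0// mulr_ge0.
have -> : pinned_density a b y =
    expR (\sum_(i | free_site a b i)
      (pinned_field a b y i * y i - cumulant (pinned_field a b y i))).
  rewrite /pinned_density big_filter expR_sum; apply: eq_bigr => i _.
  exact: tilt_density_exp.
rewrite -expRD ler_expR /linearized (bigID (free_site a b))/= addrC lerD2r.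
apply: (@le_trans _ _ (\sum_(i | ~~ free_site a b i) 2 * C * bound)).
  apply: ler_sum => i _.
  have h1 := cumulant_norm mu km_le_kp km_geC kp_leC (pinned_field a b y i).
  have h2 := pinned_field_norm a b y i.
  have h3 : pinned_field a b y i * y i <= bound * C.
    rewrite (le_trans (ler_norm _))// normrM ler_pM//.
    exact: (cube_norm km_geC kp_leC).
  have h4 := ler_wpM2l C0 h2.
  move: h1; rewrite ler_norml => /andP[h1 _]; move: h1 h3 h4.
  by move: (cumulant _) (pinned_field a b y i * _) (`|_|) (bound) => x z n d; lra.
rewrite big_mkcond /sample_size -big_split mulr_sumr; apply: ler_sum => i _ /=.
rewrite /free_site /sampled negb_and !negbK.
have c0 : 0 <= 2 * C * bound by rewrite !mulr_ge0.
by move: (2 * C * bound) c0 => d d0; case: (a i == _); case: (b i == _) => /=; lra.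
Qed.

(** * Weight of an event with a low functional *)

Section bad_event.
Context (X : ('I_N -> R) -> bool) (c e : R).
Hypothesis e_gt0 : 0 < e.
Hypothesis bm_X : bm (fun y => (X y)%:R).
Hypothesis X_low : forall y, in_cube y -> X y ->
  `|dev_sum y| <= e ^+ 2 * N%:R -> field_dev y <= e ^+ 2 * N%:R ->
  local_functional y <= ln Zc - c * N%:R.

(** The terms are, in order: the two errors of [energy_linearized]; the cost
    [2 * C * (2 * beta * e)] of passing to the pinned fields; the price [2 * C * bound] of each of
    at most [8 * N / q] sampled sites; and the gain [c]. *)
Definition exponent : R := 2 * beta / 3 * e ^+ 2 + 2 * beta / 3 * C * e
  + 4 * C * beta * e + 16 * C * bound / q - c.

Let Z0 : 0 < Zc := Zc_gt0 mu km_le_kp A beta h.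

Let weight_cell a b y : in_cube y -> X y ->
  `|dev_sum y| <= e ^+ 2 * N%:R -> field_dev y <= e ^+ 2 * N%:R ->
  good_sample A (e ^+ 2) a b y ->
  weight y <= Zc * expR (exponent * N%:R) * pinned_density a b y.
Proof.
move=> cy Xy dy fy /andP[sz er].
have h1 := energy_linearized cy e_gt0 dy fy.
have h2 := X_low cy Xy dy fy.
have h3 := linearized_lip (field y) (pinned_field a b y) cy.
have h4 := field_sub_pinned cy e_gt0 er.
have h5 := linearized_pinned a b cy.
have b0 : 0 <= 2 * C * bound by rewrite !mulr_ge0// addr_ge0// mulr_ge0.
have h6 := ler_wpM2l b0 sz.
have C20 : 0 <= 2 * C by rewrite mulr_ge0.
have h7 := ler_wpM2l C20 h4.
have h8 : weight y <= expR (linearized (pinned_field a b y) y)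
    * (Zc * expR ((exponent - 16 * C * bound / q) * N%:R)).
  have -> : Zc * expR ((exponent - 16 * C * bound / q) * N%:R) =
      expR (ln Zc + (exponent - 16 * C * bound / q) * N%:R).
    by rewrite expRD lnK.
  rewrite -expRD ler_expR; move: h1 h2 h3 h7; rewrite /exponent.
  move: (linearized (field y) y) (linearized (pinned_field a b y) y)
    (local_functional y) (energy _ _ _ _) (\sum_i `|_|) (bound) (ln Zc) (16 * C * _ / q).
  by move=> l1 l2 f w s d z k; lra.
apply: (le_trans h8); apply: (@le_trans _ _ (expR (2 * C * bound * (8 * (q^-1 * N%:R)))
   * pinned_density a b y * (Zc * expR ((exponent - 16 * C * bound / q) * N%:R)))).
  rewrite ler_wpM2r ?mulr_ge0 ?expR_ge0 ?(ltW Z0)//; apply: (le_trans h5).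
  rewrite ler_wpM2r ?ler_expR//; rewrite /pinned_density.
  by apply: prodr_ge0 => i _; rewrite tilt_density_exp expR_ge0.
rewrite (_ : exponent * N%:R = 2 * C * bound * (8 * (q^-1 * N%:R))
   + (exponent - 16 * C * bound / q) * N%:R); last by ring.
by rewrite expRD le_eqVlt; apply/orP; left; apply/eqP; ring.
Qed.

Definition small_sq : Prop :=
  16 * (q ^+ 3 * (C ^+ 4 * sq_sum A)) <= e ^+ 2 * N%:R.

(** Outside two Chebyshev events, the weight is at most twice its average over the good pairs of
    colourings. For each such pair it is bounded by a multiple of [pinned_density], whose integral
    is one, so averaging the bounds costs nothing. *)
Lemma bad_event_bound : small_sq ->
  Ex (fun y => weight y * (X y)%:R) <= Zc *
   (dev_const C beta h gamma / (e ^+ 4 * N%:R)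
    + field_dev_const C beta h gamma (sq_sum A) / (e ^+ 4 * N%:R)
    + 2 * expR (exponent * N%:R)).
Proof.
move=> small; have e2 : 0 < e ^+ 2 by rewrite exprn_gt0.
have e4 : e ^+ 4 = (e ^+ 2) ^+ 2 by rewrite -exprM.
have bD := bm_dev_sum mu km_le_kp km_geC kp_leC A beta h.
have bF := bm_field_dev mu km_le_kp km_geC kp_leC A beta h.
have bw : bm weight by exact: bm_weight.
have M1 := weighted_markov km_le_kp bD e2 N_gt0
  (dev_sum_second_moment mu km_le_kp km_geC kp_leC A_int h beta_ge0 gamma_ge0 rows_le).
have M2 := weighted_markov km_le_kp bF e2 N_gt0
  (field_dev_second_moment mu km_le_kp km_geC kp_leC A_int h beta_ge0 gamma_ge0 rows_le).
rewrite -e4 in M1 M2.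
pose W y := Zc * expR (exponent * N%:R) *
  (2 * avg (fun a => avg (fun b => pinned_density a b y))).
have bW : bm W.
  apply: bmM; first exact: bm_cst.
  apply: bmM; first exact: bm_cst.
  apply: (bm_sum km_le_kp) => a; apply: bmM; first exact: bm_cst.
  apply: (bm_sum km_le_kp) => b; apply: bmM; first exact: bm_cst.
  exact: bm_pinned_density.
have ExW : Ex W = 2 * (Zc * expR (exponent * N%:R)).
  rewrite ExZ//; last first.
    apply: bmM; first exact: bm_cst.
    apply: (bm_sum km_le_kp) => a; apply: bmM; first exact: bm_cst.
    apply: (bm_sum km_le_kp) => b; apply: bmM; first exact: bm_cst.
    exact: bm_pinned_density.
  rewrite ExZ//; last first.
    apply: (bm_sum km_le_kp) => a; apply: bmM; first exact: bm_cst.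
    apply: (bm_sum km_le_kp) => b; apply: bmM; first exact: bm_cst.
    exact: bm_pinned_density.
  have bb a b : bm (fun y => q^-1 ^+ N * pinned_density a b y).
    by apply: bmM; [exact: bm_cst|exact: bm_pinned_density].
  have ba a : bm (fun y => \sum_b q^-1 ^+ N * pinned_density a b y).
    by apply: (bm_sum km_le_kp) => b.
  rewrite Ex_sum//; last by move=> a; apply: bmM; [exact: bm_cst|exact: ba].
  rewrite [X in _ * (2 * X)](_ : _ = 1); first by rewrite mulr1 mulrC.
  rewrite -[RHS](avg_cst N K 1); apply: eq_bigr => a _.
  rewrite ExZ//; last exact: ba.
  congr (_ * _); rewrite -[RHS](avg_cst N K 1) Ex_sum//.
  apply: eq_bigr => b _; rewrite ExZ//; last exact: bm_pinned_density.
  by rewrite Ex_pinned_density.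
pose D1 y : R := (e ^+ 2 * N%:R < `|dev_sum y|)%R%:R.
pose D2 y : R := (e ^+ 2 * N%:R < `|field_dev y|)%R%:R.
have bD1 : bm D1 by apply: bm_lt; [exact: bm_cst|exact: bm_norm].
have bD2 : bm D2 by apply: bm_lt; [exact: bm_cst|exact: bm_norm].
have bwD1 : bm (fun y => weight y * D1 y) by exact: bmM.
have bwD2 : bm (fun y => weight y * D2 y) by exact: bmM.
apply: (@le_trans _ _ (Ex (fun y => weight y * D1 y + weight y * D2 y + W y))); last first.
  rewrite ExD//; last exact: bmD.
  rewrite ExD// ExW !mulrDr lerD//; last by rewrite mulrCA.
  exact: lerD.
apply: Ex_le => //; [exact: bmM|by apply: bmD => //; exact: bmD|].
move=> y cy.
have w0 : 0 <= weight y by exact: expR_ge0.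
have W0 : 0 <= W y.
  rewrite /W mulr_ge0 ?(mulr_ge0 (ltW Z0)) ?expR_ge0// mulr_ge0//.
  have qN : 0 <= q^-1 ^+ N by rewrite exprn_ge0// invr_ge0.
  apply: sumr_ge0 => a _; rewrite mulr_ge0//; apply: sumr_ge0 => b _.
  rewrite mulr_ge0// /pinned_density; apply: prodr_ge0 => i _.
  by rewrite tilt_density_exp expR_ge0.
have [Xy|_] := boolP (X y); last first.
  by rewrite mulr0 !addr_ge0// mulr_ge0// ler0n.
rewrite mulr1 /D1 /D2.
have [d1|d1] := ltP (e ^+ 2 * N%:R) `|dev_sum y|.
  by rewrite mulr1 -addrA lerDl addr_ge0// mulr_ge0// ler0n.
have [d2|d2] := ltP (e ^+ 2 * N%:R) `|field_dev y|.
  by rewrite mulr1 mulr0 add0r lerDl.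
rewrite !mulr0 !add0r.
have yC i : `|y i| <= C by exact: (cube_norm km_geC kp_leC).
have := ler_wpM2l w0 (avg_good_sample A_int N_gt0 e2 yC small).
rewrite mulr1 => /le_trans; apply; rewrite /W mulrCA [leRHS]mulrCA ler_wpM2l//.
rewrite -!avgZ; apply: avg_le => a; rewrite -!avgZ; apply: avg_le => b.
have fy : field_dev y <= e ^+ 2 * N%:R by exact: le_trans (ler_norm _) d2.
have [g|_] := boolP (good_sample _ _ _ _ _); first by rewrite mulr1; exact: weight_cell.
rewrite mulr0 mulr_ge0 ?(mulr_ge0 (ltW Z0)) ?expR_ge0//.
by apply: prodr_ge0 => i _; rewrite tilt_density_exp expR_ge0.
Qed.

End bad_event.
End pinned.
End cells.

(** * Gibbs measure and operator norm *)

Section almost_sure_support.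
Context d (T : measurableType d) (R : realType) (P : probability T R).

Lemma integral_eq_full (D : set T) (f g : T -> \bar R) :
  measurable D -> P D = 1%E -> measurable_fun setT f -> measurable_fun setT g ->
  (forall x, D x -> f x = g x) -> (\int[P]_x f x = \int[P]_x g x)%E.
Proof.
move=> mD PD mf mg fg; apply: ae_eq_integral => //.
exists (~` D); split; first exact: measurableC.
  by have := probability_setC P mD; rewrite PD subee.
by move=> x /= nfg Dx; apply: nfg => _; exact: fg.
Qed.

End almost_sure_support.

Section gibbs_measure.
Context (R : realType) (km kp : R) (mu : probability (measurableTypeR R) R).
Hypothesis km_le_kp : km <= kp.
Hypothesis mu_itv : mu `[km, kp]%classic = 1%E.

Notation tupR N := (N.-tuple (measurableTypeR R)).

Lemma log_mgf_cumulant t : log_mgf mu t = cumulant km kp mu t.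
Proof.
rewrite /log_mgf /cumulant /mgf /E1 /Rintegral; congr (ln (fine _)).
have ce : continuous (fun z : R => expR (t * z)).
  move=> x; apply: (@continuous_comp _ _ _ (fun z => t * z) expR).
    by apply: cvgM; [exact: cvg_cst|exact: cvg_id].
  exact: continuous_expR.
have cE := continuous_measurable_fun ce.
apply: (@integral_eq_full _ (measurableTypeR R) R mu `[km, kp]%classic).
- exact: measurable_itv.
- exact: mu_itv.
- exact/measurable_EFinP.
- apply/measurable_EFinP.
  exact: (measurableT_comp cE
    (continuous_measurable_fun (@continuous_clip R km kp))).
- by move=> z /=; rewrite in_itv/= => zk; rewrite clip_id.
Qed.

Section fixed_size.
Context (N : nat) (A : 'I_N -> 'I_N -> 'I_N -> R).

Definition cube_set : set (tupR N) := [set x | forall i, `[km, kp]%classic (tnth x i)].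

Lemma cube_set_full : power_prob mu N cube_set = 1%E.
Proof.
have mI (i : 'I_N) : @measurable _ (measurableTypeR R) `[km, kp]%classic.
  exact: measurable_itv.
apply: etrans (power_probE mu mI) _.
by rewrite big1// => i _; exact: mu_itv.
Qed.

Lemma measurable_cube_set : measurable cube_set.
Proof.
rewrite (_ : cube_set = \bigcap_(i in [set: 'I_N])
    ((fun t : tupR N => tnth t i) @^-1` `[km, kp]%classic)).
  apply: fin_bigcap_measurable; first exact: finite_finset.
  move=> i _; rewrite -[X in measurable X]setTI.
  by apply: (measurable_tnth i) => //; exact: measurable_itv.
by apply/seteqP; split => t /= ht i; [move=> _|]; exact: ht.
Qed.

Lemma cube_point_id (x : tupR N) : cube_set x -> cube_point km kp x = tnth x.
Proof.
move=> cx; apply/funext => i; rewrite /cube_point clip_id//.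
by have := cx i; rewrite /= in_itv.
Qed.

Lemma measurable_tnth_real i : measurable_fun setT (fun x : tupR N => tnth x i).
Proof. exact: measurable_tnth. Qed.

Let mD (f g : tupR N -> R) : measurable_fun setT f -> measurable_fun setT g ->
  measurable_fun setT (fun x => f x + g x).
Proof. exact: measurable_funD. Qed.

Let mM (f g : tupR N -> R) : measurable_fun setT f -> measurable_fun setT g ->
  measurable_fun setT (fun x => f x * g x).
Proof. exact: measurable_funM. Qed.

Let mB (f g : tupR N -> R) : measurable_fun setT f -> measurable_fun setT g ->
  measurable_fun setT (fun x => f x - g x).
Proof. exact: measurable_funB. Qed.

Let mc (c : R) : measurable_fun setT (fun _ : tupR N => c).
Proof. exact: measurable_cst. Qed.

Let mS (f : 'I_N -> tupR N -> R) : (forall i, measurable_fun setT (f i)) ->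
  measurable_fun setT (fun x => \sum_i f i x).
Proof. by move=> mf; exact: measurable_sum. Qed.

Lemma measurable_hamiltonian beta h :
  measurable_fun setT (fun x : tupR N => hamiltonian A beta h x).
Proof.
have mt := measurable_tnth_real.
apply: mD; apply: mM => //; last exact: mS.
do 3 (apply: mS => ?).
do 3 (apply: mM; last exact: mt); exact: mc.
Qed.

Lemma measurable_exp_hamiltonian beta h :
  measurable_fun setT (fun x : tupR N => expR (hamiltonian A beta h x)).
Proof.
exact: (measurableT_comp (continuous_measurable_fun (@continuous_expR R))
  (measurable_hamiltonian beta h)).
Qed.

Lemma measurable_local_field i :
  measurable_fun setT (fun x : tupR N => local_field A x i).
Proof.
have mt := measurable_tnth_real.
do 2 (apply: mS => ?).
do 2 (apply: mM; last exact: mt); exact: mc.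
Qed.

Lemma measurable_T_stat : measurable_fun setT (fun x : tupR N => T_stat A x).
Proof.
have mt := measurable_local_field; rewrite /T_stat /mean_local_field.
have mm : measurable_fun setT (fun x : tupR N => N%:R^-1 * \sum_j local_field A x j).
  by apply: mM; [exact: mc|exact: (mS (f := fun j x => local_field A x j))].
apply: mM; first exact: mc.
apply: (mS (f := fun i x => (local_field A x i - N%:R^-1 * \sum_j local_field A x j) ^+ 2)) => i.
under eq_fun do rewrite expr2.
by apply: mM; apply: mB.
Qed.

Definition field_variance (y : 'I_N -> R) : R :=
  N%:R^-1 * \sum_i (lf A y i - N%:R^-1 * \sum_j lf A y j) ^+ 2.

Lemma T_stat_variance (x : N.-tuple R) : T_stat A x = field_variance (tnth x).
Proof. by []. Qed.

Lemma bm_field_variance : bm km kp field_variance.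
Proof.
have bl i : bm km kp (fun y => lf A y i) by exact: bm_lf.
apply: bmM; first exact: bm_cst.
apply: (bm_sum km_le_kp) => i; apply: bmX; apply: bmB => //.
by apply: bmM; [exact: bm_cst|exact: (bm_sum km_le_kp)].
Qed.

Lemma partition_function_Zc beta h :
  partition_function A mu beta h = Zc km kp mu A beta h.
Proof.
rewrite /partition_function /Zc /Ex /Rintegral; congr fine.
have [mw _] := bm_weight km_le_kp A beta h.
apply: (@integral_eq_full _ (tupR N) R (power_prob mu N) cube_set).
- exact: measurable_cube_set.
- exact: cube_set_full.
- by apply/measurable_EFinP; exact: measurable_exp_hamiltonian.
- exact/measurable_EFinP.
- by move=> x cx; rewrite /weight (cube_point_id cx).
Qed.

Lemma gibbs_T_stat beta h (eps : R) :
  gibbs A mu beta h [set x | eps < `|T_stat A x|] =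
  (Ex km kp mu (fun y => weight A beta h y * (eps < `|field_variance y|)%R%:R)
    / Zc km kp mu A beta h)%:E.
Proof.
set Z := Zc km kp mu A beta h.
have bX : bm km kp (fun y => (eps < `|field_variance y|)%R%:R : R).
  by apply: bm_lt; [exact: bm_cst|apply: bm_norm; exact: bm_field_variance].
have bwX : bm km kp (fun y => weight A beta h y * (eps < `|field_variance y|)%R%:R).
  by apply: bmM => //; exact: bm_weight.
have mE : measurable [set x : tupR N | eps < `|T_stat A x|].
  rewrite -[X in measurable X]setTI.
  have mT : measurable_fun setT (fun x : tupR N => `|T_stat A x|).
    by apply: measurableT_comp => //; exact: measurable_T_stat.
  rewrite (_ : [set x | _] = (fun x : tupR N => `|T_stat A x|) @^-1` `]eps, +oo[).
    by apply: mT => //; exact: measurable_itv.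
  by apply/seteqP; split => x /=; rewrite in_itv/= andbT.
have bR : bm km kp (fun y => Z^-1 * (weight A beta h y * (eps < `|field_variance y|)%R%:R)).
  by apply: bmM => //; exact: bm_cst.
rewrite mulrC -ExZ// /Ex (EFin_Rexp _ bR).
rewrite /gibbs partition_function_Zc -/Z integral_mkcond.
apply: (@integral_eq_full _ (tupR N) R (power_prob mu N) cube_set).
- exact: measurable_cube_set.
- exact: cube_set_full.
- apply/(measurable_restrictT _ mE).
  apply: (@measurable_funS _ _ _ _ setT) => //.
  apply/measurable_EFinP; apply: mM; last exact: mc.
  exact: measurable_exp_hamiltonian.
- by apply/measurable_EFinP; case: bR.
- move=> x cx; rewrite /patch (cube_point_id cx) -T_stat_variance.
  have [xE|xE] := boolP (x \in _).
    by rewrite (set_mem xE) mulr1 mulrC.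
  case: ltP => [xT|_]; last by rewrite mulr0 mulr0.
  by move/negP: xE; case; rewrite inE.
Qed.

End fixed_size.
End gibbs_measure.

Section operator_norm.
Context (R : realType) (N : nat).

Lemma opnorm_ge (M : 'M[R]_N) (v : 'cV[R]_N) :
  l2norm v <= 1 -> l2norm (M *m v) <= opnorm M.
Proof.
move=> v1; apply: ub_le_sup; last by exists v.
(* The supremum dominates its elements only if the set is bounded: coordinates of [w] are at most
   one in absolute value, so absolute row sums bound the image. *)
exists (Num.sqrt (\sum_i (\sum_j `|M i j|) ^+ 2)) => _ [w /= w1 <-].
have wj j : `|w j 0| <= 1.
  rewrite -sqrtr_sqr (le_trans _ w1)// ler_sqrt.
    rewrite (bigD1 j)//= lerDl; apply: sumr_ge0 => i _; exact: sqr_ge0.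
  by apply: sumr_ge0 => i _; exact: sqr_ge0.
rewrite ler_sqrt; last by apply: sumr_ge0 => i _; exact: sqr_ge0.
apply: ler_sum => i _; rewrite -real_normK ?num_real// ler_sqr ?nnegrE//; last first.
  by apply: sumr_ge0 => j _.
rewrite mxE (le_trans (ler_norm_sum _ _ _))//; apply: ler_sum => j _.
by rewrite normrM -[leRHS]mulr1 ler_wpM2l.
Qed.

(* The test vector is the normalized constant vector. *)
Lemma sq_sum_le_opnorm (A : 'I_N -> 'I_N -> 'I_N -> R) (tau : R) :
  interaction_tensor A -> (0 < N)%N -> 0 < tau ->
  opnorm (\sum_i slice A i *m slice A i) <= tau ->
  sq_sum A <= 2 * tau * N%:R.
Proof.
move=> A_int N0 tau0; set M := \sum_i _ => Mt.
have N0' : 0 < N%:R :> R by rewrite ltr0n.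
pose s := Num.sqrt (N%:R : R).
have s0 : 0 < s by rewrite sqrtr_gt0.
have ss : s ^+ 2 = N%:R by rewrite sqr_sqrtr// ltW.
pose v : 'cV[R]_N := const_mx s^-1.
have v1 : l2norm v <= 1.
  rewrite /l2norm (eq_bigr (fun=> s^-1 ^+ 2)); last by move=> i _; rewrite mxE.
  rewrite sumr_const card_ord -mulr_natl -ss exprVn mulfV ?sqrtr1//.
  by rewrite gt_eqF// exprn_gt0.
have H := le_trans (opnorm_ge M v1) Mt.
pose w i := (M *m v) i 0.
have w2 : \sum_i w i ^+ 2 <= tau ^+ 2.
  have S0 : 0 <= \sum_i w i ^+ 2 by apply: sumr_ge0 => i _; exact: sqr_ge0.
  by rewrite -(sqr_sqrtr S0) ler_sqr ?nnegrE ?sqrtr_ge0// ltW.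
(* Summing [A l i j * A l j k] over [i] and [k] gives the square of [pr A l j]. *)
have sumM : \sum_i \sum_k M i k = sq_sum A.
  transitivity (\sum_i \sum_k \sum_l \sum_j A l i j * A l j k).
    apply: eq_bigr => i _; apply: eq_bigr => k _; rewrite summxE.
    apply: eq_bigr => l _; rewrite mxE; apply: eq_bigr => j _.
    by rewrite !mxE.
  under eq_bigr do rewrite exchange_big/=.
  rewrite exchange_big/=; apply: eq_bigr => l _.
  under eq_bigr do rewrite exchange_big/=.
  rewrite exchange_big/=; apply: eq_bigr => j _.
  rewrite expr2 mulr_suml; apply: eq_bigr => i _.
  by rewrite mulr_sumr; apply: eq_bigr => k _; rewrite (tensor_sym23 A_int).
have sw : \sum_i w i = s^-1 * sq_sum A.
  rewrite -sumM mulr_sumr; apply: eq_bigr => i _; rewrite /w mxE mulr_sumr.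
  by apply: eq_bigr => k _; rewrite mxE mulrC.
(* This cutoff balances the two terms of [sum_cutoff]: each is at most [tau * s]. *)
have ts : 0 < tau / s by rewrite divr_gt0.
have sw2 : s^-1 * sq_sum A <= 2 * tau * s.
  rewrite -sw (le_trans (ler_norm _))// (le_trans (ler_norm_sum _ _ _))//.
  rewrite (le_trans (sum_cutoff w ts))// card_ord -ss.
  have : (tau / s)^-1 * \sum_i w i ^+ 2 <= (tau / s)^-1 * tau ^+ 2.
    by rewrite ler_wpM2l// invr_ge0 ltW.
  rewrite (_ : (tau / s)^-1 * tau ^+ 2 = tau * s); last by field; rewrite !gt_eqF.
  rewrite (_ : tau / s * s ^+ 2 = tau * s); last by field; rewrite gt_eqF.
  by move: (_ * \sum_i _) => z; lra.
rewrite ler_pdivrMl// in sw2; apply: (le_trans sw2).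
by rewrite -ss le_eqVlt; apply/orP; left; apply/eqP; ring.
Qed.

End operator_norm.

(** * Configurations with large variance are far from optimal *)

Section low_functional.
Context (R : realType) (km kp : R) (mu : probability (measurableTypeR R) R).
Hypothesis km_le_kp : km <= kp.
Context (C : R).
Hypotheses (km_geC : - C <= km) (kp_leC : kp <= C).
Hypothesis mu_itv : mu `[km, kp]%classic = 1%E.
Hypothesis supp_kp : supp mu kp.
Hypothesis mu_nonneg : stochastically_nonnegative mu.
Context (beta h gamma alpha delta : R).
Hypotheses (beta_gt0 : 0 < beta) (h_ge0 : 0 <= h) (gamma_ge0 : 0 <= gamma)
  (alpha_gt0 : 0 < alpha) (delta_gt0 : 0 < delta).
Hypothesis case_i_or_ii : 0 < h \/ 0 <= km.

Let C0 : 0 <= C := C_ge0 km_le_kp km_geC kp_leC.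

Lemma exists_small (M eps : R) : 0 <= M -> 0 < eps ->
  exists x, [/\ 0 < x, x <= 1 & M * x <= eps].
Proof.
move=> M0 e0; have M1 : 0 < M + 1 by rewrite ltr_wpDl.
exists (Num.min 1 (eps / (M + 1))); split.
- by rewrite lt_min ltr01 divr_gt0.
- by rewrite ge_min lexx.
- apply: (@le_trans _ _ (M * (eps / (M + 1)))).
    by rewrite ler_wpM2l// ge_min lexx orbT.
  by rewrite mulrA ler_pdivrMr// mulrC ler_wpM2l ?(ltW e0)// lerDl.
Qed.

(** The left-hand side is one competitor in the supremum defining the rate at [- s]; stochastic
    non-negativity passes to the rate at [s], where the supremum is attained at [t]. *)
Lemma reflected_rate (t s l : R) : s <= 0 -> tilt_mean km kp mu t = s ->
  l * - s - cumulant km kp mu l <= t * s - cumulant km kp mu t.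
Proof.
move=> s0 ts.
have := mu_nonneg (t := - s); rewrite oppr_ge0 opprK => /(_ s0) H.
rewrite -lee_fin -!(log_mgf_cumulant mu_itv).
apply: (@le_trans _ _ (rate mu (- s))).
  by apply: ereal_sup_ubound; exists l.
apply: (le_trans H); apply: ge_ereal_sup => _ [l' _ <-].
rewrite lee_fin !(log_mgf_cumulant mu_itv) -ts.
exact: (cumulant_tilt_ge mu km_le_kp km_geC kp_leC).
Qed.

Section fixed_size.
Context (N : nat) (A : 'I_N -> 'I_N -> 'I_N -> R).
Hypothesis A_int : interaction_tensor A.
Hypothesis rows_le : forall i, row_sum A i <= gamma.
Hypothesis rows_gt0 : forall i, 0 < row_sum A i.
Hypothesis N_gt0 : (0 < N)%N.
Hypothesis mean_ge : alpha <= mean_row_sum A.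
Context (s : seq R).
Hypothesis spectrum : is_spectrum (transition A) s.
Hypothesis spectral_gap : delta <= 1 - s`_1.

Lemma tensor_poincare (x : 'I_N -> R) (xbar : R) :
  \sum_i row_sum A i * (x i - xbar) = 0 ->
  2 * delta * (\sum_i row_sum A i * (x i - xbar) ^+ 2)
    <= \sum_i \sum_j pr A i j * (x i - x j) ^+ 2.
Proof.
move=> x0.
have -> : \sum_i \sum_j pr A i j * (x i - x j) ^+ 2 =
    \sum_i \sum_j pair_sum A i j * (x i - x j) ^+ 2.
  by apply: eq_bigr => i _; apply: eq_bigr => j _; rewrite mxE.
apply: (poincare (s := s)) => //.
- by apply/matrixP => i j; rewrite !mxE; exact: pr_sym.
- by move=> i; apply: eq_bigr => j _; rewrite mxE.
Qed.

Context (y : 'I_N -> R).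
Hypothesis y_cube : in_cube km kp y.

Let u := cond_mean km kp mu A beta h y.
Let I := conj_rate km kp mu A beta h y.
Let L := ln (Zc km kp mu A beta h).

Let u_le i : `|u i| <= C.
Proof.
apply: (cube_norm km_geC kp_leC).
exact: (cond_mean_cube mu km_le_kp km_geC kp_leC).
Qed.

Let site i : beta / 3 * (mean_row_sum A * `|u i| ^+ 3) + h * `|u i| - I i <= N%:R^-1 * L.
Proof.
apply: (site_bound_abs km_le_kp km_geC kp_leC A_int (ltW beta_gt0) h_ge0 N_gt0 supp_kp).
by move=> s' l s0; exact: reflected_rate.
Qed.

(** If [h = 0] then [km >= 0], all conditional means are nonnegative and [negative_mass] vanishes.
    Any positive number can then replace [h], and division by it stays legitimate. *)
Let h' := if 0 < h then h else 1.

Lemma negative_mass_le : h' * negative_mass u <= h * negative_mass u.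
Proof.
rewrite /h'; case: ifPn => [//|hN].
case: case_i_or_ii => [h0|km0]; first by rewrite h0 in hN.
suff -> : negative_mass u = 0 by rewrite !mulr0.
apply: big1 => i _; rewrite ger0_norm ?subrr//.
have /andP[u0 _] := cond_mean_cube mu km_le_kp km_geC kp_leC A beta h y i.
exact: le_trans km0 u0.
Qed.

Lemma negative_mass_ge0 : 0 <= negative_mass u.
Proof. by apply: sumr_ge0 => i _; rewrite subr_ge0 ler_norm. Qed.

Lemma cubic_variation_ge0 : 0 <= cubic_variation A u.
Proof.
apply: sumr_ge0 => i _; apply: sumr_ge0 => j _.
by rewrite mulr_ge0 ?exprn_ge0// pr_ge0.
Qed.

Context (e e' rho : R).
Hypotheses (e_gt0 : 0 < e) (e'_gt0 : 0 < e') (rho_gt0 : 0 < rho).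

(** Per-site bound for the right-hand side of [gibbs_functional_defect] when the gap and the
    irregularity are both at most [rho * N]. *)
Definition defect : R := rho * (1 + beta / 3 * C ^+ 3).

Hypothesis irr : irregularity A <= rho * N%:R.
Hypothesis irr2 : \sum_i (row_sum A i - mean_row_sum A) ^+ 2 <= rho * N%:R.
Hypothesis dev : field_dev km kp mu A beta h y <= rho * N%:R.
Hypothesis near_opt : L - rho * N%:R <= local_functional km kp mu A beta h y.

Lemma field_variance_near_opt :
  field_variance A y <= 3 * rho + 12 * C ^+ 3 * gamma ^+ 2 *
   (defect / h' + (e' + e'^-1 * (alpha^-1 * ((2 * delta)^-1 *
      (e ^+ 2 * gamma + e^-1 * (18 / beta * defect)) + C ^+ 2 * rho))))
   + 3 * C ^+ 4 * rho.
Proof.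
have N0 : 0 < N%:R :> R by rewrite ltr0n.
have h'0 : 0 < h' by rewrite /h'; case: ifPn.
have b3 : 0 <= beta / 3 by rewrite divr_ge0// ltW.
have C30 : 0 <= C ^+ 3 by rewrite exprn_ge0.
have D := gibbs_functional_defect A_int C0 beta_gt0 N_gt0 u_le site.
have Dle : L - gibbs_functional A beta h u I + beta / 3 * (C ^+ 3 * irregularity A)
    <= defect * N%:R.
  have := ler_wpM2l b3 (ler_wpM2l C30 irr).
  move: near_opt; rewrite /local_functional -/u -/I /defect.
  by move: (gibbs_functional _ _ _ _ _) (irregularity A) L (C ^+ 3) => f x l c; lra.
have {}D := le_trans D Dle.
have V1 : negative_mass u <= defect / h' * N%:R.
  rewrite mulrAC ler_pdivlMr// mulrC; apply: (le_trans negative_mass_le).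
  have b18 : 0 <= beta / 18 by rewrite divr_ge0// ltW.
  by have := mulr_ge0 b18 cubic_variation_ge0; move: D; move: (beta / 18 * _) => z; lra.
have S3 : cubic_variation A u <= 18 / beta * defect * N%:R.
  rewrite -[18 / beta]invf_div -mulrA ler_pdivlMl ?divr_gt0//.
  by have := mulr_ge0 h_ge0 negative_mass_ge0; move: D; move: (h * _) (beta / 18 * _) => z z'; lra.
have H := local_field_variance_le A_int C0 gamma_ge0 rows_le N_gt0 u_le
  alpha_gt0 delta_gt0 mean_ge tensor_poincare y e_gt0 e'_gt0.
rewrite /field_variance ler_pdivrMl//; apply: (le_trans H).
have K0 : 0 <= 12 * C ^+ 3 * gamma ^+ 2 by rewrite mulr_ge0 ?sqr_ge0// mulr_ge0.
have inner : negative_mass u + (e' * N%:R + e'^-1 * (alpha^-1 *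
    ((2 * delta)^-1 * (e ^+ 2 * (gamma * N%:R) + e^-1 * cubic_variation A u)
     + C ^+ 2 * irregularity A))) <=
   (defect / h' + (e' + e'^-1 * (alpha^-1 * ((2 * delta)^-1 *
      (e ^+ 2 * gamma + e^-1 * (18 / beta * defect)) + C ^+ 2 * rho)))) * N%:R.
  rewrite [leRHS]mulrDl lerD// [leRHS]mulrDl lerD2l -[leRHS]mulrA.
  rewrite ler_wpM2l ?invr_ge0 ?(ltW e'_gt0)// -[leRHS]mulrA.
  rewrite ler_wpM2l ?invr_ge0 ?(ltW alpha_gt0)// [leRHS]mulrDl lerD//; last first.
    by rewrite -[leRHS]mulrA ler_wpM2l// sqr_ge0.
  rewrite -[leRHS]mulrA ler_wpM2l ?invr_ge0 ?mulr_ge0 ?(ltW delta_gt0)//.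
  rewrite [leRHS]mulrDl -[X in _ <= X + _]mulrA lerD2l -[leRHS]mulrA.
  by rewrite ler_wpM2l ?invr_ge0 ?(ltW e_gt0).
have C40 : 0 <= 3 * C ^+ 4 by rewrite mulr_ge0// exprn_ge0.
have a1 := ler_wpM2l K0 inner.
have a2 := ler_wpM2l C40 irr2.
have a3 : 3 * \sum_i (lf A y i - lf A u i) ^+ 2 <= 3 * (rho * N%:R).
  by rewrite ler_pM2l.
move: (lerD (lerD a3 a1) a2) => /le_trans; apply.
rewrite le_eqVlt; apply/orP; left; apply/eqP.
by move: (defect / h' + _) (12 * _ * _) (C ^+ 4) => p q r; ring.
Qed.

End fixed_size.

(** Contraposition of [field_variance_near_opt]. The parameters are chosen in the order [e'], [e],
    [rho], each depending on the earlier ones through their inverses; [W] collects what is linear in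
    [rho]. Each choice contributes at most [eps / 4], and [rho] is uniform in [N] and [A]. *)
Lemma far_from_optimal (eps : R) : 0 < eps ->
  exists2 rho, 0 < rho & forall (N : nat) (A : 'I_N -> 'I_N -> 'I_N -> R) (s : seq R) y,
    interaction_tensor A -> (forall i, row_sum A i <= gamma) ->
    (forall i, 0 < row_sum A i) -> (0 < N)%N -> alpha <= mean_row_sum A ->
    is_spectrum (transition A) s -> delta <= 1 - s`_1 ->
    irregularity A <= rho * N%:R ->
    \sum_i (row_sum A i - mean_row_sum A) ^+ 2 <= rho * N%:R ->
    eps < `|field_variance A y| ->
    field_dev km kp mu A beta h y <= rho * N%:R ->
    local_functional km kp mu A beta h y <= ln (Zc km kp mu A beta h) - rho * N%:R.
Proof.
move=> eps0; pose M := 12 * C ^+ 3 * gamma ^+ 2.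
have C30 : 0 <= C ^+ 3 by rewrite exprn_ge0.
have M0 : 0 <= M by rewrite /M mulr_ge0 ?sqr_ge0// mulr_ge0.
have eps4 : 0 < eps / 4 by rewrite divr_gt0.
have [e' [e'0 e'1 Me']] := exists_small M0 eps4.
pose M1 := M * (e'^-1 * (alpha^-1 * ((2 * delta)^-1 * gamma))).
have M10 : 0 <= M1.
  rewrite /M1 mulr_ge0// mulr_ge0 ?invr_ge0 ?(ltW e'0)// mulr_ge0 ?invr_ge0 ?(ltW alpha_gt0)//.
  by rewrite mulr_ge0 ?invr_ge0// mulr_ge0// ltW.
have [e [e0 e1 M1e]] := exists_small M10 eps4.
pose h' := if 0 < h then h else 1 : R.
have h'0 : 0 < h' by rewrite /h'; case: ifPn.
pose g := 1 + beta / 3 * C ^+ 3.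
have g0 : 0 <= g by rewrite addr_ge0// mulr_ge0// divr_ge0// ltW.
pose W := 3 + M * (g / h' + e'^-1 * (alpha^-1 *
   ((2 * delta)^-1 * (e^-1 * (18 / beta * g)) + C ^+ 2))) + 3 * C ^+ 4.
have W0 : 0 <= W.
  rewrite /W addr_ge0 ?mulr_ge0 ?exprn_ge0// addr_ge0// mulr_ge0// addr_ge0//.
    by rewrite divr_ge0// ltW.
  rewrite mulr_ge0 ?invr_ge0 ?(ltW e'0)// mulr_ge0 ?invr_ge0 ?(ltW alpha_gt0)//.
  rewrite addr_ge0 ?sqr_ge0// mulr_ge0 ?invr_ge0 ?mulr_ge0 ?(ltW delta_gt0)//.
    by rewrite invr_ge0 ltW.
  by rewrite invr_ge0 ltW.
have [rho [rho0 _ Wrho]] := exists_small W0 eps4.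
exists rho => // N A s y A_int rows rows0 N0 mean spec gap irr irr2 big dev.
rewrite leNgt; apply/negP => /ltW near.
have := field_variance_near_opt A_int rows rows0 N0 mean spec gap e0 e'0
  irr irr2 dev near.
have fv0 : 0 <= field_variance A y.
  by rewrite mulr_ge0 ?invr_ge0//; apply: sumr_ge0 => i _; exact: sqr_ge0.
rewrite ger0_norm// in big; move=> /(lt_le_trans big); rewrite ltNge => /negP; apply.
rewrite /defect -/M -/h' -/g.
have e2 : e ^+ 2 <= e by rewrite expr2 -[leRHS]mulr1 ler_wpM2l// ltW.
have b1 := ler_wpM2l M10 e2.
have -> : 3 * rho + M * (rho * g / h' + (e' + e'^-1 * (alpha^-1 * ((2 * delta)^-1 *
    (e ^+ 2 * gamma + e^-1 * (18 / beta * (rho * g))) + C ^+ 2 * rho)))) + 3 * C ^+ 4 * rho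
  = M * e' + M1 * e ^+ 2 + W * rho.
  rewrite /M1 /W; move: (h'^-1) (e'^-1) (alpha^-1) ((2 * delta)^-1) (e^-1) (beta^-1).
  by move=> *; ring.
by move: Me' M1e Wrho b1; move: (M * e') (M1 * e) (M1 * _) (W * rho) => p q r t; lra.
Qed.

End low_functional.

(** * Asymptotics *)

Lemma mul_le_chain (R : realType) (q x t t' n f : R) : 0 <= q -> 0 <= n ->
  x <= 2 * t * n -> t <= t' -> q * 2 * t' <= f -> q * x <= f * n.
Proof.
move=> q0 n0 xt tt' qf.
apply: le_trans (ler_wpM2l q0 xt) _; apply: le_trans (ler_wpM2r n0 qf).
have -> : q * (2 * t * n) = q * 2 * t * n by ring.
by rewrite ler_wpM2r// ler_wpM2l// mulr_ge0.
Qed.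

Lemma expRN_le_inv (R : realType) (x : R) : 0 < x -> expR (- x) <= x^-1.
Proof.
move=> x0; rewrite expRN lef_pV2 ?posrE ?expR_gt0//.
by apply: le_trans (expR_ge1Dx x); rewrite lerDr.
Qed.

(** Here [s] stands for [sq_sum]. Its term need not decay like [1 / n] and is made small by [t']
    instead; all other terms are [O(1 / n)], where [4 / rho] comes from
    [2 * expR (c * n) <= 4 / (rho * n)]. *)
Lemma error_le (R : realType) (d k1 k2 s t t' n f rho c eta : R) :
  0 < n -> 0 < f -> 0 < rho -> 0 < eta -> 0 <= s -> s <= 2 * t * n -> t <= t' ->
  `|k1| * 2 / f * t' <= eta / 4 ->
  2 * ((`|d| + `|k2|) / f + 4 / rho) / eta <= n ->
  c <= - (rho / 2) ->
  d / (f * n) + (k1 * s + k2) / (f * n) + 2 * expR (c * n) <= eta.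
Proof.
move=> n0 f0 rho0 eta0 s0 st tt' te big cr.
have fn0 : 0 < f * n by rewrite mulr_gt0.
have ec : expR (c * n) <= (rho / 2 * n)^-1.
  apply: le_trans (expRN_le_inv _); last by rewrite !mulr_gt0.
  by rewrite ler_expR -mulNr ler_wpM2r// ltW.
have ks : k1 * s / (f * n) <= eta / 4.
  apply: le_trans te; rewrite ler_pdivrMr//.
  apply: (@le_trans _ _ (`|k1| * (2 * t * n))).
    apply: le_trans (ler_norm _) _.
    by rewrite normrM ler_wpM2l// ger0_norm.
  have -> : `|k1| * 2 / f * t' * (f * n) = `|k1| * (2 * t' * n).
    by field; rewrite gt_eqF.
  by rewrite ler_wpM2l// ler_wpM2r ?(ltW n0)// ler_wpM2l.
have {}big : ((`|d| + `|k2|) / f + 4 / rho) / n <= eta / 2.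
  rewrite ler_pdivrMr// in big *; move: big; rewrite ler_pdivrMr//.
  by move: (_ + _) (n * eta) (mulrC n eta) => x y xy; lra.
have dk : (d + k2) / (f * n) <= (`|d| + `|k2|) / f / n.
  rewrite -[leRHS]mulrA -invfM ler_wpM2r ?invr_ge0 ?(ltW fn0)//.
  by rewrite lerD ?ler_norm.
have -> : d / (f * n) + (k1 * s + k2) / (f * n) = (d + k2) / (f * n) + k1 * s / (f * n).
  by field; rewrite !gt_eqF.
have E : (rho / 2 * n)^-1 = 2 / rho / n by field; rewrite !gt_eqF.
have F : ((`|d| + `|k2|) / f + 4 / rho) / n = (`|d| + `|k2|) / f / n + 2 * (2 / rho / n).
  by field; rewrite !gt_eqF.
rewrite E in ec; rewrite F in big.
move: (expR _) (2 / rho / n) (_ / f / n) (k1 * s / _) ((d + k2) / _) ec ks big dk => a b c' d' e'.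
by lra.
Qed.

(** Since [expR (1 / 2) <= 2 <= N]. It converts a small multiple of [1 / ln N] into a small constant
    bound on the operator norm. *)
Lemma inv_ln_le2 (R : realType) (N : nat) : (2 <= N)%N -> `|(ln N%:R)^-1| <= 2 :> R.
Proof.
move=> N2; have N0 : 0 < N%:R :> R by rewrite ltr0n; exact: leq_trans N2.
have half : expR (2^-1) <= 2 :> R.
  have := expR_ge1Dx (- 2^-1 : R); rewrite expRN => H.
  have e_gt0 := expR_gt0 (2^-1 : R).
  have : 2^-1 * expR 2^-1 <= 1 :> R.
    have := ler_wpM2r (ltW e_gt0) H; rewrite mulVf ?gt_eqF//.
    by move: (expR _) => z; lra.
  by move: (expR _) => z; lra.
have lnh : 2^-1 <= ln N%:R :> R.
  rewrite -[leLHS]expRK ler_ln ?posrE ?expR_gt0//; apply: (le_trans half).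
  by rewrite (ler_nat R 2).
have ln0 : 0 < ln N%:R :> R by apply: lt_le_trans lnh.
by rewrite gtr0_norm ?invr_gt0// -[leRHS]invrK lef_pV2 ?posrE.
Qed.

Unset Implicit Arguments.

Theorem theorem1p13 (R : realType) (km kp : R) (km_lt_kp : km < kp)
  (mu : probability (measurableTypeR R) R)
  (mu_itv : mu `[km, kp]%classic = 1%E)
  (supp_km : supp mu km) (supp_kp : supp mu kp)
  (A : forall N : nat, 'I_N -> 'I_N -> 'I_N -> R)
  (A_tensor : forall N, interaction_tensor (A N))
  (gamma alpha delta : R)
  (gamma_gt0 : 0 < gamma) (alpha_gt0 : 0 < alpha) (delta_gt0 : 0 < delta)
  (bounded_rows : \forall N \near \oo, forall i, row_sum (A N) i <= gamma)
  (mean_field : (fun N => opnorm (\sum_i slice (A N) i *m slice (A N) i))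
     =o_\oo (fun N => (ln N%:R)^-1 : R))
  (asymptotically_regular :
     (fun N => \sum_i (row_sum (A N) i - mean_row_sum (A N)) ^+ 2)
     =o_\oo (fun N => N%:R : R))
  (nondegenerate : \forall N \near \oo,
     alpha <= mean_row_sum (A N) /\ forall i, 0 < row_sum (A N) i)
  (spectral_gap : \forall N \near \oo,
     exists2 s, is_spectrum (transition (A N)) s & delta <= 1 - s`_1)
  (mu_nonneg : stochastically_nonnegative mu)
  (beta0 h0 : R) (beta0_gt0 : 0 < beta0) (h0_ge0 : 0 <= h0)
  (case_i_or_ii : 0 < h0 \/ 0 <= km) :
  forall eps : R, 0 < eps ->
    gibbs (A N) mu beta0 h0 [set x | eps < `|T_stat (A N) x|] @[N --> \oo]
      --> 0%E.
Proof.
move=> eps eps0.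
pose C : R := `|km| + `|kp|.
have km_le_kp := ltW km_lt_kp.
have km_geC : - C <= km.
  by have := ler_norm (- km); have := normr_ge0 kp; rewrite normrN /C; lra.
have kp_leC : kp <= C by have := ler_norm kp; have := normr_ge0 km; rewrite /C; lra.
have C0 : 0 <= C by rewrite addr_ge0.
have beta0_ge0 := ltW beta0_gt0; have gamma_ge0 := ltW gamma_gt0.
have [rho rho0 far] := far_from_optimal km_le_kp km_geC kp_leC mu_itv supp_kp
  mu_nonneg beta0_gt0 h0_ge0 gamma_ge0 alpha_gt0 delta_gt0 case_i_or_ii eps0.
pose bound := field_bound C beta0 h0 gamma.
have bound0 : 0 <= bound by rewrite addr_ge0// mulr_ge0// mulr_ge0// sqr_ge0.
(* Coefficients of the terms of [exponent] that vanish with [e], after [e ^+ 2 <= e]; the final [1]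
   also forces [e <= rho / 8], hence [e ^+ 2 <= rho]. *)
pose M := 2 * beta0 / 3 + 2 * beta0 / 3 * C + 4 * C * beta0 + 1.
have b3 : 0 <= 2 * beta0 / 3 by rewrite divr_ge0// mulr_ge0.
have M0 : 0 <= M by rewrite /M !addr_ge0// ?mulr_ge0// mulr_ge0.
have rho8 : 0 < rho / 8 by rewrite divr_gt0.
have [e [e0 e1 Me]] := exists_small M0 rho8.
have e2e : e ^+ 2 <= e by rewrite expr2 -[leRHS]mulr1 ler_wpM2l// ltW.
have e2 : 0 < e ^+ 2 by rewrite exprn_gt0.
have e4 : 0 < e ^+ 4 by rewrite exprn_gt0.
(* Enough colours for the sampled sites to cost at most [rho / 8] per site. With the choice of [e],
   the exponent is at most [- 3 * rho / 4]. *)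
pose K := Num.bound (128 * C * bound / rho).
have K0 : 0 < K.+1%:R :> R by rewrite ltr0n.
have bK : 16 * C * bound / K.+1%:R <= rho / 8.
  have : 128 * C * bound / rho < K%:R.
    by apply: archi_boundP; rewrite divr_ge0 ?(ltW rho0)// mulr_ge0// mulr_ge0.
  rewrite ltr_pdivrMr// => H; rewrite ler_pdivrMr//.
  have : rho * K%:R <= rho * K.+1%:R by rewrite ler_wpM2l ?(ltW rho0)// ler_nat.
  by move: H; rewrite -!(mulrA _ C); move: (C * bound) => cb; lra.
pose P := 4 * C ^+ 3 * gamma ^+ 2.
pose k1 := 2 * C * (2 * C * P * field_dev_db C beta0 h0 gamma).
pose k2 := field_dev_const C beta0 h0 gamma 0.
have devE s : field_dev_const C beta0 h0 gamma s = k1 * s + k2.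
  by rewrite /k1 /k2 /field_dev_const /moment_const -/P; ring.
pose r N := Ex km kp mu (fun y => weight (A N) beta0 h0 y
    * (eps < `|field_variance (A N) y|)%R%:R) / Zc km kp mu (A N) beta0 h0.
have rE : (fun N => gibbs (A N) mu beta0 h0 [set x | eps < `|T_stat (A N) x|])
    = (fun N => (r N)%:E).
  by apply/funext => N; exact: gibbs_T_stat.
rewrite rE; apply: cvg_EFin; first by near=> N.
apply/(@cvgrPdist_le _ R^o) => eta eta0.
have eta4 : 0 < eta / 4 by rewrite divr_gt0.
have k10 : 0 <= `|k1| * 2 / e ^+ 4 by rewrite divr_ge0 ?(ltW e4)// mulr_ge0.
(* [tau1] limits the [sq_sum] part of the second moment to [eta / 4]; [tau2] below ensures
   [small_sq], so that half of the pairs of colourings are good. *)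
have [tau1 [tau10 _ tau1e]] := exists_small k10 eta4.
have q1 : 0 <= 16 * (K.+1%:R ^+ 3 * C ^+ 4) :> R.
  by rewrite !mulr_ge0// exprn_ge0// ltW.
have q3 := mulr_ge0 q1 (ler0n R 2).
have [tau2 [tau20 _ tau2e]] := exists_small q3 e2.
pose tau := Num.min tau1 tau2.
have tau0 : 0 < tau by rewrite lt_min tau10.
pose A0 := (`|dev_const C beta0 h0 gamma| + `|k2|) / e ^+ 4 + 4 / rho.
have A00 : 0 <= A0.
  by rewrite addr_ge0// divr_ge0 ?addr_ge0 ?(ltW e4) ?(ltW rho0).
(* The squared term is meant for [irregularity]: a cutoff at [rho / 2] converts squared deviations
   of the row sums into absolute ones. *)
pose rho' := Num.min rho ((rho / 2) ^+ 2).
have rho'0 : 0 < rho' by rewrite lt_min rho0 exprn_gt0// divr_gt0.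
have /eqoP mf := mean_field.
have /eqoP ar := asymptotically_regular.
have tau02 : 0 < tau / 2 by rewrite divr_gt0.
near=> N.
have N2 : (2 <= N)%N by near: N; exact: nbhs_infty_ge.
have N0 : (0 < N)%N by exact: leq_trans N2.
have N0' : 0 < N%:R :> R by rewrite ltr0n.
have rows : forall i, row_sum (A N) i <= gamma by near: N.
have [mean rows0] : alpha <= mean_row_sum (A N) /\ forall i, 0 < row_sum (A N) i by near: N.
have [s spec gap] : exists2 s, is_spectrum (transition (A N)) s & delta <= 1 - s`_1 by near: N.
have op : `|opnorm (\sum_i slice (A N) i *m slice (A N) i)| <= tau / 2 * `|(ln N%:R)^-1|.
  by near: N; exact: mf.
have reg : `|\sum_i (row_sum (A N) i - mean_row_sum (A N)) ^+ 2| <= rho' * `|N%:R|.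
  by near: N; exact: ar.
have big : 2 * A0 / eta <= N%:R by near: N; exact: nbhs_infty_ger.
have A_int := A_tensor N.
have lnN := inv_ln_le2 R N2.
have opt : opnorm (\sum_i slice (A N) i *m slice (A N) i) <= tau.
  apply: le_trans (ler_norm _) _; apply: le_trans op _.
  have := ler_wpM2l (ltW tau02) lnN; rewrite (_ : tau / 2 * 2 = tau)//.
  by rewrite divfK// pnatr_eq0.
have sq := sq_sum_le_opnorm A_int N0 tau0 opt.
have sq0 : 0 <= sq_sum (A N).
  by apply: sumr_ge0 => i _; apply: sumr_ge0 => j _; exact: sqr_ge0.
rewrite normr_nat in reg.
have Q0 : \sum_i (row_sum (A N) i - mean_row_sum (A N)) ^+ 2 <= rho' * N%:R.
  exact: le_trans (ler_norm _) reg.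
have Q1 : \sum_i (row_sum (A N) i - mean_row_sum (A N)) ^+ 2 <= rho * N%:R.
  by apply: (le_trans Q0); rewrite ler_wpM2r ?ler0n// ge_min lexx.
have irr : irregularity (A N) <= rho * N%:R.
  have rho2 : 0 < rho / 2 by rewrite divr_gt0.
  apply: le_trans (sum_cutoff (fun i => row_sum (A N) i - mean_row_sum (A N)) rho2) _.
  rewrite card_ord (_ : rho * N%:R = rho / 2 * N%:R + rho / 2 * N%:R); last by field.
  rewrite lerD2l ler_pdivrMl// mulrA -expr2; apply: (le_trans Q0).
  by rewrite ler_wpM2r ?ler0n// ge_min lexx orbT.
have erho : e ^+ 2 <= rho.
  apply: (le_trans e2e); have : e <= M * e.
    rewrite -[leLHS]mul1r ler_wpM2r ?(ltW e0)// /M lerDr !addr_ge0// ?mulr_ge0//.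
  by move=> /le_trans; apply; apply: (le_trans Me);
     rewrite ler_pdivrMr// ler_peMr ?(ltW rho0)// (ler_nat R 1 8).
have tau_le1 : tau <= tau1 by rewrite ge_min lexx.
have tau_le2 : tau <= tau2 by rewrite ge_min lexx orbT.
have small : small_sq C (A N) K e.
  have H := mul_le_chain q1 (ltW N0') sq tau_le2 tau2e.
  rewrite /small_sq (mulrA (_ ^+ 3)) (mulrA 16).
  exact: H.
have bX : bm km kp (fun y : 'I_N -> R => (eps < `|field_variance (A N) y|)%R%:R).
  by apply: bm_lt; [exact: bm_cst|apply: bm_norm; exact: bm_field_variance].
have Xlow y : in_cube km kp y -> eps < `|field_variance (A N) y| ->
    `|dev_sum km kp mu (A N) beta0 h0 y| <= e ^+ 2 * N%:R ->
    field_dev km kp mu (A N) beta0 h0 y <= e ^+ 2 * N%:R ->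
    local_functional km kp mu (A N) beta0 h0 y
      <= ln (Zc km kp mu (A N) beta0 h0) - rho * N%:R.
  move=> _ Xy _ fd; apply: (far _ _ s) => //.
  by apply: (le_trans fd); rewrite ler_wpM2r ?ler0n.
have H := bad_event_bound km_le_kp km_geC kp_leC A_int beta0_ge0 gamma_ge0 rows N0
  e0 bX Xlow small.
have Z0 := Zc_gt0 mu km_le_kp (A N) beta0 h0.
have rle : r N <= dev_const C beta0 h0 gamma / (e ^+ 4 * N%:R)
    + field_dev_const C beta0 h0 gamma (sq_sum (A N)) / (e ^+ 4 * N%:R)
    + 2 * expR (exponent C beta0 h0 gamma K rho e * N%:R).
  by rewrite /r ler_pdivrMr// mulrC.
have r0 : 0 <= r N.
  rewrite /r divr_ge0 ?(ltW Z0)//; apply: Ex_ge0 => //.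
    by apply: bmM => //; exact: bm_weight.
  by move=> y _; rewrite mulr_ge0 ?expR_ge0// ler0n.
rewrite sub0r normrN /= ger0_norm//; apply: (le_trans rle).
rewrite devE; apply: (error_le N0' e4 rho0 eta0 sq0 sq tau_le1 tau1e big).
rewrite /exponent; move: bK Me; rewrite -/bound /M.
have := ler_wpM2l b3 e2e; move: (2 * beta0 / 3) (16 * _ * _ / _) => b k.
by clear -e0 rho0 => H1 H2 H3; lra.
Unshelve. all: by end_near.
Qed.
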